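(* Let $\alpha\in(0,2)$, $\beta\in(0,1)$, $p\in\mathbb N$, let $F$ be an inter-renewal distribution satisfying the standing assumptions of the context, and let $\{X_k\}_{k\in\mathbb N_0}$ be the stable-regenerative multiple-stable process with parameters $\alpha,p$ and inter-renewal distribution $F$. Let $\boldsymbol\tau^{(1)},\dots,\boldsymbol\tau^{(p)}$ be i.i.d. non-delayed renewal processes with inter-renewal distribution $F$, let $\boldsymbol\eta=\bigcap_{r=1}^p\boldsymbol\tau^{(r)}$, set $\Theta^*_k=\mathbf 1_{\{k\in\boldsymbol\eta\}}$ for $k\in\mathbb N_0$, and let $\varepsilon$ be a Rademacher random variable independent of $\{\Theta^*_k\}_{k\in\mathbb N_0}$. Then for all $m\in\mathbb N$, as $x\to\infty$, $$\mathcal L\left(\frac{X_0}{|X_0|},\dots,\frac{X_m}{|X_0|}\;\middle|\;|X_0|>x\right)\to\mathcal L\left(\varepsilon\Theta_0^*,\dots,\varepsilon\Theta_m^*\right),$$ i.e. the conditional joint law on the left (given $|X_0|>x$) converges weakly to the joint law on the right.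
   Context: Notation: $\mathbb N=\{1,2,\dots\}$, $\mathbb N_0=\{0,1,2,\dots\}$. A Rademacher variable takes values $\pm1$ with probability $1/2$ each. Standing assumptions on $F$: $F$ is the cumulative distribution function of an $\mathbb N$-valued random variable with probability mass function $f$, such that $\overline F(x)=1-F(x)\sim \mathsf C_F x^{-\beta}$ as $x\to\infty$ for some constant $\mathsf C_F>0$ and $\beta\in(0,1)$, and $\sup_{n\in\mathbb N} nf(n)/\overline F(n)<\infty$. Renewal processes: a renewal process is the random set $\boldsymbol\tau=\{\tau_0,\tau_1,\dots\}\subset\mathbb N_0$ of its renewal times, where the increments $\tau_i-\tau_{i-1}$, $i\ge1$, are i.i.d. with distribution $F$ (independent of $\tau_0$). It is non-delayed if $\tau_0=0$, and delayed at $d$ if $\tau_0=d$. The stationary delay measure $\pi$ is the ($\sigma$-finite, infinite) measure on $\mathbb N_0$ with $\pi(\{k\})=\overline F(k)$. The stable-regenerative multiple-stable process: let $\sum_{i\ge1}\delta_{(y_i,d_i)}$ be a Poisson point process on $(0,\infty]\times\mathbb N_0$ with intensity measure $\alpha x^{-\alpha-1}dx\,d\pi$. Given it, let $\boldsymbol\tau^{(i,d_i)}$, $i\in\mathbb N$, be conditionally independent renewal processes with inter-renewal distribution $F$, the $i$-th one delayed at $d_i$. Let $\{\varepsilon_i\}_{i\in\mathbb N}$ be i.i.d. Rademacher variables independent of everything else. Then $\{X_k\}_{k\in\mathbb N_0}$ is the process with the (joint) law of $$X_k=\sum_{0<i_1<\cdots<i_p}\varepsilon_{i_1}\cdots\varepsilon_{i_p}\,y_{i_1}\cdots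 y_{i_p}\,\mathbf 1_{\{k\in\bigcap_{r=1}^p\boldsymbol\tau^{(i_r,d_{i_r})}\}},\quad k\in\mathbb N_0,$$ where for each $k$ the multiple series converges almost surely and unconditionally. *)

(* Defs.v *)
From HB Require Import structures.
From mathcomp Require Import all_boot all_order all_algebra.
From mathcomp Require Import all_classical all_reals all_analysis.
From mathcomp Require Import measurable_realfun.

Set Implicit Arguments.
Unset Strict Implicit.
Unset Printing Implicit Defensive.
Import Order.TTheory GRing.Theory Num.Theory.
Import numFieldNormedType.Exports.
Local Open Scope classical_set_scope.
Local Open Scope ring_scope.

Definition sigma_rv d d' (T : measurableType d) (T' : measurableType d')
    (X : T -> T') : set (set T) :=
  preimage_set_system [set: T] X measurable.

Definition sigma_rvs d d' (T : measurableType d) (T' : measurableType d')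
    (J : Type) (X : J -> T -> T') : set (set T) :=
  <<s \bigcup_(j in [set: J]) sigma_rv (X j) >>.

(* Meant for families [G] of sigma-algebras of measurable sets. *)
Definition mutually_independent d (T : measurableType d) (R : realType)
    (P : probability T R) (I : eqType) (G : I -> set (set T)) : Prop :=
  forall (J : seq I) (E : I -> set T), uniq J ->
    (forall i, i \in J -> G i (E i)) ->
    fine (P (\bigcap_(i in [set` J]) E i)) = \prod_(i <- J) fine (P (E i)).

Definition has_law d d' (T : measurableType d) (T' : measurableType d')
    (R : realType) (P : probability T R) (X : T -> T')
    (nu : set T' -> \bar R) : Prop :=
  forall B, measurable B -> pushforward P X B = nu B.

Definition rademacher d (T : measurableType d) (R : realType)
    (P : probability T R) (eps : T -> R) : Prop :=
  P (eps @^-1` [set 1]) = (2^-1)%:E /\ P (eps @^-1` [set -1]) = (2^-1)%:E.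

Definition borel_rV (R : realType) (n : nat) :=
  g_sigma_algebraType (@open 'rV[R]_n).

Definition law d (T : measurableType d) (R : realType) (P : probability T R)
    (n : nat) (V : T -> 'rV[R]_n) : set (borel_rV R n) -> \bar R :=
  pushforward P (V : T -> borel_rV R n).

(* Since [0^-1 = 0], this is the zero measure (not a probability) when
   [P A = 0]. *)
Definition cond_law d (T : measurableType d) (R : realType)
    (P : probability T R) (A : set T) (n : nat) (V : T -> 'rV[R]_n) :
    set (borel_rV R n) -> \bar R :=
  fun B => (P (V @^-1` B `&` A) * ((fine (P A))^-1)%:E)%E.

Definition weak_cvg (R : realType) (n : nat) (I : Type)
    (mu : I -> set (borel_rV R n) -> \bar R) (F : set_system I)
    (mu0 : set (borel_rV R n) -> \bar R) : Prop :=
  forall g : 'rV[R]_n -> R, continuous g ->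
    (exists M : R, forall v, `|g v| <= M) ->
    (\int[mu i]_v (g v)%:E)%E @[i --> F] --> (\int[mu0]_v (g v)%:E)%E.

(* The inter-renewal distribution F is represented by its law [nu] on [nat];
   the distribution function has a real argument. *)

Definition pmf_of (R : realType) (nu : probability nat R) (n : nat) : R :=
  fine (nu [set n]).

Definition cdf_of (R : realType) (nu : probability nat R) (x : R) : R :=
  fine (nu [set n : nat | n%:R <= x]).

Definition tail_of (R : realType) (nu : probability nat R) (x : R) : R :=
  1 - cdf_of nu x.

Definition interrenewal_law (R : realType) (beta : R) (nu : probability nat R)
    : Prop :=
  [/\ nu [set 0%N] = 0%E,
      (exists2 C : R, 0 < C &
        tail_of nu x / (C * x `^ (- beta)) @[x --> +oo] --> (1 : R)) &
      has_ubound [set n%:R * pmf_of nu n / tail_of nu n%:R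
                 | n in [set n | (0 < n)%N]]].

(* The renewal times [tau_0 = d] and [tau_i = tau_(i-1) + step_(i-1)]. *)
Definition renewal_set (delay : nat) (step : nat -> nat) : set nat :=
  range (fun n => (delay + \sum_(j < n) step j)%N).

(* The intensity [alpha * x^(-alpha-1) dx] on (0, +oo] does not charge the
   point at infinity, so it is defined on subsets of [R]. *)
Definition stable_measure (R : realType) (alpha : R) (A : set R) : \bar R :=
  (\int[lebesgue_measure]_(x in A `&` `]0%R, +oo[)
      (alpha * x `^ (- alpha - 1))%:E)%E.

(* The product of [stable_measure alpha] and of the stationary delay measure
   [pi {k} = tail_of nu k], computed through the sections of [A]. *)
Definition stable_delay_intensity (R : realType) (alpha : R)
    (nu : probability nat R) (A : set (R * nat)) : \bar R :=
  (\sum_(0 <= k <oo)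
      (tail_of nu k%:R)%:E * stable_measure alpha [set x | A (x, k)])%E.

Definition point_count (R : realType) d d' (T : measurableType d)
    (S : measurableType d') (z : nat -> T -> S) (A : set S) (w : T) : \bar R :=
  counting [set i | A (z i w)].

(* [\sum_i \delta_(z i)] is a Poisson point process with intensity [mu].
   The Poisson weights are written out because the library's [poisson_pmf 0]
   is constantly 1. *)
Definition poisson_point_process d d' (T : measurableType d)
    (S : measurableType d') (R : realType) (P : probability T R)
    (mu : set S -> \bar R) (z : nat -> T -> S) : Prop :=
  [/\ (forall A, measurable A -> (mu A < +oo)%E -> forall k : nat,
         P (point_count R z A @^-1` [set (k%:R)%:E]) =
         (expR (- fine (mu A)) * fine (mu A) ^+ k / k`!%:R)%:E),
      (forall A, measurable A -> mu A = +oo%E ->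
         P (point_count R z A @^-1` [set +oo%E : \bar R]) = 1%E) &
      (forall (n : nat) (A : 'I_n -> set S), (forall j, measurable (A j)) ->
         trivIset [set: 'I_n] A ->
         mutually_independent P
           (fun j => sigma_rv (point_count R z (A j) : T -> \bar R)))].

(* The source of randomness [inl tt] is the whole sequence of points
   [(y_i, d_i)], [inr (inl (i, j))] is the [j]-th step of the [i]-th renewal
   process, and [inr (inr i)] is the [i]-th sign. *)
Definition sources d (T : measurableType d) (R : realType)
    (y : nat -> T -> R) (delay : nat -> T -> nat)
    (step : nat -> nat -> T -> nat) (eps : nat -> T -> R)
    (s : unit + (nat * nat + nat)) : set (set T) :=
  match s with
  | inl _ => sigma_rvs (fun i w => (y i w, delay i w))
  | inr (inl ij) => sigma_rv (step ij.1 ij.2)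
  | inr (inr i) => sigma_rv (eps i)
  end.

Definition series_term d (T : measurableType d) (R : realType)
    (y : nat -> T -> R) (delay : nat -> T -> nat)
    (step : nat -> nat -> T -> nat) (eps : nat -> T -> R)
    (p : nat) (k : nat) (t : p.-tuple nat) (w : T) : R :=
  (\prod_(i <- t) eps i w) * (\prod_(i <- t) y i w) *
  \1_(\bigcap_(i in [set` t]) renewal_set (delay i w) (fun j => step i j w)) k.

(* Almost sure unconditional convergence: for every (deterministic) enumeration
   [e] of the increasing [p]-tuples of indices, the partial sums converge
   almost surely to the same limit. The exceptional null set may depend on [e];
   a null set common to all [e] would amount to absolute convergence, which
   fails for [1 <= alpha]. *)
Record multiple_stable_series (R : realType) (alpha : R) (p : nat)
    (nu : probability nat R) d (T : measurableType d) (P : probability T R)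
    (y : nat -> {RV P >-> R}) (delay : nat -> {RV P >-> nat})
    (step : nat -> nat -> {RV P >-> nat}) (eps : nat -> {RV P >-> R})
    (X : nat -> {RV P >-> R}) : Prop := {
  series_points_gt0 : forall i w, 0 < y i w ;
  series_points_poisson : poisson_point_process P
    (stable_delay_intensity alpha nu) (fun i w => (y i w, delay i w)) ;
  series_step_law : forall i j, has_law P (step i j) nu ;
  series_sign_law : forall i, rademacher P (eps i) ;
  series_independent : mutually_independent P
    (sources (fun i => y i : T -> R) (fun i => delay i : T -> nat)
       (fun i j => step i j : T -> nat) (fun i => eps i : T -> R)) ;
  series_cvg : forall (k : nat) (e : nat -> p.-tuple nat),
    set_bij [set: nat] [set t : p.-tuple nat | sorted ltn t] e ->
    {ae P, forall w,
      \sum_(0 <= l < n)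
        series_term (fun i => y i : T -> R) (fun i => delay i : T -> nat)
          (fun i j => step i j : T -> nat) (fun i => eps i : T -> R)
          k (e l) w @[n --> \oo] --> X k w}
}.

(* [X] has the finite-dimensional distributions of the multiple series, which
   may live on another probability space. *)
Definition multiple_stable_process (R : realType) (alpha : R) (p : nat)
    (nu : probability nat R) d (T : measurableType d) (P : probability T R)
    (X : nat -> {RV P >-> R}) : Prop :=
  exists (d' : measure_display) (T' : measurableType d')
    (P' : probability T' R)
    (y : nat -> {RV P' >-> R}) (delay : nat -> {RV P' >-> nat})
    (step : nat -> nat -> {RV P' >-> nat}) (eps : nat -> {RV P' >-> R})
    (X' : nat -> {RV P' >-> R}),
    multiple_stable_series alpha p nu y delay step eps X' /\
    forall n : nat, has_law P
      ((fun w => \row_(k < n) X k w) : T -> borel_rV R n)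
      (law P' (fun w => \row_(k < n) X' k w)).

Definition theta_star d (T : measurableType d) (R : realType) (p : nat)
    (step : 'I_p -> nat -> T -> nat) (k : nat) (w : T) : R :=
  \1_(\bigcap_(r in [set: 'I_p]) renewal_set 0 (fun j => step r j w)) k.

(* Main.v *)
Require Import Defs.
From HB Require Import structures.
From mathcomp Require Import all_boot all_order all_algebra.
From mathcomp Require Import all_classical all_reals all_analysis.
From mathcomp Require Import measurable_realfun.
From mathcomp Require Import ring lra zify.
Set Implicit Arguments.
Unset Strict Implicit.
Unset Printing Implicit Defensive.
Import Order.TTheory GRing.Theory Num.Theory.
Import numFieldNormedType.Exports.
Local Open Scope classical_set_scope.
Local Open Scope ring_scope.

(** The event that [|X 0|] exceeds a high level [x] is caused by a single large
term of the series. Write [p = q.+1]. Only the points with delay [0] can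
contribute to [X 0], and their sizes form a Poisson process with intensity
[alpha * y^(-alpha-1) dy]. For [2 ^+ N <= x < 2 ^+ N.+1] put
[Psi = (2 `^ (- alpha)) ^+ N * N.+1%:R ^+ q]; this is the order of the tail of
a product of [p] independent sizes, where the power of [N] counts the ways of
splitting the dyadic level [N] among [p] factors.

Some [p]-tuple of points with delay [0] has a product above [x] with
probability at least a constant times [Psi] ([large_event_ge]). Let
[theta = 2 ^- a * x] up to a factor [2], with [a] large. The following events
have probabilities that are small in comparison with [Psi]
([bad_event_bound]): two [p]-tuples of large points have products above
[theta] ([pair_event_le]), or fewer than [p] large points already have such a
product ([low_event_le]), since each loses a factor [N]; the product lies
within a factor [1 + delta] of [x] ([strip_event_le]), which costs a factor
[delta]; and the terms of the tuples whose large entries have a product of at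
most [theta] add up to more than [delta * x] ([far_event_le]). The last bound
is Chebyshev's inequality: the independent signs make these terms orthogonal,
and as [alpha < 2] the second moment of their sum is at most a small multiple
of [x ^+ 2 * Psi], namely one of order [2 `^ (- (2 - alpha) * a)].

Off these events everything is read off path by path ([path_structure]):
[|X 0|] exceeds [x] exactly when there is a main tuple [t], that is a unique
[p]-tuple of large points with delay [0] and product above [x], and then
[X k / |X 0|] is within [2 * delta] of the sign of [t] times the indicator
that all the renewal processes of [t] hit [k]. Being the main tuple depends on
the points alone, and the steps and the signs are independent of the points.
Given that [t] is the main tuple, its sign is therefore a Rademacher variable,
and its hitting indicators are those of the intersection of [p] independent
renewal processes started at [0] ([marks_law], [marked_event_law]). So the
conditional law of the ratios is, up to an error that can be made arbitrarily
small, the law of the limit ([conditional_mean_near], [limit_mean]). Finally,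
both the conditioning event and the ratios are functions of a finite row of
[X], so only the finite-dimensional laws of [X] matter ([same_rows_mean]). *)

(** * Counting tuples in disjoint cells; Poisson factorial moments *)

Section injective_lists.
Local Open Scope nat_scope.

Definition cell_ok (A : nat -> pred nat) (cs t : seq nat) :=
  all2 (fun c i => A c i) cs t.

Fixpoint inj_lists (A : nat -> seq nat) (cs : seq nat) : seq (seq nat) :=
  if cs is c :: cs' then
    [seq i :: t | t <- inj_lists A cs', i <- [seq i <- A c | i \notin t]]
  else [:: [::]].

Context (A : nat -> seq nat).
Hypothesis uA : forall c, uniq (A c).
Hypothesis dA : forall c c' i, i \in A c -> i \in A c' -> c = c'.

Lemma mem_inj_lists cs t :
  (t \in inj_lists A cs) = uniq t && cell_ok (fun c i => i \in A c) cs t.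
Proof.
elim: cs t => [|c cs IH] [|i t] //=.
- by rewrite andbF.
- by apply/negP => /allpairsPdep[t' [i' [_ _]]].
apply/allpairsPdep/idP => [[t' [i' [+ + [-> ->]]]]|].
  by rewrite mem_filter IH => /andP[-> ->] /andP[-> ->].
move=> /andP[/andP[it ut] /andP[iA ok]]; exists t, i; split => //.
  by rewrite IH ut.
by rewrite mem_filter it.
Qed.

Lemma count_cell_ok cs t c : cell_ok (fun c i => i \in A c) cs t ->
  count (fun i => i \in A c) t = count_mem c cs.
Proof.
elim: cs t => [|c' cs IH] [|i t] //= /andP[iA /IH ->]; congr addn.
case: eqP => [<-|/eqP cc']; first by rewrite iA.
by apply/eqP; rewrite eqb0; apply: contra cc' => iA'; rewrite (dA iA iA').
Qed.

Lemma size_inj_lists_cons c cs : size (inj_lists A (c :: cs)) =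
  (size (A c) - count_mem c cs) * size (inj_lists A cs).
Proof.
rewrite /= size_allpairs_dep.
rewrite sumnE big_map.
rewrite (eq_big_seq (fun=> size (A c) - count_mem c cs)).
  by rewrite big_const_seq count_predT iter_addn_0.
move=> t; rewrite mem_inj_lists => /andP[ut /(count_cell_ok c) <-].
rewrite size_filter -(count_predC [in t] (A c)) addnC.
suff -> : count [in t] (A c) = count (fun i => i \in A c) t by rewrite addnK.
rewrite -!size_filter; apply: perm_size; apply: uniq_perm.
- exact: filter_uniq.
- exact: filter_uniq.
- by move=> i; rewrite !mem_filter andbC.
Qed.

(** The entries can be chosen one cell at a time, and choosing [k] distinct
   entries of one cell in order gives a falling factorial. *)
Lemma size_inj_lists cs : size (inj_lists A cs) =
  \prod_(c <- undup cs) size (A c) ^_ (count_mem c cs).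
Proof.
elim: cs => [|c cs IH]; first by rewrite big_nil.
rewrite size_inj_lists_cons IH /=; case: ifPn => ccs.
  rewrite [RHS](bigD1_seq c) ?undup_uniq ?mem_undup//=.
  rewrite (bigD1_seq c) ?undup_uniq ?mem_undup//=.
  rewrite mulnA eqxx add1n ffactnSr [X in X * _ = _]mulnC; congr (_ * _).
  by apply: eq_bigr => c'; rewrite eq_sym => /negbTE ->.
rewrite big_cons eqxx (count_memPn ccs) subn0 ffactn1; congr (_ * _).
apply: eq_big_seq => c'; rewrite mem_undup => c'cs; case: eqP => // cc'.
by rewrite cc' c'cs in ccs.
Qed.

Lemma count_cell_ok_le (L : seq (seq nat)) cs : uniq L ->
  {in L, forall t, uniq t} ->
  count (cell_ok (fun c i => i \in A c) cs) L <=
  \prod_(c <- undup cs) size (A c) ^_ (count_mem c cs).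
Proof.
move=> uL Lu; rewrite -size_inj_lists -size_filter; apply: uniq_leq_size.
  exact: filter_uniq.
by move=> t; rewrite mem_filter mem_inj_lists => /andP[-> /Lu ->].
Qed.

End injective_lists.

Section poisson.
Context (R : realType).

Definition poisson_weight (m : R) (l : nat) : R := expR (- m) * m ^+ l / l`!%:R.

Lemma poisson_weight_ge0 m l : 0 <= m -> 0 <= poisson_weight m l.
Proof. by move=> m0; rewrite /poisson_weight !mulr_ge0 ?expR_ge0 ?exprn_ge0 ?invr_ge0. Qed.

Lemma poisson_weight_sum (m : R) : 0 <= m ->
  (\sum_(0 <= l <oo) (poisson_weight m l)%:E = 1)%E.
Proof.
move=> m0; apply/cvg_lim => //.
have -> : (fun n => \sum_(0 <= i < n) (poisson_weight m i)%:E)%E =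
  EFin \o (fun n => expR (- m) * series (exp_coeff m) n).
  apply/funext => n /=; rewrite sumEFin /series /= big_distrr /=.
  by congr EFin; apply: eq_bigr => i _; rewrite /poisson_weight -mulrA.
apply: cvg_EFin; first by near=> n.
have -> : 1 = expR (- m) * expR m by rewrite mulrC expRxMexpNx_1.
apply: cvgM; [exact: cvg_cst|].
exact: is_cvg_series_exp_coeff.
Unshelve. all: by end_near. Qed.

(** The factor [l ^_ k / l`!] is [1 / (l - k)`!], so the series is [m ^+ k]
   times the sum of the Poisson weights. *)
Lemma poisson_factorial_moment (m : R) k : 0 <= m ->
  (\sum_(0 <= l <oo) ((l ^_ k)%:R * poisson_weight m l)%:E = (m ^+ k)%:E)%E.
Proof.
move=> m0.
have ge0 l : (0 <= ((l ^_ k)%:R * poisson_weight m l)%:E)%E.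
  by rewrite lee_fin mulr_ge0 // poisson_weight_ge0.
rewrite (nneseries_split 0 k) // add0n big1_seq ?add0e; last first.
  move=> l /=; rewrite mem_index_iota => lk.
  by rewrite ffact_small ?mul0r //; case/andP: lk.
rewrite -(nneseries_addn k) //.
rewrite (eq_eseriesr (g := fun l => (m ^+ k)%:E * (poisson_weight m l)%:E)%E).
  rewrite nneseriesZl ?poisson_weight_sum ?mule1 // => l _ //.
  by rewrite lee_fin poisson_weight_ge0.
move=> l _; rewrite -EFinM; congr EFin.
rewrite /poisson_weight exprD.
have f0 j : (j`!%:R : R) != 0 by rewrite pnatr_eq0 -lt0n fact_gt0.
have := ffact_fact (leq_addl l k); rewrite addnK => /(congr1 (fun n => n%:R : R)).
rewrite natrM => <-.
have f1 : ((l + k) ^_ k)%:R != 0 :> R by rewrite pnatr_eq0 -lt0n ffact_gt0 leq_addl.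
field.
by rewrite f0 f1.
Qed.

End poisson.

(** * Tuples of Poisson points in prescribed cells *)

Section poisson_cells.
Context d d' (T : measurableType d) (S : measurableType d') (R : realType).
Context (P : probability T R) (mu : set S -> \bar R) (z : nat -> T -> S).
Hypothesis mz : forall i, measurable_fun setT (z i).
Hypothesis mu_ge0 : forall A, (0 <= mu A)%E.
Hypothesis ppp : poisson_point_process P mu z.

Lemma measurable_point_count A : measurable A ->
  measurable_fun setT (point_count R z A).
Proof.
move=> mA.
have -> : point_count R z A = fun w => (\sum_(n <oo) (\1_A (z n w))%:E)%E.
  by apply/funext => w; rewrite /point_count counting_dirac.
apply: ge0_emeasurable_sum => [n w _ _|n _]; first by rewrite lee_fin.
apply/measurable_EFinP; apply: measurableT_comp => //.
Qed.

Lemma measurable_point_count_eq A (k : \bar R) : measurable A ->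
  measurable (point_count R z A @^-1` [set k]).
Proof.
move=> mA; rewrite -[X in measurable X]setTI.
by apply: measurable_point_count => //; exact: emeasurable_set1.
Qed.

(** A Poisson process has independent counts for finite families of disjoint
   sets; this form fits cells indexed by all natural numbers. *)
Lemma point_count_indep_nat (C : nat -> set S) (D : nat -> set (\bar R))
  (v : seq nat) :
  (forall c, measurable (C c)) -> trivIset setT C -> uniq v ->
  (forall c, measurable (D c)) ->
  fine (P (\bigcap_(c in [set` v]) (point_count R z (C c) @^-1` D c))) =
  \prod_(c <- v) fine (P (point_count R z (C c) @^-1` D c)).
Proof.
move=> mC tC uv mD; have [_ _ ind] := ppp.
set n := (\max_(c <- v) c).+1.
have vn c : c \in v -> (c < n)%N by move=> cv; rewrite ltnS; exact: leq_bigmax_seq.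
pose A (j : 'I_n) := C j.
have tA : trivIset [set: 'I_n] A.
  by apply/trivIsetP => i j _ _ ij; move/trivIsetP : tC; apply.
pose J : seq 'I_n := [seq j <- enum 'I_n | val j \in v].
have memJ (j : 'I_n) : (j \in J) = (val j \in v) by rewrite mem_filter mem_enum andbT.
have uJ : uniq J by rewrite filter_uniq // enum_uniq.
have := ind n A (fun j => mC j) tA J
  (fun j => point_count R z (C j) @^-1` D j) uJ.
have -> : \bigcap_(i in [set` J]) (point_count R z (C i) @^-1` D i) =
   \bigcap_(c in [set` v]) (point_count R z (C c) @^-1` D c).
  apply/seteqP; split => w h c /= cv.
    by apply: (h (Ordinal (vn c cv))); rewrite /= memJ.
  by apply: h; rewrite /= -memJ.
move=> ->; last by move=> j _; exists (D j) => //; rewrite setTI.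
have vJ : perm_eq [seq val j | j <- J] v.
  apply: uniq_perm => //; first by rewrite map_inj_uniq //; exact: val_inj.
  move=> c; apply/mapP/idP => [[j + ->]|cv]; first by rewrite memJ.
  by exists (Ordinal (vn c cv)); rewrite // memJ.
by rewrite -(perm_big _ vJ) big_map.
Qed.

Context (C : nat -> set S).
Hypothesis mC : forall c, measurable (C c).
Hypothesis tC : trivIset setT C.
Hypothesis fC : forall c, (mu (C c) < +oo)%E.

Let m c : R := fine (mu (C c)).
Let m_ge0 c : 0 <= m c. Proof. exact: fine_ge0. Qed.
Let E c (l : nat) : set T := point_count R z (C c) @^-1` [set (l%:R)%:E].

Let mE c l : measurable (E c l). Proof. exact: measurable_point_count_eq. Qed.

Let PE c l : P (E c l) = (poisson_weight (m c) l)%:E.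
Proof. by have [h _ _] := ppp; rewrite h. Qed.

Let tE c : trivIset setT (E c).
Proof.
apply/trivIsetP => i j _ _ ij; apply/seteqP; split => // w []; rewrite /E /= => -> .
by move=> [] /eqP; rewrite eqr_nat (negbTE ij).
Qed.

Let PEv (l : nat -> nat) v : uniq v ->
  P (\bigcap_(c in [set` v]) E c (l c)) = (\prod_(c <- v) poisson_weight (m c) (l c))%:E.
Proof.
move=> uv; rewrite -[LHS]fineK ?fin_num_measure//; last first.
  exact: bigcap_measurableType.
rewrite (@point_count_indep_nat C (fun c => [set (l c)%:R%:E])) //.
congr EFin; apply: eq_bigr => c _; by rewrite PE.
Qed.

(** The count of a cell of finite intensity is almost surely finite, so its
   values split the space. *)
Let integral_split_count B c (f : T -> \bar R) : measurable B ->
  measurable_fun setT f -> (forall w, 0 <= f w)%E ->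
  (\int[P]_(w in B) f w = \sum_(0 <= l <oo) \int[P]_(w in B `&` E c l) f w)%E.
Proof.
move=> mB mf f0.
(* the null event of an infinite count in the cell [c] *)
pose N := ~` \bigcup_l E c l.
have mN : measurable N by apply/measurableC/bigcupT_measurable => l.
have PN : P N = 0%E.
  rewrite probability_setC ?measure_bigcup//=; last first.
    exact: bigcupT_measurable.
  under eq_eseriesl do rewrite in_setT.
  under eq_eseriesr do rewrite PE.
  by rewrite poisson_weight_sum // subee.
rewrite (@ge0_negligible_integral _ _ _ P B N f)//=; last exact: measurable_funTS.
rewrite (_ : B `\` N = \bigcup_l (B `&` E c l)); last first.
  by rewrite /N setDE setCK setI_bigcupr.
rewrite ge0_integral_bigcup //.
- by move=> l; exact: measurableI.
- exact: measurable_funTS.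
- exact: trivIset_setIl.
Qed.

Variables (L : seq (seq nat)).
Hypotheses (uL : uniq L) (Lu : {in L, forall t, uniq t}).

Definition in_cells (cs t : seq nat) : set T :=
  [set w | cell_ok (fun c i => `[< C c (z i w) >]) cs t].

Lemma measurable_in_cells cs t : measurable (in_cells cs t).
Proof.
elim: cs t => [|c cs IH] [|i t].
- by rewrite (_ : in_cells _ _ = setT) //; apply/seteqP; split.
- by rewrite (_ : in_cells _ _ = set0) //; apply/seteqP; split.
- by rewrite (_ : in_cells _ _ = set0) //; apply/seteqP; split.
rewrite (_ : in_cells _ _ = (z i @^-1` C c) `&` in_cells cs t).
  by apply: measurableI => //; rewrite -[X in measurable X]setTI; exact: mz.
apply/seteqP; split => w; rewrite /in_cells /=.
  by move=> /andP[/asboolP h h'].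
by move=> [h h']; apply/andP; split => //; apply/asboolP.
Qed.

Let cnt cs w := count (cell_ok (fun c i => `[< C c (z i w) >]) cs) L.

Let cntE cs w : (((cnt cs w)%:R : R)%:E = \sum_(t <- L) (\1_(in_cells cs t) w)%:E)%E.
Proof.
rewrite sumEFin /cnt -sum1_count natr_sum; congr EFin.
rewrite [RHS](bigID (cell_ok (fun c i => `[< C c (z i w) >]) cs)) /=.
rewrite [X in _ + X]big1 ?addr0.
  by apply: eq_bigr => t ok; rewrite indicE mem_set.
by move=> t ok; rewrite indicE memNset //; exact/negP.
Qed.

Let mcnt cs : measurable_fun setT (fun w => ((cnt cs w)%:R : R)%:E).
Proof.
under eq_fun do rewrite cntE.
apply: emeasurable_sum => t; apply/measurable_EFinP.
by apply: measurable_indic; exact: measurable_in_cells.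
Qed.

(** If the counts of the cells are known, then the tuples in [L] with profile
   [cs] are among the injective choices of points. *)
Let cnt_le cs l w : (\bigcap_(c in [set` undup cs]) E c (l c)) w ->
  (cnt cs w <= \prod_(c <- undup cs) (l c) ^_ (count_mem c cs))%N.
Proof.
move=> Ew.
have fin c : c \in cs -> finite_set [set i | C c (z i w)] /\
    size (finmap.enum_fset (fset_set [set i | C c (z i w)])) = l c.
  rewrite -mem_undup => /(Ew c); rewrite /E /point_count /counting /=.
  by case: ifPn => // /asboolP f [] /eqP; rewrite eqr_nat => /eqP.
pose A c : seq nat := if c \in cs then finmap.enum_fset (fset_set [set i | C c (z i w)]) else [::].
have memA c i : c \in cs -> (i \in A c) = `[< C c (z i w) >].
  move=> ccs; rewrite /A ccs in_fset_set ?inE //; by case: (fin c ccs).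
have uA c : uniq (A c) by rewrite /A; case: ifP => // _; exact: finmap.fset_uniq.
have dA c c' i : i \in A c -> i \in A c' -> c = c'.
  have [ccs|] := boolP (c \in cs); last by rewrite /A => /negbTE ->.
  have [ccs'|] := boolP (c' \in cs); last by rewrite /A => /negbTE ->.
  rewrite !memA // => /asboolP h /asboolP h'.
  by apply: (tC I I); exists (z i w).
rewrite /cnt (@eq_count _ _ (cell_ok (fun c i => i \in A c) cs)).
  apply: leq_trans (count_cell_ok_le uA dA cs uL Lu) _.
  rewrite leq_eqVlt; apply/orP; left; apply/eqP.
  apply: eq_big_seq => c; rewrite mem_undup => ccs; congr (_ ^_ _).
  by rewrite /A ccs; case: (fin c ccs).
move=> t; rewrite /cell_ok.
have : {subset cs <= cs} by [].
elim: {1 3 4}cs t => [|c s IH] [|i t] // sub /=.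
rewrite memA ?IH //; last by apply: sub; rewrite inE eqxx.
by move=> c' c's; apply: sub; rewrite inE c's orbT.
Qed.

(** The counts of the cells of [u] are integrated out one at a time, those of
   [v] being fixed; by independence each contributes a Poisson factorial
   moment, which is a power of the mean. *)
Let integral_cnt cs (u v : seq nat) (l : nat -> nat) : perm_eq (v ++ u) (undup cs) ->
  (\int[P]_(w in \bigcap_(c in [set` v]) E c (l c)) ((cnt cs w)%:R : R)%:E <=
   (\prod_(c <- v) ((l c ^_ count_mem c cs)%:R * poisson_weight (m c) (l c)) *
    \prod_(c <- u) m c ^+ count_mem c cs)%:E)%E.
Proof.
elim: u v l => [|c u IH] v l vu.
  rewrite big_nil mulr1.
  have vE : [set` v] = [set` undup cs].
    by apply/seteqP; split => c /=; rewrite -(perm_mem vu) cats0.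
  have uv : uniq v by have := undup_uniq cs; rewrite -(perm_uniq vu) cats0.
  rewrite big_split /= EFinM -PEv //.
  have mEv : measurable (\bigcap_(c in [set` v]) E c (l c)).
    exact: bigcap_measurableType.
  rewrite -(@integral_cst _ _ _ P _ mEv) //.
  apply: ge0_le_integral => //.
  - exact: measurable_funTS.
  move=> w Ew; rewrite lee_fin -natr_prod ler_nat.
  apply: leq_trans (cnt_le _) _; first by rewrite -vE; exact: Ew.
  by rewrite -(perm_big _ vu) cats0.
have := undup_uniq cs; rewrite -(perm_uniq vu) cat_uniq /= => /and3P[uv].
rewrite negb_or => /andP[cv _] _.
have vneq c' : c' \in v -> (c' == c) = false.
  by move=> c'v; apply/negbTE; apply: contraNneq cv => <-.
have mEv : measurable (\bigcap_(c in [set` v]) E c (l c)).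
  exact: bigcap_measurableType.
rewrite (integral_split_count c) //.
pose pv := \prod_(c0 <- v) ((l c0 ^_ count_mem c0 cs)%:R * poisson_weight (m c0) (l c0)).
pose pu := \prod_(c <- u) m c ^+ count_mem c cs.
have pv0 : 0 <= pv by apply: prodr_ge0 => i _; rewrite mulr_ge0 // poisson_weight_ge0.
have pu0 : 0 <= pu by apply: prodr_ge0 => i _; rewrite exprn_ge0.
apply: (@le_trans _ _ (\sum_(0 <= k <oo) (pv * pu)%:E *
    ((k ^_ count_mem c cs)%:R * poisson_weight (m c) k)%:E)%E).
  apply: lee_nneseries => k _; first by move=> *; apply: integral_ge0 => w _; rewrite lee_fin.
  pose l' c' := if c' == c then k else l c'.
  have := IH (rcons v c) l'; rewrite cat_rcons => /(_ vu).
  rewrite (_ : \bigcap_(c in [set` rcons v c]) E c (l' c) =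
      (\bigcap_(c in [set` v]) E c (l c)) `&` E c k); last first.
    apply/seteqP; split => w.
      move=> h; split; last by have := h c; rewrite /l' eqxx; apply; rewrite /= mem_rcons inE eqxx.
      by move=> c' /= c'v; have := h c'; rewrite /l' vneq //; apply; rewrite /= mem_rcons inE c'v orbT.
    move=> [h1 h2] c' /=; rewrite mem_rcons inE /l'; case: eqP => [->|] //= _ c'v.
    exact: h1.
  move=> /le_trans; apply; rewrite -EFinM lee_fin le_eqVlt; apply/orP; left; apply/eqP.
  rewrite -/pu big_rcons /= /l' eqxx.
  rewrite (_ : \prod_(i <- v) _ = pv); first by ring.
  by apply: eq_big_seq => c' /vneq ->.
rewrite nneseriesZl; last by move=> k _; rewrite lee_fin mulr_ge0 // poisson_weight_ge0.
rewrite poisson_factorial_moment // -EFinM lee_fin big_cons -/pv -/pu.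
by rewrite -mulrA [pu * _]mulrC.
Qed.

(** The expected number of tuples with a given profile of cells; because of the
   factorial moments no correction appears for repeated cells. It bounds the
   factorial moment measure of the process without computing it. *)
Lemma sum_in_cells_le cs :
  (\sum_(t <- L) P (in_cells cs t) <= (\prod_(c <- cs) m c)%:E)%E.
Proof.
have -> : (\sum_(t <- L) P (in_cells cs t) = \int[P]_w ((cnt cs w)%:R : R)%:E)%E.
  under eq_integral do rewrite cntE.
  rewrite ge0_integral_sum //.
  - by apply: eq_bigr => t _; rewrite integral_indic ?setIT //; exact: measurable_in_cells.
  - move=> t; apply/measurable_EFinP.
    by apply: measurable_indic; exact: measurable_in_cells.
have := @integral_cnt cs (undup cs) [::] (fun=> 0%N) (perm_refl _).
rewrite set_nil bigcap_set0 big_nil mul1r => /le_trans; apply.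
rewrite lee_fin le_eqVlt; apply/orP; left; apply/eqP.
elim: cs => [|c cs IH]; first by rewrite !big_nil.
rewrite big_cons /= -IH; case: ifPn => ccs.
  rewrite [LHS](bigD1_seq c) ?undup_uniq ?mem_undup//= eqxx add1n exprS.
  rewrite [X in _ = _ * X](bigD1_seq c) ?undup_uniq ?mem_undup//=.
  rewrite mulrA; congr (_ * _).
  by apply: eq_bigr => c'; rewrite eq_sym => /negbTE ->.
rewrite big_cons eqxx (count_memPn ccs) addn0 expr1; congr (_ * _).
apply: eq_big_seq => c'; rewrite mem_undup => c'cs; case: eqP => // cc'.
by rewrite cc' c'cs in ccs.
Qed.

End poisson_cells.

(** * Iterated sums over the cells of a tuple *)

Section iterated_sums.
Context (R : realType).
Implicit Types (F G : seq nat -> \bar R).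

(** The sum of [F cs] over all the profiles [cs] of length [q], as an iterated
   series: this matches the induction over the entries of a tuple. *)
Fixpoint isum (q : nat) F : \bar R :=
  if q is q'.+1 then (\sum_(0 <= c <oo) isum q' (fun cs => F (c :: cs)))%E
  else F [::].

Lemma isumS q F : isum q.+1 F = (\sum_(0 <= c <oo) isum q (fun cs => F (c :: cs)))%E.
Proof. by []. Qed.

Lemma isum_ge0 q F : (forall cs, (0 <= F cs)%E) -> (0 <= isum q F)%E.
Proof. by elim: q F => //= q IH F F0; apply: nneseries_ge0 => c _ _; apply: IH. Qed.

Lemma isum_le q F G : (forall cs, (0 <= F cs)%E) ->
  (forall cs, size cs = q -> (F cs <= G cs)%E) -> (isum q F <= isum q G)%E.
Proof.
elim: q F G => [|q IH] F G F0 FG /=; first exact: FG.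
apply: lee_nneseries => c _; first by move=> _; exact: isum_ge0.
by apply: IH => // cs sz; apply: FG; rewrite /= sz.
Qed.

Lemma eq_isum q F G : F =1 G -> isum q F = isum q G.
Proof. by move=> FG; congr isum; apply/funext. Qed.

Lemma isum_sum q I (r : seq I) (F : I -> seq nat -> \bar R) :
  (forall i cs, (0 <= F i cs)%E) ->
  isum q (fun cs => (\sum_(i <- r) F i cs)%E) = (\sum_(i <- r) isum q (F i))%E.
Proof.
elim: q F => //= q IH F F0.
under eq_eseriesr do rewrite IH //.
by rewrite nneseries_sum // => i c _; exact: isum_ge0.
Qed.

Lemma isumZl q F (x : R) : 0 <= x -> (forall cs, (0 <= F cs)%E) ->
  isum q (fun cs => (x%:E * F cs)%E) = (x%:E * isum q F)%E.
Proof.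
move=> x0; elim: q F => //= q IH F F0.
under eq_eseriesr do rewrite IH //.
by rewrite nneseriesZl // => c _; exact: isum_ge0.
Qed.

Lemma isum_ge q F cs : (forall cs, (0 <= F cs)%E) -> size cs = q ->
  (F cs <= isum q F)%E.
Proof.
elim: q F cs => [|q IH] F [|c cs] F0 //= [sz].
apply: le_trans (IH (fun cs => F (c :: cs)) _ _ sz) _ => //.
apply: le_trans (nneseries_lim_ge c.+1 _); last first.
  by move=> n _ _; exact: isum_ge0.
by rewrite big_nat_recr //= leeDr // sume_ge0 // => i _; exact: isum_ge0.
Qed.

Lemma integral_isum d (T : measurableType d) (P : {measure set T -> \bar R}) q
    (F : seq nat -> T -> \bar R) :
  (forall cs, measurable_fun setT (F cs)) -> (forall cs w, (0 <= F cs w)%E) ->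
  measurable_fun setT (fun w => isum q (F ^~ w)) /\
  (\int[P]_w isum q (F ^~ w) = isum q (fun cs => \int[P]_w F cs w))%E.
Proof.
elim: q F => [|q IH] F mF F0 /=; first by split.
have IHc c := IH (fun cs => F (c :: cs)) (fun cs => mF _) (fun cs => F0 _).
split.
  apply: ge0_emeasurable_sum => [c w _ _|c _]; first exact: isum_ge0.
  by have [] := IHc c.
rewrite integral_nneseries //.
- by apply: eq_eseriesr => c _; have [_] := IHc c.
- by move=> c; have [] := IHc c.
- by move=> c w _; exact: isum_ge0.
Qed.

Lemma nneseries_le_bound (u : nat -> \bar R) B : (forall n, (0 <= u n)%E) ->
  (forall n, (\sum_(0 <= c < n) u c <= B)%E) -> (\sum_(0 <= c <oo) u c <= B)%E.
Proof.
move=> u0 uB; have /ereal_nondecreasing_cvgn/cvg_lim -> // :=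
  @ereal_nondecreasing_series R u xpredT 0 (fun n _ _ => u0 n).
by apply: ub_ereal_sup => _ [n _ <-].
Qed.

End iterated_sums.

Section cell_functional.
Context d d' (T : measurableType d) (S : measurableType d') (R : realType).
Context (P : probability T R) (mu : set S -> \bar R) (z : nat -> T -> S).
Hypothesis mz : forall i, measurable_fun setT (z i).
Hypothesis mu_ge0 : forall A, (0 <= mu A)%E.
Hypothesis ppp : poisson_point_process P mu z.
Context (C : nat -> set S).
Hypothesis mC : forall c, measurable (C c).
Hypothesis tC : trivIset setT C.
Hypothesis fC : forall c, (mu (C c) < +oo)%E.

(** The first moment bound behind every upper estimate: a nonnegative functional
   of tuples of points that is dominated by a function [F] of their cells
   has expected sum at most the sum of [F] against the product of the
   intensities of the cells. *)
Lemma expectation_tuples_le (q : nat) (L : seq (seq nat)) (F : seq nat -> R)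
    (phi : seq nat -> T -> \bar R) :
  uniq L -> {in L, forall t, uniq t /\ size t = q} ->
  (forall cs, 0 <= F cs) ->
  {in L, forall t, measurable_fun setT (phi t)} ->
  (forall t w, (0 <= phi t w)%E) ->
  {in L, forall t w, phi t w = 0%E \/
     exists2 cs, in_cells z C cs t w & (phi t w <= (F cs)%:E)%E} ->
  (\sum_(t <- L) \int[P]_w phi t w <=
   isum q (fun cs => (F cs * \prod_(c <- cs) fine (mu (C c)))%:E))%E.
Proof.
move=> uL Lu F0 mphi phi0 H.
pose ind cs t w : \bar R := ((F cs)%:E * (\1_(in_cells z C cs t) w)%:E)%E.
have ind0 cs t w : (0 <= ind cs t w)%E by rewrite mule_ge0 // lee_fin.
have mi cs t : measurable_fun setT (fun w => (\1_(in_cells z C cs t) w : R)%:E).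
  by apply/measurable_EFinP/measurable_indic; exact: measurable_in_cells.
have mind cs t : measurable_fun setT (ind cs t).
  by apply: emeasurable_funM => //; exact: measurable_cst.
apply: (@le_trans _ _ (\sum_(t <- L) isum q (fun cs => (F cs)%:E * P (in_cells z C cs t)))%E).
  rewrite big_seq [leRHS]big_seq; apply: lee_sum => t tL.
  have [mis eis] := integral_isum P q (mind ^~ t) (fun cs w => ind0 cs t w).
  have -> : isum q (fun cs => (F cs)%:E * P (in_cells z C cs t))%E =
      (\int[P]_w isum q (fun cs => ind cs t w))%E.
    rewrite eis; apply: eq_isum => cs; rewrite /ind ge0_integralZl //.
    by rewrite integral_indic ?setIT //; exact: measurable_in_cells.
    by rewrite lee_fin.
  apply: ge0_le_integral => //.
  - exact: mphi.
  - move=> w _; case: (H t tL w) => [->|[cs csw le]]; first exact: isum_ge0.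
    apply: le_trans (isum_ge (cs := cs) _ _) => //.
      by rewrite /ind indicE mem_set // mule1.
    have [_ <-] := Lu t tL.
    by move: csw; rewrite /in_cells /cell_ok /= all2E => /andP[/eqP].
rewrite -isum_sum; last by move=> t cs; rewrite mule_ge0 // lee_fin.
apply: isum_le => cs; first by apply: sume_ge0 => t _; rewrite mule_ge0 // lee_fin.
move=> _; rewrite -ge0_sume_distrr //.
rewrite EFinM lee_wpmul2l ?lee_fin //.
by apply: (sum_in_cells_le mz mu_ge0 ppp mC tC fC) => // t /Lu[].
Qed.

End cell_functional.

(** * Sums over the levels of a tuple *)

Section geometric_sums.
Context (R : realType).
Implicit Types (rho : R).

Lemma sum_geom_le rho n : 0 < rho < 1 ->
  \sum_(0 <= c < n) rho ^+ c <= (1 - rho)^-1.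
Proof.
move=> /andP[r0 r1]; have d0 : 0 < 1 - rho by rewrite subr_gt0.
have -> : \sum_(0 <= c < n) rho ^+ c = (1 - rho ^+ n) / (1 - rho).
  elim: n => [|n IH]; first by rewrite big_geq // expr0 subrr mul0r.
  by rewrite big_nat_recr //= IH exprS; field; rewrite gt_eqF.
rewrite -[leRHS]mul1r ler_wpM2r ?invr_ge0 ?(ltW d0) //.
by rewrite gerBl exprn_ge0 // ltW.
Qed.

Lemma sum_geom_tail_le rho n S : 0 < rho < 1 ->
  \sum_(0 <= c < n | (S <= c)%N) rho ^+ c <= rho ^+ S / (1 - rho).
Proof.
move=> hr; have /andP[r0 r1] := hr.
have d0 : 0 < 1 - rho by rewrite subr_gt0.
have [nS|/ltnW Sn] := leqP n S.
  rewrite big1_seq; first by rewrite divr_ge0 ?exprn_ge0 // ltW.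
  move=> c; rewrite mem_index_iota => /andP[Sc /andP[_ cn]].
  by have := leq_trans cn (leq_trans nS Sc); rewrite ltnn.
rewrite -(subnK Sn) addnC.
rewrite (@big_cat_nat _ _ _ S) ?leq_addr //= big1_seq ?add0r; last first.
  move=> c; rewrite mem_index_iota => /andP[Sc /andP[_ cS]].
  by have := leq_ltn_trans Sc cS; rewrite ltnn.
rewrite -{1}[S]add0n [(S + _)%N]addnC big_addn addnK.
apply: (@le_trans _ _ (rho ^+ S * \sum_(0 <= c < n - S) rho ^+ c)).
  rewrite mulr_sumr big_mkcond /=; apply: ler_sum => c _.
  rewrite exprD mulrC; case: ifP => // _.
  by rewrite mulr_ge0 // exprn_ge0 // ltW.
by rewrite ler_wpM2l ?exprn_ge0 ?(ltW r0) // sum_geom_le.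
Qed.

Lemma sum_geom_deriv_le rho n : 0 < rho < 1 ->
  \sum_(0 <= c < n) (c.+1)%:R * rho ^+ c <= ((1 - rho) ^+ 2)^-1.
Proof.
move=> /andP[r0 r1]; have d0 : 0 < 1 - rho by rewrite subr_gt0.
have -> : \sum_(0 <= c < n) (c.+1)%:R * rho ^+ c =
    (1 - n.+1%:R * rho ^+ n + n%:R * rho ^+ n.+1) / (1 - rho) ^+ 2.
  elim: n => [|n IH]; first by rewrite big_geq // expr0 !mul0r mulr1 subrr addr0 mul0r.
  rewrite big_nat_recr //= IH !exprS -[n.+2%:R]natr1 -[n.+1%:R]natr1.
  by field; rewrite gt_eqF.
rewrite -[leRHS]mul1r ler_wpM2r ?invr_ge0 ?exprn_ge0 ?(ltW d0) //.
rewrite -addrA gerDl addrC subr_le0 exprS.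
apply: ler_pM; rewrite ?mulr_ge0 ?exprn_ge0 ?(ltW r0) ?ler_nat //.
by rewrite ler_piMl ?exprn_ge0 ?(ltW r0) // ltW.
Qed.

End geometric_sums.

Section tuple_sums.
Context (R : realType) (m : nat -> R) (K rho : R).
Hypothesis m_ge0 : forall c, 0 <= m c.
Hypothesis hr : 0 < rho < 1.
Hypothesis mK : forall c, m c <= K * rho ^+ c.

Let r0 : 0 < rho. Proof. by case/andP: hr. Qed.
Let d0 : 0 < 1 - rho. Proof. by rewrite subr_gt0; case/andP: hr. Qed.
Let K0 : 0 <= K. Proof. by have := le_trans (m_ge0 0) (mK 0); rewrite expr0 mulr1. Qed.
Let rX n : 0 <= rho ^+ n. Proof. by rewrite exprn_ge0 // ltW. Qed.

Let wt cs : R := \prod_(c <- cs) m c.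
Let wt_ge0 cs : 0 <= wt cs. Proof. exact: prodr_ge0. Qed.

(** In this section [m c] stands for the intensity of the cell of level [c], and
   [wt cs] for the expected number of tuples with levels [cs]. *)
Definition tail_mass q S : \bar R :=
  isum q (fun cs => ((S <= sumn cs)%N%:R * wt cs)%:E).

Let F0 (b : bool) cs : (0 <= (b%:R * wt cs)%:E)%E.
Proof. by rewrite lee_fin mulr_ge0. Qed.

Lemma tail_mass_ge0 q S : (0 <= tail_mass q S)%E.
Proof. by apply: isum_ge0. Qed.

Lemma tail_massS q S :
  tail_mass q.+1 S = (\sum_(0 <= c <oo) (m c)%:E * tail_mass q (S - c))%E.
Proof.
apply: eq_eseriesr => c _; rewrite -isumZl //; apply: eq_isum => cs.
rewrite -EFinM /wt big_cons /= leq_subLR.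
by congr EFin; ring.
Qed.

Lemma sum_leq_le n S (x : R) : 0 <= x ->
  \sum_(0 <= c < n | (c <= S)%N) x <= S.+1%:R * x.
Proof.
move=> x0; rewrite -big_filter big_const_seq count_predT iter_addr_0 -[leLHS]mulr_natl.
rewrite ler_wpM2r // ler_nat -[leqRHS](size_iota 0).
apply: uniq_leq_size; first by rewrite filter_uniq // iota_uniq.
by move=> c; rewrite mem_filter mem_iota ltnS => /andP[].
Qed.

(** The level [S] is split among [q.+1] entries: each of the about [S ^ q] ways
   has weight [rho ^+ S]. *)
Lemma tail_mass_le q : exists2 C : R, 0 <= C &
  forall S, (tail_mass q.+1 S <= (C * rho ^+ S * S.+1%:R ^+ q)%:E)%E.
Proof.
elim: q => [|q [C C0 IH]].
  exists (K / (1 - rho)); first by rewrite divr_ge0 // ltW.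
  move=> S; rewrite tail_massS /tail_mass /=.
  apply: nneseries_le_bound => [n|n].
    by rewrite -EFinM lee_fin !mulr_ge0.
  rewrite expr0 mulr1 sumEFin lee_fin.
  apply: (@le_trans _ _ (K * \sum_(0 <= c < n | (S <= c)%N) rho ^+ c)).
    rewrite mulr_sumr [leRHS]big_mkcond /=; apply: ler_sum => c _.
    rewrite /wt big_nil mulr1 leqn0 subn_eq0; case: ifP => _; last by rewrite mulr0.
    by rewrite mulr1.
  apply: le_trans (ler_wpM2l K0 (sum_geom_tail_le n S hr)) _.
  by rewrite le_eqVlt; apply/orP; left; apply/eqP; field; rewrite gt_eqF.
exists (K * C * (1 + (1 - rho)^-1)).
  by rewrite !mulr_ge0 // addr_ge0 // invr_ge0 ltW.
move=> S; rewrite tail_massS; apply: nneseries_le_bound => [n|n].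
  by rewrite mule_ge0 ?lee_fin // tail_mass_ge0.
apply: (@le_trans _ _ (\sum_(0 <= c < n)
   (K * C * ((c <= S)%N%:R * (rho ^+ S * S.+1%:R ^+ q) + (S <= c)%N%:R * rho ^+ c))%:E)%E).
  apply: lee_sum => c _.
  apply: (@le_trans _ _ ((K * rho ^+ c)%:E * (C * rho ^+ (S - c) * (S - c).+1%:R ^+ q)%:E)%E).
    by apply: lee_pmul => //; rewrite ?lee_fin ?tail_mass_ge0.
  rewrite -EFinM lee_fin.
  have [cS|/ltnW Sc] := leqP c S.
    rewrite mul1r mulrDr -[leLHS]addr0 lerD //; last by rewrite !mulr_ge0.
    have -> : rho ^+ S = rho ^+ (S - c) * rho ^+ c by rewrite -exprD subnK.
    set u := (S - c).+1%:R ^+ q.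
    rewrite [leLHS](_ : _ = K * C * (rho ^+ (S - c) * rho ^+ c * u)); last by rewrite /u; ring.
    rewrite ler_wpM2l ?mulr_ge0 // ler_wpM2l ?mulr_ge0 //.
    by rewrite lerXn2r ?nnegrE // ler_nat ltnS leq_subr.
  rewrite mul0r add0r Sc mul1r.
  have -> : (S - c)%N = 0%N by apply/eqP; rewrite subn_eq0.
  by rewrite expr0 expr1n; lra.
rewrite sumEFin lee_fin -mulr_sumr -!mulrA ler_wpM2l // ler_wpM2l //.
rewrite big_split /=.
apply: (@le_trans _ _ (S.+1%:R * (rho ^+ S * S.+1%:R ^+ q) + rho ^+ S / (1 - rho))).
  apply: lerD.
    apply: le_trans (sum_leq_le n S _); last by rewrite mulr_ge0 // exprn_ge0.
    rewrite [leRHS]big_mkcond; apply: ler_sum => c _ /=.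
    by case: ifP => _; rewrite ?mul1r ?mul0r.
  apply: le_trans (sum_geom_tail_le n S hr).
  rewrite [leRHS]big_mkcond; apply: ler_sum => c _ /=.
  by case: ifP => _; rewrite ?mul1r ?mul0r.
rewrite exprS mulrDl mul1r; apply: lerD.
  by rewrite le_eqVlt; apply/orP; left; apply/eqP; ring.
rewrite mulrC ler_wpM2l ?invr_ge0 ?(ltW d0) //.
by rewrite ler_peMr // -exprS exprn_ege1 // ler1n.
Qed.

(** The quotient is the power [q.-1] of [S.+1]; it covers [q = 0], in which case
   the left side vanishes for [0 < S]. *)
Lemma tail_mass_div_le q : exists2 C : R, 0 <= C &
  forall S, (tail_mass q S <= (C * rho ^+ S * (S.+1%:R ^+ q / S.+1%:R))%:E)%E.
Proof.
case: q => [|q].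
  exists 1 => // S; rewrite /tail_mass /= /wt big_nil leqn0 lee_fin.
  case: S => [|S] /=; first by rewrite !expr0; lra.
  by rewrite mul0r !mulr_ge0 // ?exprn_ge0 ?invr_ge0.
have [C C0 H] := tail_mass_le q; exists C => // S.
by apply: le_trans (H S) _; rewrite exprSr mulfK // pnatr_eq0.
Qed.

(** Two tuples that differ in one entry, of levels [i <= j]; the one with the
   lower level has total level at least [S]. *)
Definition pair_mass q S : \bar R :=
  isum q.+2 (fun cs => ((if cs is i :: j :: cs' then
    (i <= j)%N && (S <= i + sumn cs')%N else false)%:R * wt cs)%:E).

(** Summing over [j] from [i] on costs a further factor [rho ^+ i], so the level
   [i] is bounded in effect and only [q] entries are left to share [S]. This
   is one power of [S] less than for a single tuple of [q.+1] entries. *)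
Lemma pair_mass_le q : exists2 C : R, 0 <= C &
  forall S, (pair_mass q S <= (C * rho ^+ S * (S.+1%:R ^+ q / S.+1%:R))%:E)%E.
Proof.
have [C C0 H] := tail_mass_div_le q.
exists (K * (K / (1 - rho)) * C / (1 - rho) ^+ 2).
  by rewrite !mulr_ge0 // ?invr_ge0 ?exprn_ge0 // ltW.
move=> S; rewrite /pair_mass.
have step i j : isum q (fun cs => (((i <= j)%N && (S <= i + sumn cs)%N)%:R *
     wt [:: i, j & cs])%:E) = ((m i)%:E * (((i <= j)%N%:R * m j)%:E * tail_mass q (S - i)))%E.
  rewrite muleA -EFinM -isumZl ?mulr_ge0 //; apply: eq_isum => cs.
  rewrite -EFinM /wt !big_cons leq_subLR.
  by case: (i <= j)%N; case: (S <= _)%N => /=; congr EFin; ring.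
rewrite /=.
under eq_eseriesr do under eq_eseriesr do rewrite step.
apply: nneseries_le_bound => [i|n].
  by apply: nneseries_ge0 => j _ _; rewrite !mule_ge0 ?lee_fin ?mulr_ge0 ?tail_mass_ge0.
apply: (@le_trans _ _ (\sum_(0 <= i < n) (K * (K / (1 - rho)) * C *
   (rho ^+ S * (S.+1%:R ^+ q / S.+1%:R)) * (i.+1%:R * rho ^+ i))%:E)%E).
  apply: lee_sum => i _.
  rewrite nneseriesZl; last by move=> j _; rewrite !mule_ge0 ?lee_fin ?mulr_ge0 ?tail_mass_ge0.
  apply: (@le_trans _ _ ((K * rho ^+ i)%:E * ((K / (1 - rho) * rho ^+ i) *
     (C * rho ^+ (S - i) * ((S - i).+1%:R ^+ q / (S - i).+1%:R)))%:E)%E).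
    apply: lee_pmul; rewrite ?lee_fin //.
      by apply: nneseries_ge0 => j _ _; rewrite !mule_ge0 ?lee_fin ?mulr_ge0 ?tail_mass_ge0.
    apply: nneseries_le_bound => [j|k].
      by rewrite !mule_ge0 ?lee_fin ?mulr_ge0 ?tail_mass_ge0.
    rewrite -ge0_sume_distrl; last by move=> j _; rewrite lee_fin mulr_ge0.
    rewrite EFinM; apply: lee_pmul; rewrite ?tail_mass_ge0 //.
      by apply: sume_ge0 => j _; rewrite lee_fin mulr_ge0.
    rewrite sumEFin lee_fin.
    rewrite -mulrA [_^-1 * _]mulrC.
    apply: le_trans (ler_wpM2l K0 (sum_geom_tail_le k i hr)).
    rewrite mulr_sumr [leRHS]big_mkcond; apply: ler_sum => j _ /=.
    by case: ifP => _; rewrite ?mul1r ?mul0r.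
  rewrite -EFinM lee_fin.
  set a := K / (1 - rho); have a0 : 0 <= a by rewrite divr_ge0 // ltW.
  rewrite [leLHS](_ : _ = K * a * C * rho ^+ i * ((rho ^+ (S - i) * rho ^+ i) *
     ((S - i).+1%:R ^+ q / (S - i).+1%:R))); last by ring.
  rewrite [leRHS](_ : _ = K * a * C * rho ^+ i * (rho ^+ S *
     (S.+1%:R ^+ q * (i.+1%:R / S.+1%:R)))); last by ring.
  apply: ler_wpM2l; first by rewrite !mulr_ge0 // invr_ge0 ltW.
  apply: ler_pM.
  - by rewrite mulr_ge0.
  - by rewrite divr_ge0 // exprn_ge0.
  - rewrite -exprD ler_wiXn2l ?(ltW r0) //; first by rewrite -subr_ge0 ltW.
    by rewrite addnC -leq_subLR.
  apply: ler_pM; rewrite ?exprn_ge0 ?invr_ge0 //.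
    by rewrite lerXn2r ?nnegrE // ler_nat ltnS leq_subr.
  rewrite -[leLHS]mul1r ler_pdivrMr // mulrAC ler_pdivlMr // mul1r.
  by rewrite -natrM ler_nat; nia.
rewrite sumEFin lee_fin -mulr_sumr.
apply: le_trans (ler_wpM2l _ (sum_geom_deriv_le n hr)) _.
  by rewrite !mulr_ge0 // ?invr_ge0 ?exprn_ge0 // ltW.
by rewrite le_eqVlt; apply/orP; left; apply/eqP; ring.
Qed.

Lemma level_mass_le q s :
  (isum q.+1 (fun cs => ((sumn cs == s)%:R * wt cs)%:E) <=
   (K ^+ q.+1 * rho ^+ s * s.+1%:R ^+ q)%:E)%E.
Proof.
elim: q s => [|q IH] s.
  apply: nneseries_le_bound => [c|n] /=; first by rewrite lee_fin mulr_ge0.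
  rewrite sumEFin lee_fin expr0 mulr1 expr1.
  apply: (@le_trans _ _ (\sum_(0 <= c < n | c == s) K * rho ^+ s)).
    rewrite [leRHS]big_mkcond; apply: ler_sum => c _ /=.
    rewrite addn0; case: eqP => [->|_]; rewrite ?mul0r // mul1r /wt big_seq1 //.
  rewrite -big_filter big_const_seq count_predT iter_addr_0.
  rewrite -mulr_natr ler_piMr ?mulr_ge0 // lern1.
  rewrite size_filter (eq_count (a2 := pred1 s)) //.
  by rewrite count_uniq_mem ?iota_uniq // leq_b1.
rewrite isumS; apply: nneseries_le_bound => [c|n].
  by apply: isum_ge0 => cs; rewrite lee_fin mulr_ge0.
apply: (@le_trans _ _ (\sum_(0 <= c < n | (c <= s)%N)
     (K ^+ q.+2 * rho ^+ s * s.+1%:R ^+ q)%:E)%E).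
  rewrite [leRHS]big_mkcond; apply: lee_sum => c _.
  case: ifPn => [cs|]; last first.
    rewrite -ltnNge => sc.
    rewrite (@eq_isum _ q.+1 _ (fun=> 0%:E * 0%:E)%E) ?isumZl ?mul0e //.
    move=> cs /=; rewrite (_ : (c + sumn cs == s)%N = false) ?mul0r ?mule0 //.
    by apply/negbTE; rewrite neq_ltn (leq_trans sc (leq_addr _ _)) orbT.
  rewrite (@eq_isum _ q.+1 _ (fun cs0 => (m c)%:E * ((sumn cs0 == s - c)%N%:R * wt cs0)%:E)%E); last first.
    move=> cs0; rewrite /wt big_cons /= -EFinM.
    rewrite (_ : (c + sumn cs0 == s)%N = (sumn cs0 == s - c)%N); last lia.
    by congr EFin; ring.
  rewrite isumZl //.
  apply: (@le_trans _ _ ((K * rho ^+ c)%:E * (K ^+ q.+1 * rho ^+ (s - c) * (s - c).+1%:R ^+ q)%:E)%E).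
    apply: lee_pmul => //; rewrite ?lee_fin //.
    by apply: isum_ge0 => cs0; rewrite lee_fin mulr_ge0.
  have -> : rho ^+ s = rho ^+ (s - c) * rho ^+ c by rewrite -exprD subnK.
  rewrite -EFinM lee_fin [K ^+ q.+2]exprS.
  rewrite [leLHS](_ : _ = K * K ^+ q.+1 * (rho ^+ (s - c) * rho ^+ c) *
     (s - c).+1%:R ^+ q); last by ring.
  rewrite ler_wpM2l ?mulr_ge0 ?exprn_ge0 ?(ltW r0)//.
  by rewrite lerXn2r ?nnegrE // ler_nat ltnS leq_subr.
rewrite sumEFin lee_fin; apply: le_trans (sum_leq_le _ _ _) _.
  by rewrite mulr_ge0 ?exprn_ge0 // mulr_ge0 ?exprn_ge0 // ltW.
by rewrite le_eqVlt; apply/orP; left; apply/eqP; rewrite [s.+1%:R ^+ q.+1]exprS; ring.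
Qed.

End tuple_sums.

Section weighted_sums.
Context (R : realType) (a : nat -> R) (l : nat -> nat) (K sigma : R).
Hypothesis a_ge0 : forall c, 0 <= a c.
Hypothesis hs : 1 < sigma.
Hypothesis K0 : 0 <= K.
Hypothesis aK : forall j n, \sum_(0 <= c < n | l c == j) a c <= K * sigma ^+ j.

Let s0 : 0 < sigma. Proof. exact: lt_trans ltr01 hs. Qed.
Let sX n : 0 <= sigma ^+ n. Proof. by rewrite exprn_ge0 // ltW. Qed.
Let wt cs : R := \prod_(c <- cs) a c.
Let wt_ge0 cs : 0 <= wt cs. Proof. exact: prodr_ge0. Qed.

(** Here [a c] is the weight of the second moments of the cell [c] and [l c] its
   level; the weights grow geometrically with the level, whence bounds from
   above on the total level. *)
Definition low_mass q M : \bar R :=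
  isum q (fun cs => ((\sum_(c <- cs) l c <= M)%N%:R * wt cs)%:E).

Let sum_levels n M (h : nat -> R) :
  \sum_(0 <= c < n | (l c <= M)%N) a c * h (l c) =
  \sum_(0 <= j < M.+1) (\sum_(0 <= c < n | l c == j) a c) * h j.
Proof.
under [RHS]eq_bigr do rewrite mulr_suml big_mkcond.
rewrite exchange_big /= big_mkcond; apply: eq_bigr => c _.
case: leqP => lM.
  rewrite (bigD1_seq (l c)) ?iota_uniq ?mem_index_iota //= eqxx big1 ?addr0 //.
  by move=> j; rewrite eq_sym => /negbTE ->.
rewrite big1_seq // => j; rewrite mem_index_iota /= => jM.
by case: eqP => // lj; move: jM; rewrite -lj ltnS leqNgt lM.
Qed.

Lemma low_mass_le q : exists2 C : R, 0 <= C &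
  forall M, (low_mass q.+1 M <= (C * sigma ^+ M * M.+1%:R ^+ q)%:E)%E.
Proof.
elim: q => [|q [C C0 IH]].
  exists (K * (sigma / (sigma - 1))).
    by rewrite mulr_ge0 // divr_ge0 // ?subr_ge0 ltW.
  move=> M; rewrite /low_mass; apply: nneseries_le_bound => [c|n] /=.
    by rewrite lee_fin mulr_ge0.
  rewrite sumEFin lee_fin expr0 mulr1.
  apply: (@le_trans _ _ (\sum_(0 <= c < n | (l c <= M)%N) a c * 1)).
    rewrite [leRHS]big_mkcond; apply: ler_sum => c _ /=.
    by rewrite /wt !big_seq1 mulr1; case: ifP; rewrite ?mul1r ?mul0r.
  rewrite (sum_levels n M (fun=> 1)).
  apply: (@le_trans _ _ (\sum_(0 <= j < M.+1) K * sigma ^+ j)).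
    by apply: ler_sum => j _; rewrite mulr1.
  rewrite -mulr_sumr -!mulrA ler_wpM2l //.
  have d0 : 0 < sigma - 1 by rewrite subr_gt0.
  elim: M => [|M IHM].
    rewrite big_nat1 expr0 mulr1 ler_pdivlMr // mul1r; lra.
  rewrite big_nat_recr //=; apply: le_trans (lerD IHM (lexx _)) _.
  rewrite !exprS.
  by rewrite le_eqVlt; apply/orP; left; apply/eqP; field; rewrite gt_eqF.
exists (K * C); first by rewrite mulr_ge0.
move=> M; rewrite /low_mass; rewrite isumS; apply: nneseries_le_bound => [c|n].
  by apply: isum_ge0 => cs; rewrite lee_fin mulr_ge0.
apply: (@le_trans _ _ (\sum_(0 <= c < n | (l c <= M)%N)
     (a c * (C * sigma ^+ (M - l c) * (M - l c).+1%:R ^+ q))%:E)%E).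
  rewrite [leRHS]big_mkcond; apply: lee_sum => c _.
  case: ifPn => [lM|]; last first.
    rewrite -ltnNge => lM.
    rewrite (@eq_isum _ q.+1 _ (fun=> 0%:E * 0%:E)%E) ?isumZl ?mul0e //.
    move=> cs /=; rewrite big_cons leqNgt (leq_trans lM (leq_addr _ _)) /=.
    by rewrite mul0r.
  rewrite (@eq_isum _ q.+1 _ (fun cs0 => (a c)%:E *
      ((\sum_(c <- cs0) l c <= M - l c)%N%:R * wt cs0)%:E)%E); last first.
    move=> cs0; rewrite /wt !big_cons /= -EFinM leq_subRL // .
    by congr EFin; ring.
  rewrite isumZl //; last by move=> cs0; rewrite lee_fin mulr_ge0.
  rewrite EFinM lee_wpmul2l ?lee_fin //.
  exact: IH.
rewrite sumEFin lee_fin.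
rewrite (sum_levels n M (fun j => C * sigma ^+ (M - j) * (M - j).+1%:R ^+ q)).
apply: (@le_trans _ _ (\sum_(0 <= j < M.+1) K * C * sigma ^+ M * M.+1%:R ^+ q)).
  rewrite !big_seq; apply: ler_sum => j; rewrite mem_index_iota /= ltnS => jM.
  have -> : sigma ^+ M = sigma ^+ (M - j) * sigma ^+ j by rewrite -exprD subnK.
  apply: (@le_trans _ _ (K * sigma ^+ j * (C * sigma ^+ (M - j) * M.+1%:R ^+ q))).
    apply: ler_pM => //.
    - by rewrite sumr_ge0.
    - by rewrite !mulr_ge0 // exprn_ge0.
    rewrite ler_wpM2l ?mulr_ge0 // lerXn2r ?nnegrE // ler_nat ltnS leq_subr //.
  by rewrite le_eqVlt; apply/orP; left; apply/eqP; ring.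
rewrite sumr_const_nat subn0 -[leLHS]mulr_natl.
by rewrite le_eqVlt; apply/orP; left; apply/eqP; rewrite (exprS (M.+1%:R : R) q); ring.
Qed.

End weighted_sums.

(** * Independent signs *)

Lemma sigma_rvI d d' (T : measurableType d) (T' : measurableType d')
    (X : T -> T') : setI_closed (sigma_rv X).
Proof.
move=> _ _ [B mB <-] [B' mB' <-]; exists (B `&` B'); first exact: measurableI.
by rewrite !setTI preimage_setI.
Qed.

Lemma sigma_rvT d d' (T : measurableType d) (T' : measurableType d')
    (X : T -> T') : sigma_rv X setT.
Proof. by exists setT => //; rewrite setTI. Qed.

Lemma bounded_integrable d (T : measurableType d) (R : realType)
    (P : probability T R) (f : T -> R) (M : R) : measurable_fun setT f ->
  (forall w, `|f w| <= M) -> P.-integrable setT (EFin \o f).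
Proof.
move=> mf bf; apply: measurable_bounded_integrable => //.
  by rewrite (le_lt_trans (probability_le1 P measurableT)) ?ltry.
by exists M; split; [exact: num_real|move=> x Mx w _; exact: le_trans (bf w) (ltW Mx)].
Qed.

(** Both sides are the integral of the identity for the common image measure. *)
Lemma same_law_integral d d' (T : measurableType d) (T' : measurableType d')
    (R : realType) (P : probability T R) (P' : probability T' R)
    (U : T -> R) (V : T' -> R) (M : R) :
  measurable_fun setT U -> measurable_fun setT V ->
  (forall w, `|U w| <= M) -> (forall w, `|V w| <= M) ->
  (forall B, measurable B -> P (U @^-1` B) = P' (V @^-1` B)) ->
  (\int[P]_w (U w)%:E = \int[P']_w (V w)%:E)%E.
Proof.
move=> mU mV bU bV UV.
have tr e (S : measurableType e) (Q : probability S R) (W : S -> R)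
    (mW : measurable_fun setT W) : (forall w, `|W w| <= M) ->
    (\int[Q]_w (W w)%:E = \int[pushforward Q W]_x x%:E)%E.
  move=> bW; rewrite (@integral_pushforward _ _ _ _ _ _ mW Q _ (EFin : R -> \bar R)) //.
  exact: bounded_integrable mW bW.
rewrite !tr //; apply: eq_measure_integral => B mB _.
exact: UV.
Qed.

Section sign_sources.
Context d (T : measurableType d) (R : realType) (P : probability T R).
Context (y : nat -> T -> R) (delay : nat -> T -> nat)
  (step : nat -> nat -> T -> nat) (sg : nat -> T -> R).
Hypothesis my : forall i, measurable_fun setT (y i).
Hypothesis mdelay : forall i, measurable_fun setT (delay i).
Hypothesis mstep : forall i j, measurable_fun setT (step i j).
Hypothesis msg : forall i, measurable_fun setT (sg i).
Hypothesis sg1 : forall i w, sg i w = 1 \/ sg i w = -1.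
Hypothesis sg_half : forall i, P (sg i @^-1` [set 1]) = (2^-1)%:E.
Hypothesis ind : mutually_independent P (sources y delay step sg).

Local Notation src := (sources y delay step sg).
Local Notation idx := (unit + (nat * nat + nat))%type.

Lemma sources_measurable s A : src s A -> measurable A.
Proof.
have mrv d' (T' : measurableType d') (X : T -> T') B : measurable_fun setT X ->
    sigma_rv X B -> measurable B.
  by move=> mX [C mC <-]; exact: mX.
case: s => [[]|[[i j]|i]] /=; [|exact: mrv|exact: mrv].
apply: smallest_sub; first exact: sigma_algebra_measurable.
by move=> B [i _]; apply: mrv; exact: measurable_fun_pair.
Qed.

Let srcI s : setI_closed (src s).
Proof.
case: s => [[]|[[i j]|i]] /=; [|exact: sigma_rvI|exact: sigma_rvI].
move=> A B; exact: (@measurableI _ (g_sigma_algebraType _)).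
Qed.

Let srcT s : src s setT.
Proof.
case: s => [[]|[[i j]|i]] /=; [|exact: sigma_rvT|exact: sigma_rvT].
exact: (@measurableT _ (g_sigma_algebraType _)).
Qed.

(** A pi-system for the sigma-algebra of all the sources but the sign of [i]:
   intersections of events of finitely many of them. *)
Definition cylinders (i : nat) : set (set T) :=
  [set A | exists (J : seq idx) (E : idx -> set T),
     [/\ uniq J, inr (inr i) \notin J, (forall s, src s (E s)) &
         A = \bigcap_(s in [set` J]) E s]].

(** A copy of [T] that carries the sigma-algebra of all the sources but the sign
   of [i]; measurability on it is the precise form of not depending on this
   sign. *)
Definition but_sign i : Type := g_sigma_algebraType (cylinders i).
HB.instance Definition _ i := Measurable.on (but_sign i).

Lemma cylindersI i : setI_closed (cylinders i).
Proof.
move=> _ _ [J [E [uJ iJ sE ->]]] [J' [E' [uJ' iJ' sE' ->]]].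
exists (undup (J ++ J')), (fun s => (if s \in J then E s else setT) `&`
   (if s \in J' then E' s else setT)); split.
- exact: undup_uniq.
- by rewrite mem_undup mem_cat negb_or iJ.
- by move=> s; apply: srcI; case: ifP.
apply/seteqP; split => w.
  move=> [h h'] s _; split; case: ifP => // sJ; [exact: h|exact: h'].
move=> h; split => s /= sJ; have := h s; rewrite /= mem_undup mem_cat sJ ?orbT.
  by move=> /(_ isT)[].
by move=> /(_ isT)[].
Qed.

Lemma cylindersT i : cylinders i setT.
Proof.
exists [::], (fun=> setT); split => //.
by rewrite set_nil bigcap_set0.
Qed.

Lemma cylinders_measurable i : cylinders i `<=` measurable.
Proof.
move=> _ [J [E [_ _ sE ->]]]; apply: fin_bigcap_measurable => //.
by move=> s _; exact: sources_measurable (sE s).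
Qed.

Lemma but_sign_measurable i (A : set T) :
  measurable (A : set (but_sign i)) -> measurable A.
Proof.
apply: smallest_sub; first exact: sigma_algebra_measurable.
exact: cylinders_measurable.
Qed.

Lemma but_sign_source i s A : s != inr (inr i) -> src s A ->
  measurable (A : set (but_sign i)).
Proof.
move=> si sA; apply: sub_sigma_algebra; exists [:: s].
exists (fun s' => if s' == s then A else setT); split => //.
- by rewrite inE eq_sym.
- by move=> s'; case: eqP => [->|].
- apply/seteqP; split => w; last by move=> /(_ s); rewrite /= inE eqxx; exact.
  by move=> Aw s' /=; rewrite inE => /eqP ->; rewrite eqxx.
Qed.

Let D i : set T := sg i @^-1` [set 1].
Let mD i : measurable (D i).
Proof. by rewrite -[X in measurable X]setTI; exact: msg. Qed.

(** The measures [P (_ `&` D i)] and [2^-1 * P] agree on the cylinders by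
   independence, hence on the sigma-algebra that these generate. *)
Lemma half_of_but_sign i (A : set T) : measurable (A : set (but_sign i)) ->
  P (A `&` D i) = (2^-1 * fine (P A))%:E.
Proof.
move=> mA.
have h2 : 0 <= 2^-1 :> R by rewrite invr_ge0.
pose m1 : {measure set T -> \bar R} := mrestr P (mD i).
pose m2 : {measure set T -> \bar R} := mscale (NngNum h2) P.
have : m1 A = m2 A.
  apply: (@g_sigma_algebra_measure_unique _ _ _ (cylinders i)
    (@cylinders_measurable i) (fun=> setT)) => //.
  - by move=> _; exact: cylindersT.
  - by apply/seteqP; split => // w _; exists 0%N.
  - exact: cylindersI.
  - move=> _ [J [E [uJ iJ sE ->]]].
    rewrite -[LHS]/(P ((\bigcap_(s in [set` J]) E s) `&` D i)).
    rewrite -[RHS]/((2^-1)%:E * P (\bigcap_(s in [set` J]) E s))%E.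
    have mJ : measurable (\bigcap_(s in [set` J]) E s).
      apply: fin_bigcap_measurable; first exact: finite_seq.
      by move=> s _; exact: sources_measurable (sE s).
    pose E' s := if s == inr (inr i) then D i else E s.
    have srcD : src (inr (inr i)) (D i) by exists [set 1] => //; rewrite setTI.
    have := @ind (inr (inr i) :: J) E'; rewrite /= iJ uJ => /(_ isT).
    have -> : \bigcap_(s in [set` inr (inr i) :: J]) E' s =
        (\bigcap_(s in [set` J]) E s) `&` D i.
      rewrite /E'; apply/seteqP; split => w.
        move=> h; split; last by have := h (inr (inr i)); rewrite eqxx; apply; rewrite /= inE eqxx.
        move=> s /= sJ; have := h s; rewrite /= inE sJ orbT => /(_ isT).
        by case: eqP => // sE'; move: iJ; rewrite -sE' sJ.
      move=> [h h'] s /=; rewrite inE; case: eqP => //= _; exact: h.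
    have h : forall s, s \in inr (inr i) :: J -> src s (E' s).
      by move=> s _; rewrite /E'; case: eqP => [->|].
    move=> /(_ h); rewrite big_cons {1}/E' eqxx.
    rewrite -[X in _ = X -> _]/(_ * _) /D sg_half /= => e.
    rewrite -[LHS]fineK; last by apply: fin_num_measure; exact: (measurableI _ _ mJ (mD i)).
    rewrite -[X in _ = (_ * X)%E]fineK ?fin_num_measure // -EFinM; congr EFin.
    rewrite e; congr (_ * _); rewrite (ind uJ) //; apply: eq_big_seq => s sJ.
    by rewrite /E'; case: eqP => // sE'; move: iJ; rewrite -sE' sJ.
  - move=> _; rewrite -[X in (X < _)%E]/(P (setT `&` D i)) setTI.
    by apply: le_lt_trans (probability_le1 P (mD i)) _; rewrite ltry.
rewrite -[LHS]/(P (A `&` D i)) -[RHS]/((2^-1)%:E * P A)%E => ->.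
by rewrite EFinM fineK // fin_num_measure //; exact: but_sign_measurable mA.
Qed.

Let bs_mfun i (W : T -> R) : measurable_fun [set: but_sign i] (W : but_sign i -> R) ->
  measurable_fun [set: T] W.
Proof. by move=> mW _ B mB; apply: (@but_sign_measurable i); exact: mW. Qed.

Lemma compl_half_of_but_sign i (A : set T) : measurable (A : set (but_sign i)) ->
  P (A `&` ~` D i) = (2^-1 * fine (P A))%:E.
Proof.
move=> mA; have mA' := but_sign_measurable mA.
rewrite -setDE measureD //=; last by rewrite (le_lt_trans (probability_le1 P _)) ?ltry.
rewrite half_of_but_sign // -[P A]fineK ?fin_num_measure // -EFinB; congr EFin => /=.
by lra.
Qed.

(** The variables [W * \1_(D i)] and [W * \1_(~` D i)] have the same law, so
   their difference has mean [0]. *)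
Lemma sign_centered i (W : T -> R) (M : R) :
  measurable_fun [set: but_sign i] (W : but_sign i -> R) ->
  (forall w, `|W w| <= M) ->
  (\int[P]_w (sg i w * W w)%:E = 0)%E.
Proof.
move=> mWi bW; have mW := bs_mfun mWi.
pose U w : R := W w * \1_(D i) w.
pose V w : R := W w * \1_(~` D i) w.
have mU : measurable_fun setT U.
  by apply: measurable_funM => //; exact: measurable_indic.
have mV : measurable_fun setT V.
  by apply: measurable_funM => //; apply: measurable_indic; exact: measurableC.
have M0 : 0 <= M := le_trans (normr_ge0 _) (bW point).
have bU w : `|U w| <= M.
  rewrite /U normrM indicE; case: (_ \in _); rewrite ?normr1 ?mulr1 //.
  by rewrite normr0 mulr0.
have bV w : `|V w| <= M.
  rewrite /V normrM indicE; case: (_ \in _); rewrite ?normr1 ?mulr1 //.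
  by rewrite normr0 mulr0.
have UV : (\int[P]_w (U w)%:E = \int[P]_w (V w)%:E)%E.
  apply: (same_law_integral mU mV bU bV) => B mB.
  have mWB : measurable (W @^-1` B : set (but_sign i)).
    by rewrite -[X in measurable X]setTI; exact: mWi.
  have mZ : measurable ([set w | B 0] : set (but_sign i)).
    have [B0|B0] := pselect (B 0).
      by rewrite (_ : [set w | _] = setT) //; apply/seteqP; split.
    by rewrite (_ : [set w | _] = set0) //; apply/seteqP; split.
  have mWB' := but_sign_measurable mWB.
  have mZ' := but_sign_measurable mZ.
  have mDC : measurable (~` D i) by exact: measurableC.
  have -> : U @^-1` B = ((W @^-1` B) `&` D i) `|` ([set w | B 0] `&` ~` D i).
    apply/seteqP; split => w; rewrite /U /= indicE.
      by have [Dw|Dw] := pselect (D i w);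
        [rewrite mem_set // mulr1; left|rewrite memNset // mulr0; right].
    by move=> [[? ?]|[? ?]]; [rewrite mem_set // mulr1|rewrite memNset // mulr0].
  have -> : V @^-1` B = ((W @^-1` B) `&` ~` D i) `|` ([set w | B 0] `&` D i).
    apply/seteqP; split => w; rewrite /V /= indicE.
      have [Dw|Dw] := pselect (D i w);
        [rewrite memNset ?mulr0; [right|by []]|rewrite mem_set // mulr1; left] => //.
    by move=> [[? ?]|[? ?]]; [rewrite mem_set // mulr1|rewrite memNset ?mulr0].
  rewrite !measureU //; do ?exact: measurableI.
  - have h1 := half_of_but_sign mWB; have h2 := half_of_but_sign mZ.
    have h3 := compl_half_of_but_sign mWB; have h4 := compl_half_of_but_sign mZ.
    by rewrite [X in (X + _)%E]h1 [X in (_ + X)%E = _]h4 [X in (_ = X + _)%E]h3 [X in (_ = _ + X)%E]h2.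
  - by apply/seteqP; split => // w [[_ ?] [_ ?]].
  - by apply/seteqP; split => // w [[_ ?] [_ ?]].
have iU := bounded_integrable P mU bU.
have iV := bounded_integrable P mV bV.
under eq_integral => w _.
  have -> : sg i w * W w = U w - V w.
    rewrite /U /V !indicE; have [Dw|Dw] := pselect (D i w).
      by rewrite mem_set // memNset ?Dw /=; [rewrite mulr1 mulr0 subr0 mul1r|].
    rewrite memNset // mem_set //; case: (sg1 i w) => [/Dw//|->].
    by rewrite mulr0 mulr1 sub0r mulN1r.
  rewrite EFinB; over.
rewrite integralB_EFin // UV subee //.
exact: integrable_fin_num.
Qed.

Definition sign_of (t : seq nat) (w : T) : R := \prod_(i <- t) sg i w.

Lemma sign_of1 t w : sign_of t w = 1 \/ sign_of t w = -1.
Proof.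
rewrite /sign_of; elim: t => [|i t IH]; first by rewrite big_nil; left.
rewrite big_cons; case: (sg1 i w) => ->; case: IH => ->; rewrite ?mul1r ?mulN1r ?opprK; tauto.
Qed.

Lemma sign_of_norm t w : `|sign_of t w| = 1.
Proof. by case: (sign_of1 t w) => ->; rewrite ?normrN normr1. Qed.

Lemma measurable_sign_of_but i t : i \notin t ->
  measurable_fun [set: but_sign i] (sign_of t : but_sign i -> R).
Proof.
rewrite /sign_of; elim: t => [|j t IH].
  by move=> _; under eq_fun do rewrite big_nil; exact: measurable_cst.
rewrite inE negb_or => /andP[ij it]; under eq_fun do rewrite big_cons.
apply: measurable_funM; last exact: IH.
move=> _ B mB; apply: (@but_sign_source _ (inr (inr j))); last by exists B.
by apply: contra ij => /eqP[->].
Qed.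

Lemma measurable_sign_of t : measurable_fun setT (sign_of t).
Proof.
rewrite /sign_of; elim: t => [|j t IH].
  by under eq_fun do rewrite big_nil; exact: measurable_cst.
under eq_fun do rewrite big_cons.
by apply: measurable_funM.
Qed.

(** Cross terms vanish: two distinct tuples of the family differ by an index
   whose sign then occurs exactly once in the product. *)
Lemma second_moment (L : seq (seq nat)) (a : seq nat -> T -> R) (M : R) :
  uniq L -> {in L, forall t : seq nat, uniq t} ->
  {in L &, forall t t' : seq nat, t != t' -> exists2 i, i \in t & i \notin t'} ->
  (forall t i, measurable_fun [set: but_sign i] (a t : but_sign i -> R)) ->
  (forall t w, `|a t w| <= M) ->
  (\int[P]_w ((\sum_(t <- L) sign_of t w * a t w) ^+ 2)%:E =
   \sum_(t <- L) \int[P]_w ((a t w) ^+ 2)%:E)%E.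
Proof.
move=> uL Lu Ld ma ba.
have M0 : 0 <= M := le_trans (normr_ge0 _) (ba [::] point).
have ma' t : measurable_fun setT (a t) by exact: (@bs_mfun 0%N).
pose X t t' w := (sign_of t w * a t w) * (sign_of t' w * a t' w).
have mX t t' : measurable_fun setT (X t t').
  by do !apply: measurable_funM => //; exact: measurable_sign_of.
have bX t t' w : `|X t t' w| <= M * M.
  by rewrite /X !normrM !sign_of_norm !mul1r ler_pM.
have iX t t' : P.-integrable setT (EFin \o X t t').
  exact: bounded_integrable (mX t t') (bX t t').
have X0 t t' : t \in L -> t' \in L -> t != t' -> (\int[P]_w (X t t' w)%:E = 0)%E.
  move=> tL t'L tt'; have [i it it'] := Ld _ _ tL t'L tt'.
  pose W w := (sign_of (rem i t) w * sign_of t' w) * (a t w * a t' w).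
  transitivity (\int[P]_w (sg i w * W w)%:E)%E.
    apply: eq_integral => w _; congr EFin.
    have st : sign_of t w = sg i w * sign_of (rem i t) w.
      by rewrite /sign_of (perm_big _ (perm_to_rem it)) big_cons.
    by rewrite /X /W st; ring.
  apply: (@sign_centered _ _ (M * M)).
    apply: measurable_funM; apply: measurable_funM => //.
      apply: measurable_sign_of_but; rewrite mem_rem_uniqF //; exact: Lu.
    exact: measurable_sign_of_but.
  by move=> w; rewrite /W !normrM !sign_of_norm !mul1r ler_pM.
transitivity (\int[P]_w \sum_(t <- L) \sum_(t' <- L) (X t t' w)%:E)%E.
  apply: eq_integral => w _; rewrite expr2 mulr_suml -sumEFin; apply: eq_bigr => t _.
  by rewrite mulr_sumr -sumEFin.
rewrite integral_sum //; last by move=> t; apply: integrable_sum => // t' _; exact: iX.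
rewrite big_seq [RHS]big_seq; apply: eq_bigr => t tL.
rewrite integral_sum //; last by move=> t'; exact: iX.
rewrite (bigD1_seq t) //= [X in (_ + X)%E]big1_seq ?adde0.
  apply: eq_integral => w _; congr EFin; rewrite /X.
  by case: (sign_of1 t w) => ->; ring.
by move=> t' /andP[t't t'L]; rewrite X0 // eq_sym.
Qed.

Lemma measurable_point_but i j :
  measurable_fun [set: but_sign i] ((fun w => (y j w, delay j w)) : but_sign i -> _).
Proof.
move=> _ B mB; apply: (@but_sign_source _ (inl tt)) => //.
by apply: sub_sigma_algebra; exists j => //; exists B.
Qed.

Lemma measurable_step_but i j k :
  measurable_fun [set: but_sign i] (step j k : but_sign i -> nat).
Proof.
by move=> _ B mB; apply: (@but_sign_source _ (inr (inl (j, k)))) => //; exists B.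
Qed.

End sign_sources.

(** * The intensity of bounded delays and dyadic sizes *)

Section stable_intensity.
Context (R : realType) (alpha : R) (nu : probability nat R).
Hypothesis alpha0 : 0 < alpha.

Lemma powR_stable_le (a x : R) : 0 < a -> a <= x ->
  x `^ (- alpha - 1) <= a `^ (- alpha - 1).
Proof.
move=> a0 ax; have x0 := lt_le_trans a0 ax.
rewrite -opprD !powRN lef_pV2 ?posrE ?powR_gt0 //.
apply: ge0_ler_powR => //; rewrite ?nnegrE ?(ltW a0) ?(ltW x0) //.
by rewrite addr_ge0 // ltW.
Qed.

Let dens_ge0 (x : R) : (0 <= (alpha * x `^ (- alpha - 1))%:E)%E.
Proof. by rewrite lee_fin mulr_ge0 ?powR_ge0 // ltW. Qed.

Let measurable_dens (D : set R) :
  measurable_fun D (fun x : R => (alpha * x `^ (- alpha - 1))%:E).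
Proof.
apply: measurable_funTS; apply/measurable_EFinP; exact: measurable_funM.
Qed.

Lemma stable_measure_ge0 A : (0 <= stable_measure alpha A)%E.
Proof. by apply: integral_ge0. Qed.

Lemma stable_measure_mono (A B : set R) : measurable A -> measurable B ->
  A `<=` B -> (stable_measure alpha A <= stable_measure alpha B)%E.
Proof.
move=> mA mB AB; apply: ge0_subset_integral => //.
- exact: (measurableI _ _ mA (measurable_itv _)).
- exact: (measurableI _ _ mB (measurable_itv _)).
- exact: measurable_dens.
- exact: setSI.
Qed.

Let itv_stable (a c : R) : 0 < a ->
  [set x | a <= x < c] `&` `]0, +oo[ = `[a, c[%classic :> set R.
Proof.
move=> a0; apply/seteqP; split => x; rewrite /= !in_itv /= ?andbT; first by case.
by move=> h; split => //; apply: lt_le_trans a0 _; case/andP: h.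
Qed.

Let leb_itv (a c : R) : a <= c -> lebesgue_measure `[a, c[%classic = (c - a)%:E :> \bar R.
Proof.
move=> ac; rewrite lebesgue_measure_itv /= lte_fin.
by case: ltgtP ac => // -> _; rewrite subrr.
Qed.

Lemma stable_measure_itv_le (a c : R) : 0 < a -> a <= c ->
  (stable_measure alpha [set x | (a <= x < c)%R] <=
   ((c - a) * alpha * a `^ (- alpha - 1))%:E)%E.
Proof.
move=> a0 ac; rewrite /stable_measure itv_stable //.
apply: (@le_trans _ _ (\int[lebesgue_measure]_(x in `[a, c[) (alpha * a `^ (- alpha - 1))%:E)%E).
  apply: ge0_le_integral => //; try exact: measurable_dens.
  move=> x; rewrite /= in_itv /= => /andP[ax _].
  by rewrite lee_fin ler_wpM2l ?(ltW alpha0) // powR_stable_le.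
by rewrite integral_cst //= leb_itv // -EFinM lee_fin mulrC mulrA.
Qed.

Lemma stable_measure_itv_ge (a c : R) : 0 < a -> a <= c ->
  (((c - a) * alpha * c `^ (- alpha - 1))%:E <=
   stable_measure alpha [set x | (a <= x < c)%R])%E.
Proof.
move=> a0 ac; rewrite /stable_measure itv_stable //.
apply: (@le_trans _ _ (\int[lebesgue_measure]_(x in `[a, c[) (alpha * c `^ (- alpha - 1))%:E)%E).
  by rewrite integral_cst //= leb_itv // -EFinM lee_fin [leRHS]mulrC mulrA.
apply: ge0_le_integral => //; try exact: measurable_dens.
move=> x; rewrite /= in_itv /= => /andP[ax xc].
by rewrite lee_fin ler_wpM2l ?(ltW alpha0) // powR_stable_le ?(ltW xc)// (lt_le_trans a0).
Qed.

Lemma tail_of_ge0 x : 0 <= tail_of nu x.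
Proof.
by rewrite /tail_of subr_ge0 /cdf_of -lee_fin fineK ?fin_num_measure // probability_le1.
Qed.

Lemma tail_of_le1 x : tail_of nu x <= 1.
Proof. by rewrite /tail_of gerBl /cdf_of fine_ge0. Qed.

Lemma tail_of0 : nu [set 0%N] = 0%E -> tail_of nu 0%:R = 1.
Proof.
move=> nu0; rewrite /tail_of /cdf_of.
rewrite (_ : [set n | _] = [set 0%N]) ?nu0 ?subr0 //.
by apply/seteqP; split => n /=; [rewrite ler_nat leqn0 => /eqP|move=> ->].
Qed.

Local Notation mu := (stable_delay_intensity alpha nu).

Lemma intensity_ge0 A : (0 <= mu A)%E.
Proof.
apply: nneseries_ge0 => k _ _; rewrite mule_ge0 ?stable_measure_ge0 //.
by rewrite lee_fin tail_of_ge0.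
Qed.

Lemma measurable_level (A : set (R * nat)) k : measurable A ->
  measurable [set x | A (x, k)].
Proof.
move=> mA; rewrite (_ : [set x | _] = setT `&` (fun x => (x, k)) @^-1` A); last by rewrite setTI.
by apply: (measurable_fun_pair (@measurable_id _ _ setT) (@measurable_cst _ _ _ _ setT k)).
Qed.

Lemma intensity_mono (A B : set (R * nat)) : measurable A -> measurable B ->
  A `<=` B -> (mu A <= mu B)%E.
Proof.
move=> mA mB AB; apply: lee_nneseries => k _.
  by move=> _; rewrite mule_ge0 ?stable_measure_ge0 // lee_fin tail_of_ge0.
apply: lee_wpmul2l; first by rewrite lee_fin tail_of_ge0.
apply: stable_measure_mono; do ?exact: measurable_level.
by move=> x /=; exact: AB.
Qed.

Definition strip (lo hi : R) (k : nat) : set (R * nat) :=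
  [set z | (lo <= z.1 < hi) && (z.2 <= k)%N].

Lemma measurable_strip lo hi k : measurable (strip lo hi k).
Proof.
rewrite (_ : strip _ _ _ = (setT `&` fst @^-1` `[lo, hi[%classic) `&`
    (setT `&` snd @^-1` [set j | (j <= k)%N])).
  apply: measurableI; first exact: measurable_fst.
  exact: measurable_snd.
rewrite !setTI; apply/seteqP; split => -[x j]; rewrite /strip /= in_itv /=.
  by move=> /andP.
by move=> [-> ->].
Qed.

Lemma intensity_strip_le_stable (lo hi : R) k :
  (mu (strip lo hi k) <=
   k.+1%:R%:E * stable_measure alpha [set x | (lo <= x < hi)%R])%E.
Proof.
set B := stable_measure _ _; have B0 : (0 <= B)%E by exact: stable_measure_ge0.
apply: nneseries_le_bound => [n|n].
  by rewrite mule_ge0 ?stable_measure_ge0 // lee_fin tail_of_ge0.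
apply: (@le_trans _ _ (\sum_(0 <= j < n) ((j <= k)%N%:R)%:E * B)%E).
  apply: lee_sum => j _.
  case: leqP => jk; last first.
    rewrite (_ : [set x | _] = set0); last first.
      by apply/seteqP; split => // x; rewrite /strip /= leqNgt jk andbF.
    by rewrite /stable_measure set0I integral_set0 mule0 mul0e.
  rewrite (_ : [set x | _] = [set x | (lo <= x < hi)%R]); last first.
    by apply/seteqP; split => x; rewrite /strip /= jk andbT.
  apply: lee_pmul; rewrite ?stable_measure_ge0 ?lee_fin ?tail_of_ge0 //.
  exact: tail_of_le1.
rewrite -ge0_sume_distrl; last by move=> j _; rewrite lee_fin.
rewrite lee_wpmul2r // sumEFin lee_fin.
have := @sum_leq_le R n k 1 ler01; rewrite mulr1; apply: le_trans.
by rewrite [leRHS]big_mkcond; apply: ler_sum => j _; case: ifP.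
Qed.

Lemma intensity_strip_le (lo hi : R) k : 0 < lo -> lo <= hi ->
  (mu (strip lo hi k) <= (k.+1%:R * ((hi - lo) * alpha * lo `^ (- alpha - 1)))%:E)%E.
Proof.
move=> lo0 lohi; apply: le_trans (intensity_strip_le_stable _ _ _) _.
by rewrite [leRHS]EFinM lee_wpmul2l ?lee_fin // stable_measure_itv_le.
Qed.

Lemma intensity_strip_ge (lo hi : R) : nu [set 0%N] = 0%E -> 0 < lo -> lo <= hi ->
  (((hi - lo) * alpha * hi `^ (- alpha - 1))%:E <= mu (strip lo hi 0))%E.
Proof.
move=> nu0 lo0 lohi; apply: le_trans (stable_measure_itv_ge lo0 lohi) _.
apply: le_trans (nneseries_lim_ge 1 _); last first.
  by move=> n _ _; rewrite mule_ge0 ?stable_measure_ge0 // lee_fin tail_of_ge0.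
rewrite big_nat1 tail_of0 // mul1e.
rewrite (_ : [set x | _] = [set x | strip lo hi 0 (x, 0%N)]) //.
by apply/seteqP; split => x; rewrite /strip /= andbT.
Qed.

(** On the strip the density is at most its value at the left end, and each of
   the [k.+1] delays has mass at most [1]. *)
Lemma geometric_strip_le (b : R) n k : 1 <= b ->
  (mu (strip (b ^+ n) (b ^+ n.+1) k) <=
   (k.+1%:R * ((b - 1) * alpha) * (b `^ (- alpha)) ^+ n)%:E)%E.
Proof.
move=> b1; have b0 : 0 < b := lt_le_trans ltr01 b1.
apply: le_trans (intensity_strip_le _ _ _) _; rewrite ?exprn_gt0 //.
  by rewrite exprS ler_peMl // exprn_ge0 // ltW.
rewrite lee_fin -!mulrA ler_wpM2l // exprS -[X in _ - X]mul1r -mulrBl.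
rewrite -!mulrA ler_wpM2l ?subr_ge0 //.
rewrite [_ ^+ n * _]mulrC -mulrA ler_wpM2l ?(ltW alpha0) //.
rewrite -powR_mulrn ?(ltW b0) // -!powRrM -powRD; last by rewrite (gt_eqF b0) implybT.
rewrite -powR_mulrn ?powR_ge0 // -powRrM.
by rewrite le_eqVlt; apply/orP; left; apply/eqP; congr (_ `^ _); ring.
Qed.

Lemma geometric_strip_ge (b : R) n : nu [set 0%N] = 0%E -> 1 <= b ->
  ((((b - 1) * alpha * b `^ (- alpha - 1)) * (b `^ (- alpha)) ^+ n)%:E <=
   mu (strip (b ^+ n) (b ^+ n.+1) 0))%E.
Proof.
move=> nu0 b1; have b0 : 0 < b := lt_le_trans ltr01 b1.
apply: le_trans (intensity_strip_ge nu0 _ _); rewrite ?exprn_gt0 //; last first.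
  by rewrite exprS ler_peMl // exprn_ge0 // ltW.
rewrite lee_fin [X in _ <= (X - _) * _ * _]exprS -[X in _ <= (_ - X) * _ * _]mul1r -mulrBl.
rewrite -!mulrA ler_wpM2l ?subr_ge0 //.
rewrite [leRHS]mulrCA ler_wpM2l ?(ltW alpha0) //.
rewrite -!powR_mulrn ?powR_ge0 ?(ltW b0) // -!powRrM -!powRD; do ?by rewrite (gt_eqF b0) implybT.
rewrite le_eqVlt; apply/orP; left; apply/eqP; congr (_ `^ _).
by rewrite -natr1; ring.
Qed.

Lemma geometric_ratio_lt1 (b : R) : 1 < b -> 0 < b `^ (- alpha) < 1.
Proof.
move=> b1; have b0 := lt_trans ltr01 b1.
rewrite powR_gt0 //= powRN invf_lt1 ?powR_gt0 //.
have h : 1 `^ alpha = 1 :> R by rewrite powR1.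
rewrite -{1}h.
by apply: gt0_ltr_powR; rewrite // nnegrE ltW.
Qed.

(** The stable measure is finite away from [0]: dyadic pieces have geometrically
   decreasing masses. *)
Lemma intensity_dyadic_bounded :
  exists2 C : R, 0 <= C & forall M, (mu (strip 1 (2 ^+ M) 0) <= C%:E)%E.
Proof.
have b0 : 0 < 2 :> R by [].
pose r : R := 2 `^ (- alpha).
have r1 : 0 < r < 1 by apply: geometric_ratio_lt1; lra.
exists (alpha / (1 - r)).
  by rewrite divr_ge0 ?(ltW alpha0) // subr_ge0; case/andP: r1 => _ /ltW.
move=> M; apply: le_trans (intensity_strip_le_stable _ _ _) _; rewrite mul1e.
apply: (@le_trans _ _ (alpha * \sum_(0 <= n < M) r ^+ n)%:E); last first.
  by rewrite lee_fin ler_wpM2l ?(ltW alpha0) // sum_geom_le.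
have itvE (a c : R) : 0 < a -> stable_measure alpha [set x | (a <= x < c)%R] =
    (\int[lebesgue_measure]_(x in `[a, c[) (alpha * x `^ (- alpha - 1))%:E)%E.
  by move=> a0; rewrite /stable_measure itv_stable.
elim: M => [|M IH].
  rewrite big_geq // mulr0 expr0 (_ : [set x | _] = set0); last first.
    by apply/seteqP; split => // x /= /andP[x1 /(le_lt_trans x1)]; rewrite ltxx.
  by rewrite /stable_measure set0I integral_set0.
have M1 : 1 <= 2 ^+ M :> R by rewrite exprn_ege1 // ler1n.
have MM : 2 ^+ M <= 2 ^+ M.+1 :> R by rewrite exprS ler_peMl ?ler1n // (le_trans ler01).
rewrite itvE // (_ : `[1, 2 ^+ M.+1[%classic =
    `[1, 2 ^+ M[%classic `|` `[2 ^+ M, 2 ^+ M.+1[%classic :> set R); last first.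
  apply/seteqP; split => x; rewrite /= !in_itv /=.
    by move=> /andP[x1 xM]; case: (ltP x (2 ^+ M)) => xM'; [left|right]; rewrite ?x1.
  by move=> [/andP[-> /lt_le_trans ->]//|/andP[/(le_trans M1) -> ->]].
have disj : [disjoint `[1, 2 ^+ M[%classic & `[2 ^+ M, 2 ^+ M.+1[%classic : set R].
  rewrite /disj_set; apply/eqP/seteqP; split => // x []; rewrite /= !in_itv /=.
  by move=> /andP[_ h] /andP[/le_lt_trans/(_ h)]; rewrite ltxx.
rewrite (ge0_integral_setU lebesgue_measure (measurable_itv _) (measurable_itv _)
  (@measurable_dens _) (fun x _ => dens_ge0 x) disj).
rewrite -!itvE // ?exprn_gt0 // big_nat_recr //= mulrDr EFinD leeD //.
apply: le_trans (stable_measure_itv_le _ _) _; rewrite ?exprn_gt0 // lee_fin.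
rewrite exprS mulr_natl mulr2n addrK mulrAC mulrC ler_wpM2l ?(ltW alpha0) //.
rewrite -!powR_mulrn ?powR_ge0 // -!powRrM -powRD; last by rewrite (gt_eqF b0) implybT.
by rewrite le_eqVlt; apply/orP; left; apply/eqP; congr (_ `^ _); ring.
Qed.

End stable_intensity.

(** * Upper bounds for tuples of large points *)

Section levels.
Context (R : realType).

Lemma archi_pow (b y : R) : 1 < b -> exists n, y < b ^+ n.
Proof.
move=> b1; have b0 : 0 < b - 1 by rewrite subr_gt0.
have [n yn] : exists n : nat, y / (b - 1) < n%:R.
  by exists (Num.truncn (y / (b - 1))).+1; exact: truncnS_gt.
exists n; move: yn; rewrite ltr_pdivrMr // => /lt_le_trans; apply.
elim: n => [|n IH]; first by rewrite mul0r.
rewrite exprS -natr1 mulrDl mul1r.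
have bn : 1 <= b ^+ n by rewrite exprn_ege1 // ltW.
have : b - 1 <= (b - 1) * b ^+ n by rewrite ler_peMr // ltW.
rewrite [(b - 1) * b ^+ n]mulrBl mul1r => h; lra.
Qed.

Lemma level_ex (b y : R) : 1 < b -> 1 <= y -> exists n, b ^+ n <= y < b ^+ n.+1.
Proof.
move=> b1 y1; have ex := archi_pow y b1.
case: (ex_minnP ex) => -[|n] yn mn; first by move: yn; rewrite expr0 ltNge y1.
exists n; rewrite yn andbT leNgt; apply/negP => yn'; by have := mn _ yn'; rewrite ltnn.
Qed.

Lemma low_level_ex (y : R) : 0 < y -> y < 1 ->
  exists u, 2^-1 ^+ u.+1 <= y < 2^-1 ^+ u.
Proof.
move=> y0 y1.
have ex : exists n, 2^-1 ^+ n <= y.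
  have [|n yn] := @archi_pow 2 y^-1; first lra.
  exists n; rewrite exprVn -[leRHS]invrK lef_pV2 ?posrE ?exprn_gt0 ?invr_gt0 //.
  exact: ltW.
case: (ex_minnP ex) => -[|n] yn mn.
  by move: yn; rewrite expr0 leNgt y1.
exists n; rewrite yn /= ltNge; apply/negP => yn'; by have := mn _ yn'; rewrite ltnn.
Qed.

End levels.

Section union_over_tuples.
Context d (T : measurableType d) (R : realType) (P : probability T R).

Lemma measurable_union_tuples (D : pred (seq nat)) (A : seq nat -> set T) :
  (forall t, D t -> measurable (A t)) ->
  measurable (\bigcup_(t in [set t | D t]) A t).
Proof.
move=> mA; rewrite bigcup_mkcond.
pose A' (t : seq nat) := if t \in [set t | D t] then A t else set0.
rewrite (_ : \bigcup_i _ = \bigcup_n (if pickle_inv n is Some t then A' t else set0)).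
  apply: bigcupT_measurable => n; case: (pickle_inv n) => // t.
  by rewrite /A'; case: ifP => // /set_mem /mA.
apply/seteqP; split => w [].
  by move=> t _ At; exists (pickle t) => //; rewrite pickleK_inv.
by move=> n _; case: (pickle_inv n) => // t At; exists t.
Qed.

(** The first moment method for countably many tuples, from bounds for finitely
   many. *)
Lemma union_tuples_le (D : pred (seq nat)) (A : seq nat -> set T) (B : \bar R) :
  (forall t, D t -> measurable (A t)) ->
  (forall L : seq (seq nat), uniq L -> {in L, forall t, D t} ->
    (\sum_(t <- L) P (A t) <= B)%E) ->
  (P (\bigcup_(t in [set t | D t]) A t) <= B)%E.
Proof.
move=> mA HB.
pose A' n := if pickle_inv n is Some t then (if D t then A t else set0) else set0.
have mA' n : measurable (A' n).
  by rewrite /A'; case: (pickle_inv n) => // t; case: ifP => // /mA.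
have sub : \bigcup_(t in [set t | D t]) A t `<=` \bigcup_n A' n.
  by move=> w [t /= Dt At]; exists (pickle t) => //; rewrite /A' pickleK_inv Dt.
have mU := measurable_union_tuples mA.
apply: (@le_trans _ _ (\sum_(n <oo) P (A' n))%E).
  exact: measure_sigma_subadditive.
apply: nneseries_le_bound => [n|n]; first exact: measure_ge0.
pose L := [seq t <- pmap pickle_inv (iota 0 n) | D t].
apply: (@le_trans _ _ (\sum_(t <- L) P (A t))%E); last first.
  apply: HB => [|t]; last by rewrite mem_filter => /andP[].
  by rewrite filter_uniq // (pmap_uniq (@pickle_invK _)) // iota_uniq.
rewrite /L big_filter [leRHS]big_mkcond big_pmap /index_iota subn0 le_eqVlt; apply/orP; left; apply/eqP.
apply: eq_bigr => i _; rewrite /A'; case: (pickle_inv i) => [t|] /=; last by rewrite measure0.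
by case: ifP => // _; rewrite measure0.
Qed.

End union_over_tuples.

Section event_bounds.
Context d (T : measurableType d) (R : realType) (P : probability T R).
Context (alpha : R) (nu : probability nat R).
Context (y : nat -> T -> R) (delay : nat -> T -> nat).
Hypothesis alpha0 : 0 < alpha.
Hypothesis my : forall i, measurable_fun setT (y i).
Hypothesis mdelay : forall i, measurable_fun setT (delay i).
Hypothesis y0 : forall i w, 0 < y i w.
Local Notation z := (fun i w => (y i w, delay i w)).
Local Notation mu := (stable_delay_intensity alpha nu).
Hypothesis ppp : poisson_point_process P mu z.
Context (k : nat).

Let mz i : measurable_fun setT (z i).
Proof. exact: measurable_fun_pair. Qed.

Definition prodY (t : seq nat) (w : T) : R := \prod_(i <- t) y i w.

Definition early (t : seq nat) (w : T) : bool := all (fun i => (delay i w <= k)%N) t.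

(** Here [k] is the time horizon: a point with delay above [k] has no renewal up
   to time [k]. *)
Definition large (t : seq nat) (w : T) : bool :=
  early t w && all (fun i => 1 <= y i w) t.

Lemma prodY_cons i t w : prodY (i :: t) w = y i w * prodY t w.
Proof. by rewrite /prodY big_cons. Qed.

Lemma prodY_gt0 t w : 0 < prodY t w.
Proof. by apply: prodr_gt0 => i _. Qed.

Lemma large_cons i t w : large (i :: t) w =
  [&& (delay i w <= k)%N, 1 <= y i w & large t w].
Proof.
rewrite /large /early /=; case: (delay i w <= k)%N => //=.
by case: (1 <= y i w) => //=; rewrite ?andbF.
Qed.

Lemma measurable_prodY t : measurable_fun setT (prodY t).
Proof.
rewrite /prodY; elim: t => [|i t IH].
  by under eq_fun do rewrite big_nil; exact: measurable_cst.
by under eq_fun do rewrite big_cons; exact: measurable_funM.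
Qed.

Lemma measurable_all (f : nat -> T -> bool) (t : seq nat) :
  (forall i, measurable [set w | f i w]) -> measurable [set w | all (f ^~ w) t].
Proof.
move=> mf; elim: t => [|i t IH].
  by rewrite (_ : [set w | _] = setT) //; exact/seteqP.
rewrite (_ : [set w | _] = [set w | f i w] `&` [set w | all (f ^~ w) t]).
  exact: measurableI.
by apply/seteqP; split => w /=; [move/andP|move=> [-> ->]].
Qed.

Lemma measurable_early t : measurable [set w | early t w].
Proof.
apply: measurable_all => i; rewrite -[X in measurable X]setTI.
exact: (mdelay i measurableT (Y := [set j | (j <= k)%N])).
Qed.

Lemma measurable_large t : measurable [set w | large t w].
Proof.
rewrite (_ : [set w | _] = [set w | early t w] `&` [set w | all (fun i => 1 <= y i w) t]).
  apply: measurableI; first exact: measurable_early.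
  apply: measurable_all => i; rewrite -[X in measurable X]setTI.
  rewrite (_ : [set w | _] = y i @^-1` `[1, +oo[%classic); first exact: my.
  by apply/seteqP; split => w; rewrite /= in_itv /= andbT.
by apply/seteqP; split => w; rewrite /large /=; [move/andP|move=> [-> ->]].
Qed.

Section base.
Context (b : R).
Hypothesis b1 : 1 < b.

Let b0 : 0 < b. Proof. exact: lt_trans b1. Qed.

(** The base [b] is [2] for the estimates up to constants, and close to [1] for
   products in a narrow window. *)
Definition level_cell (c : nat) : set (R * nat) := strip (b ^+ c) (b ^+ c.+1) k.

Lemma measurable_level_cell c : measurable (level_cell c).
Proof. exact: measurable_strip. Qed.

Lemma trivIset_level_cell : trivIset setT level_cell.
Proof.
apply/trivIsetP => i j _ _; wlog ij : i j / (i < j)%N.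
  move=> H; case: (ltngtP i j) => // ij _; first by apply: H; rewrite // neq_ltn ij.
  by rewrite setIC; apply: H; rewrite // neq_ltn ij.
move=> _; apply/seteqP; split => // -[x l] []; rewrite /level_cell /strip /=.
move=> /andP[/andP[_ h] _] /andP[/andP[h' _] _]; move: (le_lt_trans h' h).
rewrite ltNge ler_weXn2l // ltW //.
Qed.

Lemma level_cell_lt_pinfty c : (mu (level_cell c) < +oo)%E.
Proof.
by apply: le_lt_trans (geometric_strip_le _ alpha0 _ _ (ltW b1)) _; rewrite ltry.
Qed.

Definition level_mass c : R := fine (mu (level_cell c)).

Lemma level_mass_ge0 c : 0 <= level_mass c.
Proof. by apply: fine_ge0; exact: intensity_ge0. Qed.

Lemma level_mass_upper c :
  level_mass c <= k.+1%:R * ((b - 1) * alpha) * (b `^ (- alpha)) ^+ c.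
Proof.
rewrite -lee_fin fineK ?ge0_fin_numE ?intensity_ge0 ?level_cell_lt_pinfty //.
exact: geometric_strip_le (ltW b1).
Qed.

(** Rounding each size down to a power of [b] loses at most a factor [b] for
   each entry. *)
Lemma large_levels t w : large t w -> exists cs,
  [/\ in_cells z level_cell cs t w, size cs = size t &
      b ^+ sumn cs <= prodY t w <= b ^+ (sumn cs + size t)].
Proof.
elim: t => [|i t IH]; first by exists [::]; rewrite /prodY big_nil expr0 lexx.
rewrite large_cons => /and3P[dk y1 /IH[cs [h1 h2 /andP[h3 h4]]]].
have [n yn] := level_ex b1 y1; have /andP[yn1 yn2] := yn.
exists (n :: cs); split.
- rewrite /in_cells /cell_ok /=; apply/andP; split => //.
  by apply/asboolP; rewrite /level_cell /strip /= yn dk.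
- by rewrite /= h2.
have bX m : 0 <= b ^+ m by rewrite exprn_ge0 // ltW.
rewrite prodY_cons /= exprD ler_pM //=.
rewrite (_ : (n + sumn cs + (size t).+1)%N = (n.+1 + (sumn cs + size t))%N); last by clear; lia.
by rewrite exprD ler_pM // ltW // prodY_gt0.
Qed.

Lemma event_tuples_le q (A : seq nat -> set T) (F : seq nat -> bool) :
  (forall t, measurable (A t)) ->
  (forall t w, uniq t -> size t = q -> A t w ->
    exists2 cs, in_cells z level_cell cs t w & F cs) ->
  (P (\bigcup_(t in [set t : seq nat | uniq t && (size t == q)]) A t) <=
   isum q (fun cs => ((F cs)%:R * \prod_(c <- cs) level_mass c)%:E))%E.
Proof.
move=> mA AF; apply: union_tuples_le => // L uL Lq.
have := @expectation_tuples_le _ _ _ _ _ P mu z mz (intensity_ge0 nu alpha0) ppp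
  level_cell measurable_level_cell trivIset_level_cell level_cell_lt_pinfty
  q L (fun cs => (F cs)%:R) (fun t w => (\1_(A t) w)%:E) uL.
rewrite (eq_bigr (fun t => P (A t))); last first.
  by move=> t _; rewrite integral_indic // setIT.
apply => //.
- by move=> t /Lq /andP[-> /eqP].
- by move=> t _; apply/measurable_EFinP; exact: measurable_indic.
move=> t tL w; have [Aw|Aw] := pselect (A t w); last by left; rewrite indicE memNset.
have /andP[ut /eqP st] := Lq t tL.
right; have [cs h Fcs] := AF t w ut st Aw; exists cs => //.
by rewrite indicE mem_set // Fcs.
Qed.

End base.

Let r : R := 2 `^ (- alpha).
Let r1 : 0 < r < 1. Proof. exact: (geometric_ratio_lt1 alpha0 (ltr1n R 2)). Qed.
Let lt12 : 1 < 2 :> R. Proof. by rewrite ltr1n. Qed.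

Definition large_event q (theta : R) : set T :=
  \bigcup_(t in [set t : seq nat | uniq t && (size t == q)])
    [set w | large t w && (theta < prodY t w)].

Lemma measurable_prodY_gt t theta : measurable [set w | theta < prodY t w].
Proof.
rewrite (_ : [set w | _] = setT `&` prodY t @^-1` `]theta, +oo[%classic).
  exact: measurable_prodY.
by apply/seteqP; split => w; rewrite setTI /= in_itv /= andbT.
Qed.

Lemma measurable_large_gt t theta :
  measurable [set w | large t w && (theta < prodY t w)].
Proof.
rewrite (_ : [set w | _] = [set w | large t w] `&` [set w | theta < prodY t w]).
  by apply: measurableI; [exact: measurable_large|exact: measurable_prodY_gt].
by apply/seteqP; split => w /=; [move/andP|move=> [-> ->]].
Qed.

Lemma large_event_le q : exists2 C : R, 0 <= C &
  forall S theta, 2 ^+ (S + q) <= theta ->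
  (P (large_event q theta) <= (C * r ^+ S * (S.+1%:R ^+ q / S.+1%:R))%:E)%E.
Proof.
have [C C0 HC] := tail_mass_div_le (@level_mass_ge0 2) r1 (level_mass_upper lt12) q.
exists C => // S theta hS; apply: le_trans (HC S).
apply: (event_tuples_le lt12 (measurable_large_gt ^~ theta)) => t w _ st /andP[lt tht].
have [cs [h1 h2 /andP[_ h3]]] := large_levels lt12 lt; exists cs => //.
have := lt_le_trans (le_lt_trans hS tht) h3.
by rewrite st ltr_eXn2l // ltn_add2r => /ltnW.
Qed.

(** Two distinct large tuples with products above [theta] contain such a
   configuration: [i] and [j] complete the same [c] to a tuple, and already
   the smaller of the two gives a product above [theta]. *)
Definition pair_event q (theta : R) : set T :=
  \bigcup_(t in [set t : seq nat | uniq t && (size t == q.+2)])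
    [set w | if t is i :: j :: c then
       [&& large t w, y i w <= y j w & theta < prodY (i :: c) w] else false].

Lemma measurable_pair_tuple theta t : measurable [set w | if t is i :: j :: c then
  [&& large t w, y i w <= y j w & theta < prodY (i :: c) w] else false].
Proof.
case: t => [|i [|j c]].
- by rewrite (_ : [set w | _] = set0) //; apply/seteqP; split.
- by rewrite (_ : [set w | _] = set0) //; apply/seteqP; split.
rewrite (_ : [set w | _] = [set w | large [:: i, j & c] w] `&`
  ((setT `&` [set w | y i w <= y j w]) `&` [set w | theta < prodY (i :: c) w])).
  apply: measurableI; first exact: measurable_large.
  by apply: measurableI; [exact: measurable_fun_le|exact: measurable_prodY_gt].
by apply/seteqP; split => w /=; [move/and3P => [-> -> ->]|move=> [-> [[_ ->] ->]]].
Qed.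

(** Compared with one tuple of [q.+1] large points this loses one power of [S]:
   see [pair_mass_le]. *)
Lemma pair_event_le q : exists2 C : R, 0 <= C &
  forall S theta, 2 ^+ (S + q.+1) <= theta ->
  (P (pair_event q theta) <= (C * r ^+ S * (S.+1%:R ^+ q / S.+1%:R))%:E)%E.
Proof.
have [C C0 HC] := pair_mass_le (@level_mass_ge0 2) r1 (level_mass_upper lt12) q.
exists C => // S theta hS; apply: le_trans (HC S).
apply: (event_tuples_le lt12 (F := fun cs => if cs is i :: j :: cs' then
    (i <= j)%N && (S <= i + sumn cs')%N else false)) => [t|].
  exact: measurable_pair_tuple.
move=> [|i [|j c]] w // _ [sc] /and3P[].
rewrite !large_cons => /and3P[di yi /and3P[dj yj lc]] yij tht.
have [ni /andP[ni1 ni2]] := level_ex lt12 yi.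
have [nj /andP[nj1 nj2]] := level_ex lt12 yj.
have [cs [h1 h2 /andP[_ h3]]] := large_levels lt12 lc.
exists [:: ni, nj & cs].
  rewrite /in_cells /cell_ok /=; apply/and3P; split => //; apply/asboolP.
    by rewrite /level_cell /strip /= ni1 ni2 di.
  by rewrite /level_cell /strip /= nj1 nj2 dj.
apply/andP; split.
  have := le_lt_trans ni1 (le_lt_trans yij nj2).
  by rewrite ltr_eXn2l // ltnS.
have : theta < 2 ^+ (ni.+1 + (sumn cs + q)).
  apply: lt_le_trans tht _; rewrite prodY_cons exprD ler_pM //.
  - by rewrite ltW.
  - by rewrite ltW // prodY_gt0.
  - by rewrite ltW.
  - by rewrite -sc.
move=> /(le_lt_trans hS); rewrite ltr_eXn2l //.
move: (sumn cs) => s; clear; lia.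
Qed.

(** For a base [b] near [1] the sum of the levels of such tuples takes only [n]
   values. *)
Lemma large_between_le q (b lo hi : R) (s1 n : nat) : 1 < b ->
  b ^+ (s1 + q.+1) <= lo -> hi < b ^+ (s1 + n) ->
  (P (\bigcup_(t in [set t : seq nat | uniq t && (size t == q.+1)])
     [set w | large t w && (lo <= prodY t w <= hi)%R]) <=
   (n%:R * ((k.+1%:R * ((b - 1) * alpha)) ^+ q.+1 * (b `^ (- alpha)) ^+ s1 *
      (s1 + n)%:R ^+ q))%:E)%E.
Proof.
move=> b1 hlo hhi.
have b0 : 0 < b := lt_trans ltr01 b1.
have mA t : measurable [set w | large t w && (lo <= prodY t w <= hi)].
  rewrite (_ : [set w | _] = [set w | large t w] `&`
     (setT `&` prodY t @^-1` `[lo, hi]%classic)).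
    by apply: measurableI; [exact: measurable_large|exact: measurable_prodY].
  by apply/seteqP; split => w; rewrite setTI /= in_itv /=; [move/andP|move=> [-> ->]].
apply: le_trans (event_tuples_le b1 (F := fun cs => (s1 <= sumn cs < s1 + n)%N) mA _) _.
  move=> t w _ st /andP[lt /andP[tlo thi]].
  have [cs [h1 h2 /andP[h3 h4]]] := large_levels b1 lt; exists cs => //.
  apply/andP; split.
    have := le_trans (le_trans hlo tlo) h4.
    by rewrite st ler_eXn2l // leq_add2r.
  by have := le_lt_trans (le_trans h3 thi) hhi; rewrite ltr_eXn2l.
have h (s : nat) := level_mass_le (@level_mass_ge0 b) (geometric_ratio_lt1 alpha0 b1)
   (level_mass_upper b1) q s.
have wt0 cs : 0 <= \prod_(c <- cs) level_mass b c.
  by apply: prodr_ge0 => c _; exact: level_mass_ge0.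
apply: (@le_trans _ _ (\sum_(0 <= j < n) isum q.+1
   (fun cs => ((sumn cs == s1 + j)%N%:R * \prod_(c <- cs) level_mass b c)%:E))%E).
  rewrite -isum_sum; last by move=> j cs; rewrite lee_fin mulr_ge0.
  apply: isum_le => cs; first by rewrite lee_fin mulr_ge0.
  move=> _; rewrite sumEFin lee_fin -mulr_suml ler_wpM2r //.
  case: (boolP (_ <= _ < _)%N) => [/andP[l1 l2]|_]; last by rewrite sumr_ge0.
  rewrite (bigD1_seq (sumn cs - s1)%N) ?iota_uniq ?mem_index_iota //=; last first.
    by rewrite ltn_subLR.
  by rewrite subnKC // eqxx lerDl sumr_ge0.
apply: (@le_trans _ _ (\sum_(0 <= j < n) ((k.+1%:R * ((b - 1) * alpha)) ^+ q.+1 *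
   (b `^ (- alpha)) ^+ s1 * (s1 + n)%:R ^+ q)%:E)%E).
  rewrite !big_seq; apply: lee_sum => j; rewrite mem_index_iota /= => jn.
  apply: le_trans (h _) _; rewrite lee_fin.
  have K0 : 0 <= k.+1%:R * ((b - 1) * alpha).
    by rewrite !mulr_ge0 ?subr_ge0 // ltW.
  have /andP[rb0 rb1] := geometric_ratio_lt1 alpha0 b1.
  apply: ler_pM; rewrite ?mulr_ge0 ?exprn_ge0 // ?(ltW rb0) //.
    rewrite ler_wpM2l ?exprn_ge0 // ler_wiXn2l ?(ltW rb0) ?(ltW rb1) //.
    exact: leq_addr.
  by rewrite lerXn2r ?nnegrE // ler_nat -addnS leq_add2l.
by rewrite sumEFin lee_fin sumr_const_nat subn0 [leRHS]mulr_natl.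
Qed.

End event_bounds.

(** * The second moment of the low tuples *)

Section low_second_moment.
Context d (T : measurableType d) (R : realType) (P : probability T R).
Context (alpha : R) (nu : probability nat R).
Context (y : nat -> T -> R) (delay : nat -> T -> nat).
Hypothesis alpha0 : 0 < alpha.
Hypothesis alpha2 : alpha < 2.
Hypothesis my : forall i, measurable_fun setT (y i).
Hypothesis mdelay : forall i, measurable_fun setT (delay i).
Hypothesis y0 : forall i w, 0 < y i w.
Local Notation z := (fun i w => (y i w, delay i w)).
Local Notation mu := (stable_delay_intensity alpha nu).
Hypothesis ppp : poisson_point_process P mu z.
Context (k : nat).
Local Notation h := (2^-1 : R).

Let mz i : measurable_fun setT (z i).
Proof. exact: measurable_fun_pair. Qed.

(** The product of [t] is at most [maxY t], and [maxY t] is the product of the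
   large entries alone. Truncating by it also keeps the mixed tuples, with
   small entries, under control. *)
Definition maxY (t : seq nat) (w : T) : R := \prod_(i <- t) Num.max (y i w) 1.

Lemma measurable_maxY t : measurable_fun setT (maxY t).
Proof.
rewrite /maxY; elim: t => [|i t IH].
  by under eq_fun do rewrite big_nil; exact: measurable_cst.
under eq_fun do rewrite big_cons.
by apply: measurable_funM => //; exact: measurable_maxr.
Qed.

Definition low_term (theta : R) (t : seq nat) (w : T) : R :=
  prodY y t w * (early delay k t w && (maxY t w <= theta))%:R.

(** Odd indices enumerate the dyadic cells of sizes below [1], even indices
   those above; infinitely many cells are needed near [0], where the
   intensity is infinite. *)
Definition dyadic_cell (c : nat) : set (R * nat) :=
  if odd c then strip (h ^+ c./2.+1) (h ^+ c./2) k
  else strip (2 ^+ c./2) (2 ^+ c./2.+1) k.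

Definition dyadic_level (c : nat) : nat := if odd c then 0 else c./2.

(** An upper bound of the squared size in the cell. *)
Definition dyadic_weight (c : nat) : R :=
  if odd c then h ^+ c./2 ^+ 2 else 2 ^+ c./2.+1 ^+ 2.

Let lt12 : 1 <= 2 :> R. Proof. by rewrite ler1n. Qed.

Let h0 : 0 < h. Proof. by rewrite invr_gt0. Qed.
Let h1 : h < 1. Proof. by rewrite invf_lt1 ?ltr1n. Qed.

Lemma measurable_dyadic_cell c : measurable (dyadic_cell c).
Proof. by rewrite /dyadic_cell; case: ifP => _; exact: measurable_strip. Qed.

Lemma dyadic_cell_disjoint c c' x l : dyadic_cell c (x, l) -> dyadic_cell c' (x, l) ->
  c = c'.
Proof.
have up j j' : 2 ^+ j <= x < 2 ^+ j.+1 -> 2 ^+ j' <= x < 2 ^+ j'.+1 -> j = j'.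
  move=> /andP[a1 a2] /andP[b1 b2].
  have two2 : 1 < 2 :> R by rewrite ltr1n.
  have := le_lt_trans a1 b2; have := le_lt_trans b1 a2.
  by rewrite !ltr_eXn2l // !ltnS => jj' j'j; apply/eqP; rewrite eqn_leq jj' j'j.
have dn j j' : h ^+ j.+1 <= x < h ^+ j -> h ^+ j'.+1 <= x < h ^+ j' -> j = j'.
  move=> /andP[a1 a2] /andP[b1 b2].
  have := le_lt_trans a1 b2; have := le_lt_trans b1 a2.
  by rewrite !ltr_iXn2l // !ltnS => jj' j'j; apply/eqP; rewrite eqn_leq jj' j'j.
have ud j j' : 2 ^+ j <= x -> x < h ^+ j' -> False.
  move=> a b; have := le_lt_trans a b; rewrite ltNge => /negP; apply.
  by apply: (@le_trans _ _ 1); [rewrite exprn_ile1 // ltW|rewrite exprn_ege1 // ler1n].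
rewrite /dyadic_cell /strip.
case oc: (odd c); case oc': (odd c') => /= /andP[A _] /andP[B _].
- by rewrite -[c]odd_double_half -[c']odd_double_half oc oc' (dn _ _ A B).
- by case/andP: A => _ A; case/andP: B => B _; case: (ud _ _ B A).
- by case/andP: A => A _; case/andP: B => _ B; case: (ud _ _ A B).
- by rewrite -[c]odd_double_half -[c']odd_double_half oc oc' (up _ _ A B).
Qed.

Lemma trivIset_dyadic_cell : trivIset setT dyadic_cell.
Proof. by move=> i j _ _ [[x l] [a b]]; exact: dyadic_cell_disjoint a b. Qed.

Let low_mass_upper u : (mu (strip (h ^+ u.+1) (h ^+ u) k) <=
  (k.+1%:R * ((h ^+ u - h ^+ u.+1) * alpha * (h ^+ u.+1) `^ (- alpha - 1)))%:E)%E.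
Proof.
apply: intensity_strip_le => //.
by rewrite exprS ler_piMl ?exprn_ge0 // ltW.
Qed.

Lemma dyadic_cell_lt_pinfty c : (mu (dyadic_cell c) < +oo)%E.
Proof.
rewrite /dyadic_cell; case: ifP => _.
  by apply: le_lt_trans (low_mass_upper _) _; rewrite ltry.
by apply: le_lt_trans (geometric_strip_le _ alpha0 _ _ (lt12)) _; rewrite ltry.
Qed.

Definition dyadic_mass c : R := fine (mu (dyadic_cell c)).

Let wm c : R := dyadic_weight c * dyadic_mass c.

Lemma dyadic_weight_ge0 c : 0 <= dyadic_weight c.
Proof. by rewrite /dyadic_weight; case: ifP => _; rewrite !exprn_ge0. Qed.

Lemma dyadic_mass_ge0 c : 0 <= dyadic_mass c.
Proof. by apply: fine_ge0; exact: intensity_ge0. Qed.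

Let wm_ge0 c : 0 <= wm c.
Proof. by rewrite mulr_ge0 ?dyadic_weight_ge0 ?dyadic_mass_ge0. Qed.

Let r : R := 2 `^ (- alpha).
Let r0 : 0 < r. Proof. by rewrite powR_gt0. Qed.

(** This is [2 ^ (2 - alpha)], the growth rate of the truncated second moments. *)
Definition low_ratio : R := 4 * 2 `^ (- alpha).

Lemma low_ratio_gt1 : 1 < low_ratio.
Proof.
have a2 : 0 < 2 - alpha by rewrite subr_gt0.
have /andP[q0 q1] := geometric_ratio_lt1 a2 (ltr1n R 2).
have -> : low_ratio = (2 `^ (- (2 - alpha)))^-1.
  rewrite -powRN opprK powRD; last by rewrite pnatr_eq0 implybT.
  by rewrite /low_ratio (@powR_mulrn R 2 2) // -natrX.
by rewrite invf_gt1.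
Qed.

Let tau : R := h ^+ 3 * h `^ (- alpha - 1).

Let tau01 : 0 < tau < 1.
Proof.
have a2 : 0 < 2 - alpha by rewrite subr_gt0.
have q := geometric_ratio_lt1 a2 (ltr1n R 2).
suff e : tau = 2 `^ (- (2 - alpha)) by rewrite e.
rewrite /tau -(powR_mulrn 3) ?(ltW h0) // -powRD; last by rewrite (gt_eqF h0) implybT.
rewrite -(@powR_inv1 _ 2) // -powRrM; congr (_ `^ _); ring.
Qed.

(** Each positive level is one cell of weight of order [low_ratio ^+ j]; level
   [0] contains all the cells below [1], whose weights are summable since
   [alpha < 2]. *)
Lemma low_weighted_mass_le : exists2 K : R, 0 <= K &
  forall j n, \sum_(0 <= c < n | dyadic_level c == j) wm c <= K * low_ratio ^+ j.
Proof.
pose K1 := 4 * (k.+1%:R * ((2 - 1) * alpha)).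
pose K2 := k.+1%:R * (2^-1 * alpha * h `^ (- alpha - 1)).
have K10 : 0 <= K1.
  rewrite /K1 !mulr_ge0 // ?(ltW alpha0) //; lra.
have K20 : 0 <= K2.
  by rewrite /K2 !mulr_ge0 ?powR_ge0 // ltW.
have d0 : 0 < 1 - tau by rewrite subr_gt0; case/andP: tau01.
exists (K1 + K2 / (1 - tau)); first by rewrite addr_ge0 // divr_ge0 // ltW.
have even_le j : wm j.*2 <= K1 * low_ratio ^+ j.
  rewrite /wm /dyadic_weight /dyadic_mass /dyadic_cell odd_double doubleK.
  apply: (@le_trans _ _ (2 ^+ j.+1 ^+ 2 * (k.+1%:R * ((2 - 1) * alpha) * r ^+ j))).
    rewrite ler_wpM2l ?exprn_ge0 // -lee_fin fineK.
      by apply: geometric_strip_le; rewrite ?ler1n.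
    rewrite ge0_fin_numE ?intensity_ge0 //.
    by apply: le_lt_trans (geometric_strip_le _ alpha0 _ _ (lt12)) _; rewrite ltry.
  have e4 : 2 ^+ 2 = 4 :> R by rewrite -natrX.
  have -> : 2 ^+ j.+1 ^+ 2 = 4 * 4 ^+ j :> R by rewrite -exprM mulnC exprM e4 exprS.
  rewrite /K1 /low_ratio -/r exprMn.
  by rewrite le_eqVlt; apply/orP; left; apply/eqP; ring.
have odd_le u : wm u.*2.+1 <= K2 * tau ^+ u.
  rewrite /wm /dyadic_weight /dyadic_mass /dyadic_cell /= odd_double /= uphalf_double.
  apply: (@le_trans _ _ (h ^+ u ^+ 2 *
     (k.+1%:R * ((h ^+ u - h ^+ u.+1) * alpha * (h ^+ u.+1) `^ (- alpha - 1))))).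
    rewrite ler_wpM2l ?exprn_ge0 ?(ltW h0) // -lee_fin fineK //.
    rewrite ge0_fin_numE ?intensity_ge0 //.
    by apply: le_lt_trans (low_mass_upper _) _; rewrite ltry.
  have -> : (h ^+ u.+1) `^ (- alpha - 1) = (h `^ (- alpha - 1)) ^+ u.+1.
    rewrite -powR_mulrn ?(ltW h0) // -powRrM mulrC powRrM powR_mulrn ?powR_ge0 //.
  rewrite /K2 /tau exprMn [(h `^ _) ^+ u.+1]exprS [h ^+ u.+1]exprS.
  have -> : (h ^+ 3) ^+ u = (h ^+ u) ^+ 3 by rewrite -!exprM mulnC.
  rewrite le_eqVlt; apply/orP; left; apply/eqP.
  by field.
move=> j n.
pose f c := (dyadic_level c == j)%:R * wm c.
have f0 c : 0 <= f c by rewrite mulr_ge0.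
apply: (@le_trans _ _ (\sum_(0 <= c < n.*2) f c)).
  rewrite -addnn [leRHS](@big_cat_nat _ _ _ n) ?leq_addr //=.
  apply: (@le_trans _ _ (\sum_(0 <= c < n) f c)); last by rewrite lerDl sumr_ge0.
  rewrite big_mkcond; apply: ler_sum => c _; rewrite /f.
  by case: ifP => _; rewrite ?mul1r ?mul0r.
have -> : \sum_(0 <= c < n.*2) f c = \sum_(0 <= i < n) (f i.*2 + f i.*2.+1).
  elim: n => [|n IH]; first by rewrite !big_geq.
  by rewrite doubleS !big_nat_recr //= IH addrA.
rewrite big_split mulrDl; apply: lerD.
  apply: (@le_trans _ _ (\sum_(0 <= i < n | i == j) wm j.*2)).
    rewrite [leRHS]big_mkcond; apply: ler_sum => i _; rewrite /f.
    rewrite /dyadic_level odd_double doubleK.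
    by case: eqP => [->|_]; rewrite ?mul1r ?mul0r.
  rewrite -big_filter big_const_seq count_predT iter_addr_0.
  rewrite -mulr_natl; apply: le_trans (even_le j); rewrite ler_piMl // lern1.
  rewrite size_filter (eq_count (a2 := pred1 j)) //.
  by rewrite count_uniq_mem ?iota_uniq // leq_b1.
case: j @f f0 => [|j] f f0.
  rewrite expr0 mulr1; apply: (@le_trans _ _ (K2 * \sum_(0 <= i < n) tau ^+ i)).
    rewrite mulr_sumr; apply: ler_sum => i _.
    by rewrite /f /dyadic_level /= odd_double /= mul1r odd_le.
  by rewrite ler_wpM2l // sum_geom_le.
rewrite big1; last by move=> i _; rewrite /f /dyadic_level /= odd_double /= mul0r.
by rewrite mulr_ge0 ?divr_ge0 ?(ltW d0) // exprn_ge0 // ltW // (lt_trans ltr01) // low_ratio_gt1.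
Qed.

Lemma dyadic_levels t w : early delay k t w -> exists cs,
  [/\ in_cells z dyadic_cell cs t w,
      2 ^+ (\sum_(c <- cs) dyadic_level c) <= maxY t w &
      prodY y t w ^+ 2 <= \prod_(c <- cs) dyadic_weight c].
Proof.
rewrite /early; elim: t => [|i t IH] /=.
  by move=> _; exists [::]; rewrite !big_nil /maxY /prodY !big_nil expr0 expr1n.
move=> /andP[di /IH[cs [e1 e2 e3]]].
have [c [c1 c2 c3]] : exists c, [/\ dyadic_cell c (z i w),
    2 ^+ dyadic_level c <= Num.max (y i w) 1 & y i w ^+ 2 <= dyadic_weight c].
  have [y1|y1] := leP 1 (y i w).
    have [j yj] := level_ex (ltr1n R 2) y1; exists j.*2.
    rewrite /dyadic_cell /dyadic_level /dyadic_weight odd_double doubleK; split.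
    - by rewrite /strip /= yj di.
    - by case/andP: yj.
    - by rewrite lerXn2r ?nnegrE ?exprn_ge0 ?(ltW (y0 _ _)) // ltW //; case/andP: yj.
  have [u yu] := low_level_ex (y0 i w) y1; exists u.*2.+1.
  rewrite /dyadic_cell /dyadic_level /dyadic_weight /= odd_double /= uphalf_double; split.
  - by rewrite /strip /= yu di.
  - by rewrite expr0.
  - by rewrite lerXn2r ?nnegrE ?exprn_ge0 ?(ltW (y0 _ _)) ?(ltW h0) // ltW //; case/andP: yu.
exists (c :: cs); split.
- by rewrite /in_cells /cell_ok /=; apply/andP; split => //; exact/asboolP.
- by rewrite /maxY !big_cons exprD ler_pM // exprn_ge0.
- by rewrite prodY_cons big_cons exprMn ler_pM // exprn_ge0 // ltW // prodY_gt0.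
Qed.

Lemma measurable_low_term theta t : measurable_fun setT (low_term theta t).
Proof.
apply: measurable_funM; first exact: measurable_prodY.
rewrite (_ : (fun w => _) = \1_([set w | early delay k t w] `&`
   (setT `&` maxY t @^-1` `]-oo, theta]%classic))).
  apply: measurable_indic; apply: measurableI; first exact: measurable_early.
  exact: measurable_maxY.
apply/funext => w; rewrite indicE; congr ((nat_of_bool _)%:R); apply/idP/idP.
  by move=> /andP[a b]; rewrite inE; split => //; rewrite setTI /= in_itv.
by rewrite inE setTI => -[/= ->]; rewrite in_itv.
Qed.

Lemma low_term_le theta t w : 0 <= low_term theta t w <= `|theta|.
Proof.
rewrite /low_term; case: (early _ _ _ _) => /=; last by rewrite mulr0 lexx normr_ge0.
case: (leP (maxY t w) theta) => le; rewrite ?mulr1 ?mulr0 ?lexx ?normr_ge0 //.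
rewrite ltW ?prodY_gt0 //=; apply: le_trans (ler_norm _); apply: le_trans le.
apply: ler_prod => i _; rewrite ltW //=; by rewrite le_max lexx.
Qed.

(** The squared terms are bounded cell by cell and summed over the profiles of
   total level at most [M]. *)
Lemma low_second_moment_le q : exists2 C : R, 0 <= C &
  forall M theta (L : seq (seq nat)), theta < 2 ^+ M.+1 -> uniq L ->
  {in L, forall t : seq nat, uniq t /\ size t = q.+1} ->
  (\sum_(t <- L) \int[P]_w ((low_term theta t w) ^+ 2)%:E <=
   (C * low_ratio ^+ M * M.+1%:R ^+ q)%:E)%E.
Proof.
have [K K0 HK] := low_weighted_mass_le.
have [C C0 HC] := low_mass_le wm_ge0 low_ratio_gt1 K0 HK q.
exists C => // M theta L hM uL Lu; apply: le_trans (HC M).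
pose F cs := (\sum_(c <- cs) dyadic_level c <= M)%N%:R * \prod_(c <- cs) dyadic_weight c.
have F0 cs : 0 <= F cs.
  by rewrite mulr_ge0 // prodr_ge0 // => c _; exact: dyadic_weight_ge0.
have := @expectation_tuples_le _ _ _ _ _ P mu z mz (intensity_ge0 nu alpha0) ppp
  dyadic_cell measurable_dyadic_cell trivIset_dyadic_cell dyadic_cell_lt_pinfty
  q.+1 L F (fun t w => ((low_term theta t w) ^+ 2)%:E) uL Lu F0.
rewrite /low_mass (@eq_isum _ q.+1 _ (fun cs => ((\sum_(c <- cs) dyadic_level c <= M)%N%:R *
   \prod_(c <- cs) wm c)%:E)); last first.
  by move=> cs; rewrite /F /wm big_split /= mulrA.
apply.
- move=> t _; apply/measurable_EFinP; apply: measurable_funX.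
  exact: measurable_low_term.
- by move=> t w; rewrite lee_fin sqr_ge0.
move=> t _ w; rewrite /low_term.
have [et|_] := boolP (early delay k t w); last by left; rewrite mulr0 expr0n.
have [mt|_] := leP (maxY t w) theta; last by left; rewrite mulr0 expr0n.
have [cs [e1 e2 e3]] := dyadic_levels et.
right; exists cs => //; rewrite lee_fin mulr1 /F.
have := le_lt_trans (le_trans e2 mt) hM; rewrite ltr_eXn2l ?ltr1n // ltnS => ->.
by rewrite mul1r.
Qed.

End low_second_moment.

(** * A lower bound for tuples of large points *)

Section counting_small.
Context (R : realType).

Lemma counting_eq0 (A : set nat) : counting A = 0%E :> \bar R -> A = set0.
Proof.
rewrite /counting; case: ifPn => // /asboolP finA [] /eqP.
by rewrite pnatr_eq0 finmap.cardfs_eq0 => /eqP; exact: fset_set_set0.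
Qed.

Lemma counting_neq0 (A : set nat) : counting A = 1%E :> \bar R -> exists i, A i.
Proof.
move=> h; apply/set0P; apply/eqP => A0; move: h.
by rewrite A0 -[counting _]/(@counting nat R set0) measure0 => /esym/eqP; rewrite onee_eq0.
Qed.

End counting_small.

Section separated_levels.
Local Open Scope nat_scope.
Context (q h N : nat).
Hypothesis hN : q * q * h + q * h <= N.

(** The [q] levels lie in disjoint windows of length [h], and are encoded freely
   by [f]; together with the last level they form [q.+1] distinct levels of
   sum [N]. *)
Definition sep_init (f : {ffun 'I_q -> 'I_h}) : seq nat :=
  [seq (val r * h + val (f r))%N | r <- enum 'I_q].

(** The last level tops the sum up to [N]; it lies above all the windows by
   [hN]. *)
Definition sep_levels (f : {ffun 'I_q -> 'I_h}) : seq nat :=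
  rcons (sep_init f) (N - sumn (sep_init f)).

Lemma sep_lt (f : {ffun 'I_q -> 'I_h}) (r : 'I_q) : r * h + f r < q * h.
Proof.
have := ltn_ord (f r); have := ltn_ord r.
have : r.+1 * h <= q * h by rewrite leq_mul2r ltn_ord orbT.
by rewrite mulSn; clear; lia.
Qed.

Lemma sumn_sep_init f : sumn (sep_init f) <= q * (q * h).
Proof.
rewrite /sep_init sumnE big_map big_enum /=.
apply: leq_trans (_ : \sum_(r < q) q * h <= _).
  by apply: leq_sum => r _; apply: ltnW; exact: sep_lt.
by rewrite sum_nat_const card_ord.
Qed.

Lemma last_sep_ge f : q * h <= N - sumn (sep_init f).
Proof. by have := sumn_sep_init f; move: hN; move: (sumn _) => s; clear; nia. Qed.

Lemma sumn_sep_levels f : sumn (sep_levels f) = N.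
Proof.
rewrite /sep_levels sumn_rcons subnKC //.
by have := sumn_sep_init f; move: hN; move: (sumn _) => s; clear; nia.
Qed.

Lemma sep_init_inj (f g : {ffun 'I_q -> 'I_h}) (r s : 'I_q) :
  r * h + f r = s * h + g s -> r = s /\ f r = g s.
Proof.
move=> e; have h0 : 0 < h by apply: leq_ltn_trans (ltn_ord (f r)).
have rs : r = s.
  apply: val_inj => /=; have := congr1 (divn ^~ h) e.
  by rewrite /= !divnMDl // !divn_small // !addn0.
by split => //; apply: val_inj; move: e; rewrite rs => /addnI.
Qed.

Lemma uniq_sep_levels f : uniq (sep_levels f).
Proof.
rewrite /sep_levels rcons_uniq; apply/andP; split.
  apply/negP => /mapP[r _ e]; have := sep_lt f r; rewrite -e.
  by rewrite ltnNge last_sep_ge.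
rewrite map_inj_uniq ?enum_uniq // => r s /= e.
by case: (sep_init_inj e).
Qed.

Lemma sep_levels_le f c : c \in sep_levels f -> c <= N.
Proof.
rewrite mem_rcons inE => /orP[/eqP ->|/mapP[r _ ->]]; first exact: leq_subr.
by apply: leq_trans (ltnW (sep_lt f r)) _; move: hN; clear; nia.
Qed.

Lemma sep_levels_inj f g : {subset sep_levels f <= sep_levels g} -> f = g.
Proof.
move=> fg; apply/ffunP => r.
have : (r * h + f r) \in sep_levels g.
  apply: fg; rewrite mem_rcons inE; apply/orP; right.
  by apply/mapP; exists r; rewrite ?mem_enum.
rewrite mem_rcons inE => /orP[/eqP e|/mapP[s _ /= e]].
  by have := sep_lt f r; rewrite e ltnNge last_sep_ge.
by case: (sep_init_inj e) => -> ->.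
Qed.

Lemma size_sep_levels f : size (sep_levels f) = q.+1.
Proof. by rewrite size_rcons size_map size_enum_ord. Qed.

End separated_levels.

Section lower_bound.
Context d (T : measurableType d) (R : realType) (P : probability T R).
Context (alpha : R) (nu : probability nat R).
Context (y : nat -> T -> R) (delay : nat -> T -> nat).
Hypothesis alpha0 : 0 < alpha.
Hypothesis my : forall i, measurable_fun setT (y i).
Hypothesis mdelay : forall i, measurable_fun setT (delay i).
Hypothesis y0 : forall i w, 0 < y i w.
Hypothesis nu0 : nu [set 0%N] = 0%E.
Local Notation z := (fun i w => (y i w, delay i w)).
Local Notation mu := (stable_delay_intensity alpha nu).
Hypothesis ppp : poisson_point_process P mu z.

Let mz i : measurable_fun setT (z i).
Proof. exact: measurable_fun_pair. Qed.

Let lt12 : 1 < 2 :> R. Proof. by rewrite ltr1n. Qed.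
Let cell c : set (R * nat) := level_cell 0 2 c.
Let mcell c : measurable (cell c). Proof. exact: measurable_level_cell. Qed.

Let cell_inj c c' x : cell c x -> cell c' x -> c = c'.
Proof.
move=> cx c'x; apply: (@trivIset_level_cell R 0 2 lt12 c c' I I).
by exists x.
Qed.

Let rest (N : nat) (S : seq nat) : set (R * nat) :=
  strip 1 (2 ^+ N.+1) 0 `\` \bigcup_(c in [set` S]) cell c.

Let mrest N S : measurable (rest N S).
Proof.
apply: measurableD; first exact: measurable_strip.
by apply: bigcup_measurable => c _; exact: mcell.
Qed.

(** One point in each cell of the levels [S] and no other point with delay [0]
   and size in the range: the second part makes these events disjoint for
   different [S]. *)
Let occupied (N : nat) (S : seq nat) : set T :=
  \bigcap_(c in [set` S]) (point_count R z (cell c) @^-1` [set 1%:R%:E]) `&`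
  (point_count R z (rest N S) @^-1` [set 0%:R%:E]).

Let moccupied N S : measurable (occupied N S).
Proof.
apply: measurableI; last exact: measurable_point_count_eq.
by apply: bigcap_measurableType => c _; exact: measurable_point_count_eq.
Qed.

Let cell_sub N c : (c <= N)%N -> cell c `<=` strip 1 (2 ^+ N.+1) 0.
Proof.
move=> cN [x l]; rewrite /cell /level_cell /strip /= => /andP[/andP[c1 c2] ->].
rewrite andbT; apply/andP; split.
  by apply: le_trans c1; rewrite exprn_ege1 // ltW.
by apply: lt_le_trans c2 _; rewrite ler_eXn2l.
Qed.

(** The counts of the disjoint sets involved are independent, and the total
   intensity is bounded by [L], so the price of emptiness is a constant. *)
Let occupied_ge (N : nat) (S : seq nat) (L c0 r : R) :
  (mu (strip 1 (2 ^+ N.+1) 0) <= L%:E)%E -> 0 <= c0 -> 0 <= r ->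
  (forall c, (c0 * r ^+ c)%:E <= mu (cell c))%E ->
  uniq S -> (forall c, c \in S -> (c <= N)%N) ->
  ((expR (- L) ^+ (size S).+1 * c0 ^+ size S * r ^+ sumn S)%:E <= P (occupied N S))%E.
Proof.
move=> hL c00 r0 hc uS SN.
have mu0 A : (0 <= mu A)%E by exact: intensity_ge0.
pose A c := if c is c'.+1 then (if c' \in S then cell c' else set0) else rest N S.
pose D c : set (\bar R) := if c is c'.+1 then [set 1%:R%:E] else [set 0%:R%:E].
have mA c : measurable (A c) by case: c => [|c] //=; case: ifP.
have tA : trivIset setT A.
  move=> [|c] [|c'] _ _ [x []] //=.
  - by case: ifP => // c'S [_ nx] cx; case: nx; exists c'.
  - by case: ifP => // cS cx [_ nx]; case: nx; exists c.
  case: ifP => // _; case: ifP => // _ a b; congr _.+1.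
  exact: cell_inj a b.
have subA c : A c `<=` strip 1 (2 ^+ N.+1) 0.
  case: c => [|c] /=; first by move=> x [].
  by case: ifP => [cS|_]; [exact: cell_sub (SN _ cS)|exact: sub0set].
have muA c : (mu (A c) <= L%:E)%E.
  by apply: le_trans hL; apply: intensity_mono => //; exact: measurable_strip.
have muoo c : (mu (A c) < +oo)%E by apply: le_lt_trans (muA c) _; rewrite ltry.
have fA c : 0 <= fine (mu (A c)) <= L.
  by rewrite fine_ge0 //= -lee_fin fineK // ge0_fin_numE.
have [hpoi _ _] := ppp.
have mD c : measurable (D c) by case: c => [|c]; exact: emeasurable_set1.
have uv : uniq (0%N :: map succn S).
  rewrite /= map_inj_uniq ?uS ?andbT; last exact: succn_inj.
  by apply/negP => /mapP[].
have := point_count_indep_nat ppp mA tA uv mD.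
have -> : \bigcap_(c in [set` 0%N :: map succn S]) (point_count R z (A c) @^-1` D c) =
    occupied N S.
  rewrite /occupied; apply/seteqP; split => w.
    move=> H; split; last by have := H 0%N; apply; rewrite /= inE.
    move=> c /= cS; have := H c.+1; rewrite /= cS; apply.
    by rewrite inE; apply/orP; right; exact: map_f.
  move=> [H1 H2] c /=; rewrite inE => /orP[/eqP -> //|/mapP[c' c'S ->]] /=.
  by rewrite c'S; exact: H1.
move=> e; rewrite -[leRHS]fineK ?fin_num_measure // e lee_fin big_cons big_map /=.
rewrite (hpoi _ (mrest N S) (muoo 0%N) 0%N) /= expr0 mulr1 fact0 divr1.
rewrite exprS -!mulrA; apply: ler_pM; rewrite ?mulr_ge0 ?exprn_ge0 ?expR_ge0 //.
  by rewrite ler_expR lerN2; have /andP[] := fA 0%N.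
have -> : expR (- L) ^+ size S * (c0 ^+ size S * r ^+ sumn S) =
    \prod_(c <- S) (expR (- L) * (c0 * r ^+ c)).
  elim: (S) => [|c s IH]; first by rewrite big_nil !expr0 !mulr1.
  by rewrite big_cons -IH /= exprD !exprS; ring.
rewrite !big_seq; apply: ler_prod => c cS.
rewrite !mulr_ge0 ?expR_ge0 ?exprn_ge0 //= cS hpoi //=; last first.
  by have := muoo c.+1; rewrite /= cS.
have /andP[f0 fL] := fA c.+1; rewrite /= cS in f0 fL.
rewrite expr1 factS fact0 divr1; apply: ler_pM; rewrite ?expR_ge0 ?mulr_ge0 ?exprn_ge0 //.
  by rewrite ler_expR lerN2.
by rewrite -lee_fin fineK ?hc // ge0_fin_numE //; have := muoo c.+1; rewrite /= cS.
Qed.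

(** The disjoint events that [q.+1] distinct levels of sum [N] are occupied each
   have probability of order [(2 `^ (- alpha)) ^+ N], and there are about
   [N ^ q] of them. *)
Lemma large_event_ge q : exists2 c : R, 0 < c &
  \forall N \near \oo, forall x, x < 2 ^+ N ->
   ((c * (2 `^ (- alpha)) ^+ N * N%:R ^+ q)%:E <= P (large_event y delay 0 q.+1 x))%E.
Proof.
have [L L0 HL] := intensity_dyadic_bounded nu alpha0.
pose r : R := 2 `^ (- alpha); have r0 : 0 < r by rewrite powR_gt0.
pose c0 : R := (2 - 1) * alpha * 2 `^ (- alpha - 1).
have c00 : 0 < c0 by rewrite !mulr_gt0 ?powR_gt0 // subr_gt0.
have hc c : ((c0 * r ^+ c)%:E <= mu (cell c))%E.
  by apply: geometric_strip_ge => //; exact: ltW.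
(* the windows of [sep_levels] have length [N / D], so that [hN] holds *)
pose D := (q * q + q).+1.
pose C := expR (- L) ^+ q.+2 * c0 ^+ q.+1 * (2 * D%:R)^-1 ^+ q.
have C0 : 0 < C.
  apply: mulr_gt0; last by rewrite exprn_gt0 // invr_gt0 mulr_gt0.
  by apply: mulr_gt0; apply: exprn_gt0 => //; exact: expR_gt0.
exists C => //; exists (2 * D)%N => // N /= ND x xN.
pose h := (N %/ D)%N.
have hN : (q * q * h + q * h <= N)%N.
  by have := leq_divM N D; rewrite -/h /D mulnS -mulnDl; clear; nia.
pose E (f : {ffun 'I_q -> 'I_h}) := occupied N (sep_levels N f).
have Esub f : E f `<=` large_event y delay 0 q.+1 x.
  move=> w [H1 _].
  have ex c : exists i, c \in sep_levels N f -> cell c (z i w).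
    have [cS|cS] := boolP (c \in sep_levels N f); last by exists 0%N.
    have [i Hi] := counting_neq0 (H1 c cS); by exists i.
  have [io Hio] := choice ex.
  have inj : {in sep_levels N f &, injective io}.
    move=> c c' cS c'S e; apply: (@cell_inj _ _ (z (io c) w)); first exact: Hio.
    by rewrite e; exact: Hio.
  exists (map io (sep_levels N f)).
    by rewrite /= map_inj_in_uniq // uniq_sep_levels // size_map size_sep_levels eqxx.
  have lg c : c \in sep_levels N f -> [&& (delay (io c) w <= 0)%N, 1 <= y (io c) w &
      2 ^+ c <= y (io c) w].
    move=> /Hio; rewrite /cell /level_cell /strip /= => /andP[/andP[c1 c2] ->].
    by rewrite c1 andbT /=; apply: le_trans c1; rewrite exprn_ege1 // ltW.
  apply/andP; split.
    rewrite /large /early !all_map; apply/andP; split; apply/allP => c /lg /=.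
      by case/and3P.
    by case/and3P.
  apply: lt_le_trans xN _; rewrite -{1}(sumn_sep_levels hN f) /prodY big_map.
  move: lg; elim: (sep_levels N f) => [|c s IH] lg; first by rewrite big_nil.
  rewrite big_cons /= exprD ler_pM ?exprn_ge0 //.
    by have /and3P[] := lg c (mem_head _ _).
  by apply: IH => c' c's; apply: lg; rewrite inE c's orbT.
have Edisj : trivIset setT (fun f => E f).
  move=> f g _ _ [w [[f1 f2] [g1 g2]]].
  apply/esym/(sep_levels_inj hN) => c cg.
  have [i Hi] := counting_neq0 (g1 c cg).
  have nrest := counting_eq0 f2.
  have : ~ rest N (sep_levels N f) (z i w).
    by move=> ri; have : [set i | rest N (sep_levels N f) (z i w)] i by []; rewrite nrest.
  move=> /not_andP[|/contrapT[c' /= c'f c'i]].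
    by case; exact: cell_sub (sep_levels_le hN cg) _ Hi.
  by rewrite (cell_inj Hi c'i).
have fin : finite_set [set: {ffun 'I_q -> 'I_h}] by exact: finite_finset.
have mE f : measurable (E f) by exact: moccupied.
apply: (@le_trans _ _ (P (\bigcup_f E f))); last first.
  apply: le_measure; rewrite ?inE.
  - exact: fin_bigcup_measurable.
  - by apply: measurable_union_tuples => t _; exact: measurable_large_gt.
  - by move=> w [f _]; exact: Esub.
rewrite measure_fin_bigcup //.
rewrite fsbig_finite //=.
set B := expR (- L) ^+ q.+2 * c0 ^+ q.+1 * r ^+ N.
have B0 : 0 <= B.
  rewrite mulr_ge0 ?exprn_ge0 ?(ltW r0) // mulr_ge0 // exprn_ge0 ?expR_ge0 //.
  exact: ltW.
have EB f : (B%:E <= P (E f))%E.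
  have := @occupied_ge N (sep_levels N f) L c0 r (HL _) (ltW c00) (ltW r0) hc
    (uniq_sep_levels hN f) (@sep_levels_le _ _ _ hN f).
  by rewrite size_sep_levels sumn_sep_levels.
pose fs := finmap.enum_fset (fset_set [set: {ffun 'I_q -> 'I_h}]).
apply: (@le_trans _ _ (\sum_(f <- fs) B%:E)%E); last first.
  by apply: lee_sum => f _.
rewrite sumEFin lee_fin big_const_seq count_predT iter_addr_0.
have -> : size fs = (h ^ q)%N.
  transitivity #|{ffun 'I_q -> 'I_h}|; last by rewrite card_ffun !card_ord.
  rewrite cardE; apply: perm_size; apply: uniq_perm.
  - exact: finmap.fset_uniq.
  - exact: enum_uniq.
  - by move=> f; rewrite mem_enum /fs in_fset_set // in_setT.
have -> : C * 2 `^ (- alpha) ^+ N * N%:R ^+ q = B * ((2 * D%:R)^-1 * N%:R) ^+ q.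
  have mulE (a e u v n : R) : a * e * u * v * n = a * e * v * (u * n) by ring.
  rewrite [X in _ = _ * X]exprMn; exact: mulE.
rewrite -[leRHS]mulr_natr ler_wpM2l // natrX lerXn2r ?nnegrE //.
rewrite mulrC ler_pdivrMr ?mulr_gt0 //.
rewrite -natrM -natrM ler_nat.
have := divn_eq N D; have := ltn_pmod N (ltn0Sn (q * q + q)).
rewrite -/D -/h; move: ND.
by clear; nia.
Qed.

End lower_bound.

(** * Signs and renewal times of a tuple *)

Lemma eq_measure_mod_null d (T : measurableType d) (R : realType)
    (Q : {measure set T -> \bar R}) (N X Y : set T) :
  measurable X -> measurable Y -> Q.-negligible N ->
  (forall w, ~ N w -> X w <-> Y w) -> Q X = Q Y.
Proof.
move=> mX mY [N' [mN' nullN' NN']] XY.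
have le (U V : set T) : measurable U -> measurable V ->
    (forall w, ~ N w -> U w -> V w) -> (Q U <= Q V)%E.
  move=> mU mV UV; apply: (@le_trans _ _ (Q (V `|` N'))).
    apply: le_measure; rewrite ?inE //; first exact: measurableU.
    move=> w Uw; have [Nw|Nw] := pselect (N w); first by right; exact: NN'.
    by left; exact: UV.
  apply: le_trans (measureU2 _ _ _) _ => //.
  by rewrite [X in (_ + X)%E]nullN' adde0.
apply/eqP; rewrite eq_le; apply/andP.
by split; apply: le => // w /XY h /h.
Qed.

Lemma measure_finite_union d (T : measurableType d) (R : realType)
    (Q : {measure set T -> \bar R}) (I : finType) (D : pred I) (F : I -> set T) :
  (forall i, measurable (F i)) -> trivIset [set i | D i] F ->
  Q (\bigcup_(i in [set i | D i]) F i) = (\sum_(i | D i) Q (F i))%E.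
Proof.
move=> mF tF; rewrite measure_fin_bigcup //; last exact: finite_finset.
rewrite (_ : [set i | D i] = [set` [seq i <- enum I | D i]]); last first.
  by apply/seteqP; split => i /=; rewrite mem_filter mem_enum andbT.
rewrite -fsbig_seq; last by rewrite filter_uniq // enum_uniq.
by rewrite big_filter big_enum_cond.
Qed.

Section renewal_vector.
Context (R : realType) (nu : probability nat R) (p m : nat).

(** The indicators of [{0, ..., m}] for the intersection of [p] renewal sets
   started at [0]. *)
Definition renewal_bits (st : 'I_p -> nat -> nat) : {ffun 'I_m.+1 -> bool} :=
  [ffun k : 'I_m.+1 => [forall r, `[< renewal_set 0 (st r) k >]]].

Definition config := {ffun 'I_p * 'I_m -> 'I_m.+2}.

(** Up to time [m] only the first [m] steps matter, each truncated at [m.+1],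
   provided that they are positive: finitely many configurations remain. *)
Definition truncate (st : 'I_p -> nat -> nat) : config :=
  [ffun rj : 'I_p * 'I_m => inord (minn (st rj.1 rj.2) m.+1)].

Definition config_bits (c : config) : {ffun 'I_m.+1 -> bool} :=
  [ffun k : 'I_m.+1 => [forall r : 'I_p, [exists n : 'I_m.+1,
     (\sum_(j < m | (j < n)%N) c (r, j) == k)%N]]].

Lemma sum_ord_lt (n : nat) (f : nat -> nat) : (n <= m)%N ->
  (\sum_(j < m | (j < n)%N) f j = \sum_(j < n) f j)%N.
Proof. by move=> nm; rewrite (big_ord_widen _ _ nm). Qed.

Lemma truncate_bits st : (forall r j, 0 < st r j)%N ->
  config_bits (truncate st) = renewal_bits st.
Proof.
move=> st0; apply/ffunP => k; rewrite !ffunE; apply: eq_forallb => r.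
have tr n : (\sum_(j < m | (j < n)%N) truncate st (r, j) =
    \sum_(j < m | (j < n)%N) minn (st r j) m.+1)%N.
  by apply: eq_bigr => j _; rewrite ffunE /= inordK // ltnS geq_minr.
have km : (k <= m)%N by rewrite -ltnS.
have term (n : nat) (f : nat -> nat) (j : 'I_n) : (f j <= \sum_(i < n) f i)%N.
  by rewrite (bigD1 j) //= leq_addr.
apply/existsP/asboolP => [[n /eqP]|[n _]].
  rewrite tr (@sum_ord_lt n (fun j => minn (st r j) m.+1)); last by rewrite -ltnS.
  move=> e; exists n => //; rewrite add0n -e; apply: eq_bigr => j _.
  have := @term n (fun j => minn (st r j) m.+1) j; rewrite e.
  by move=> /leq_trans/(_ km); move: (st r j) => s; clear; lia.
rewrite add0n => e.
have nk : (n <= k)%N.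
  rewrite -e -[leqLHS](card_ord n) -sum1_card; apply: leq_sum => j _; exact: st0.
exists (inord n); rewrite tr inordK; last by rewrite ltnS (leq_trans nk).
rewrite (@sum_ord_lt n (fun j => minn (st r j) m.+1)); last exact: leq_trans km.
apply/eqP; rewrite -e; apply: eq_bigr => j _.
have := @term n (st r) j; rewrite e => /leq_trans/(_ km).
by move: (st r j) => s; clear; lia.
Qed.

Definition trunc_mass (a : 'I_m.+2) : R :=
  fine (nu [set s | inord (minn s m.+1) = a]).

(** The probability of [v] under the law of [renewal_bits] for independent steps
   with law [nu]; the finite sum makes it independent of any probability
   space, so that it serves both the tuples of the series and the limit. *)
Definition bits_mass (v : {ffun 'I_m.+1 -> bool}) : R :=
  \sum_(c : config | config_bits c == v) \prod_(rj : 'I_p * 'I_m) trunc_mass (c rj).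

Context d (T : measurableType d) (Q : probability T R).
Context (st : 'I_p -> nat -> T -> nat).
Hypothesis mst : forall r j, measurable_fun setT (st r j).

Lemma measurable_renewal_bits v :
  measurable [set w | renewal_bits (fun r j => st r j w) = v].
Proof.
rewrite (_ : [set w | _] = \bigcap_(k in [set: 'I_m.+1])
    [set w | [forall r, `[< renewal_set 0 (fun j => st r j w) k >]] = v k]); last first.
  apply/seteqP; split => w /=; first by move=> e k _ /=; rewrite -e ffunE.
  by move=> H; apply/ffunP => k; rewrite ffunE; exact: H.
apply: fin_bigcap_measurable; first exact: finite_finset.
move=> k _.
have mall : measurable [set w | [forall r, `[< renewal_set 0 (fun j => st r j w) k >]]].
  rewrite (_ : [set w | _] = \bigcap_(r in [set: 'I_p])
      \bigcup_n [set w | (\sum_(j < n) st r j w)%N = k]); last first.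
    apply/seteqP; split => w /=.
      move=> /forallP H r _; have /asboolP[n _ e] := H r.
      by exists n => //=; rewrite -e add0n.
    move=> H; apply/forallP => r; apply/asboolP; have [n _ /= e] := H r I.
    by exists n; rewrite // add0n.
  apply: fin_bigcap_measurable; first exact: finite_finset.
  move=> r _; apply: bigcupT_measurable => n.
  have ms : measurable_fun setT (fun w => (\sum_(j < n) st r j w)%N).
    elim: n => [|n IH].
      by under eq_fun do rewrite big_ord0; exact: measurable_cst.
    under eq_fun do rewrite big_ord_recr /=.
    exact: measurable_fun_addn.
  by rewrite -[X in measurable X]setTI; exact: (ms measurableT [set (k : nat)]).
case: (v k); first exact: mall.
rewrite (_ : [set w | _] = ~` [set w | [forall r, `[< renewal_set 0 (fun j => st r j w) k >]]]).
  exact: measurableC.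
by apply/seteqP; split => w /=; [move=> -> |move=> /negP/negbTE].
Qed.

Hypothesis st_pos : forall r j, Q [set w | st r j w = 0%N] = 0%E.
Context (A : set T).
Hypothesis mA : measurable A.
Hypothesis prodA : forall B : 'I_p * 'I_m -> set nat,
  fine (Q (A `&` \bigcap_(rj in [set: 'I_p * 'I_m]) (st rj.1 rj.2 @^-1` B rj))) =
  fine (Q A) * \prod_(rj : 'I_p * 'I_m) fine (nu (B rj)).

(** The event [A] carries the conditioning: it is an event of the points for the
   tuples of the series, and the full space for the limit. *)
Lemma renewal_bits_law v :
  Q (A `&` [set w | renewal_bits (fun r j => st r j w) = v]) =
  (fine (Q A) * bits_mass v)%:E.
Proof.
pose conf c := [set w | truncate (fun r j => st r j w) = c].
have confE c : conf c = \bigcap_(rj in [set: 'I_p * 'I_m])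
    (st rj.1 rj.2 @^-1` [set s | inord (minn s m.+1) = c rj]).
  apply/seteqP; split => w; first by move=> /= <- rj _ /=; rewrite ffunE.
  by move=> H; apply/ffunP => rj; rewrite ffunE; exact: H.
have mconf c : measurable (conf c).
  rewrite confE; apply: fin_bigcap_measurable; first exact: finite_finset.
  by move=> rj _; rewrite -[X in measurable X]setTI; exact: mst.
have Qconf c : Q (A `&` conf c) =
    (fine (Q A) * \prod_(rj : 'I_p * 'I_m) trunc_mass (c rj))%:E.
  rewrite -[LHS]fineK; last by apply: fin_num_measure; exact: measurableI.
  by rewrite confE prodA.
pose N := \bigcup_n (if unpickle n is Some (r, j) then
  [set w | st r j w = 0%N] else set0).
have nullN : Q.-negligible N.
  apply: negligible_bigcup => n; case: (unpickle n) => [[r j]|]; last exact: negligible_set0.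
  exists [set w | st r j w = 0%N]; split; [|exact: st_pos|by []].
  by rewrite -[X in measurable X]setTI; exact: (mst r j measurableT (Y := [set 0%N])).
pose U := \bigcup_(c in [set c : config | config_bits c == v]) (A `&` conf c).
have mU : measurable U.
  apply: fin_bigcup_measurable; first exact: finite_finset.
  by move=> c _; exact: measurableI.
have mV : measurable (A `&` [set w | renewal_bits (fun r j => st r j w) = v]).
  by apply: measurableI => //; exact: measurable_renewal_bits.
rewrite (@eq_measure_mod_null _ _ _ Q N _ U mV mU nullN).
  rewrite /U measure_finite_union.
  - rewrite (eq_bigr (fun c : config => (fine (Q A) *
        \prod_(rj : 'I_p * 'I_m) trunc_mass (c rj))%:E)); last by move=> c _; exact: Qconf.
    by rewrite sumEFin /bits_mass mulr_sumr.
  - by move=> c; exact: measurableI.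
  - by move=> c c' _ _ [w [[_ /= <-] [_ /= <-]]].
move=> w Nw.
have pos r j : (0 < st r j w)%N.
  rewrite lt0n; apply/negP => /eqP e; apply: Nw.
  by exists (pickle (r, j)) => //; rewrite pickleK.
split.
  move=> [Aw /= e]; exists (truncate (fun r j => st r j w)) => //=.
  by rewrite truncate_bits // e.
by move=> [c /= /eqP cv [Aw e]]; split => //=; rewrite -truncate_bits // e.
Qed.

End renewal_vector.

Section marks.
Context d (T : measurableType d) (R : realType) (P : probability T R).
Context (nu : probability nat R) (y : nat -> T -> R) (delay : nat -> T -> nat)
  (step : nat -> nat -> T -> nat) (sg : nat -> T -> R).
Hypothesis my : forall i, measurable_fun setT (y i).
Hypothesis mdelay : forall i, measurable_fun setT (delay i).
Hypothesis mstep : forall i j, measurable_fun setT (step i j).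
Hypothesis msg : forall i, measurable_fun setT (sg i).
Hypothesis sg1 : forall i w, sg i w = 1 \/ sg i w = -1.
Hypothesis sg_half : forall i, P (sg i @^-1` [set 1]) = (2^-1)%:E.
Hypothesis ind : mutually_independent P (sources y delay step sg).
Hypothesis step_law : forall i j, has_law P (step i j) nu.
Hypothesis nu0 : nu [set 0%N] = 0%E.
Local Notation bs := (but_sign y delay step sg).
Local Notation sgn := (sign_of sg).

(** The sign of the first entry decides: whatever the product of the other signs
   is, exactly one value of it gives [s], and each value has conditional
   probability [1/2]. *)
Lemma sign_of_half (t : seq nat) (H : set T) (s : R) : s = 1 \/ s = -1 ->
  uniq t -> t != [::] -> (forall i, measurable (H : set (bs i))) ->
  P (H `&` [set w | sgn t w = s]) = (2^-1 * fine (P H))%:E.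
Proof.
case: t => // i t s1 /= /andP[it ut] _ mH.
have mH' : measurable H := but_sign_measurable my mdelay mstep msg (mH i).
have mt : measurable_fun [set: bs i] (sgn t : bs i -> R).
  exact: measurable_sign_of_but.
have mHt s' : measurable (H `&` [set w | sgn t w = s'] : set (bs i)).
  apply: measurableI; first exact: mH.
  by rewrite -[X in measurable X]setTI; exact: (mt measurableT [set s']).
have mHt' s' : measurable (H `&` [set w | sgn t w = s']).
  exact: (but_sign_measurable my mdelay mstep msg (mHt s')).
pose D := sg i @^-1` [set 1].
have mD : measurable D by rewrite -[X in measurable X]setTI; exact: msg.
have e1 : H `&` [set w | sgn (i :: t) w = s] =
   (H `&` [set w | sgn t w = s] `&` D) `|` (H `&` [set w | sgn t w = - s] `&` ~` D).
  rewrite /D /sign_of; apply/seteqP; split => w /=.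
    rewrite big_cons => -[Hw]; case: (sg1 i w) => e; rewrite e.
      by rewrite mul1r => ?; left.
    rewrite mulN1r => <-; right; rewrite opprK; split => //.
    by apply/eqP; rewrite eq_sym -addr_eq0 -mulr2n pnatr_eq0.
  rewrite big_cons => -[[[Hw h] ->]|[[Hw h] n]]; split => //; first by rewrite mul1r.
  by case: (sg1 i w) => // ->; rewrite mulN1r h opprK.
rewrite e1 measureU; last 3 first.
- exact: measurableI.
- by apply: measurableI => //; exact: measurableC.
- by apply/seteqP; split => // w [[_ ?] [_ ?]].
have h1 := half_of_but_sign my mdelay mstep msg sg_half ind (mHt s).
have h2 := compl_half_of_but_sign my mdelay mstep msg sg_half ind (mHt (- s)).
rewrite [X in (X + _)%E]h1 [X in (_ + X)%E]h2 -EFinD -mulrDr; congr (_ * _)%:E.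
rewrite -fineD ?fin_num_measure // -measureU //.
  congr (fine (P _)); rewrite -setIUr setIidl // => w Hw /=.
  case: (sign_of1 sg1 t w) => ->; case: s1 => ->; rewrite ?opprK; tauto.
apply/seteqP; split => // w [[_ /= ->] [_ /= e]].
have n1 : 1 <> -1 :> R by apply/eqP; rewrite -addr_eq0 -mulr2n pnatr_eq0.
by case: s1 e => ->; rewrite ?opprK => e; [exact: n1 e|exact: n1 (esym e)].
Qed.

Definition tuple_bits m p (t : seq nat) (w : T) : {ffun 'I_m.+1 -> bool} :=
  renewal_bits m (fun (r : 'I_p) j => step (nth 0%N t r) j w).

(** The event [A] concerns the points only. The indices in [t] are distinct, so
   the renewal processes and the signs involved are independent of each
   other and of [A]. *)
Lemma marks_law m (t : seq nat) (A : set T) (s : R) v : s = 1 \/ s = -1 ->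
  uniq t -> t != [::] -> sources y delay step sg (inl tt) A ->
  P (A `&` [set w | tuple_bits m (size t) t w = v] `&` [set w | sgn t w = s]) =
  (2^-1 * (fine (P A) * bits_mass nu (size t) v))%:E.
Proof.
move=> s1 ut tn sA.
have mAt i : measurable (A : set (bs i)) by exact: (@but_sign_source _ _ _ _ _ _ _ _ (inl tt)).
have mA : measurable A := but_sign_measurable my mdelay mstep msg (mAt 0%N).
rewrite sign_of_half //; last first.
  move=> i; apply: measurableI; first exact: mAt.
  apply: measurable_renewal_bits => r j; exact: measurable_step_but.
congr (_ * _)%:E; rewrite -[RHS]/(fine (_%:E)); congr fine.
apply: renewal_bits_law => // [|B].
  by move=> r j; rewrite -nu0 -(step_law (nth 0%N t r) j) //.
pose src := sources y delay step sg.
pose h (rj : 'I_(size t) * 'I_m) : unit + (nat * nat + nat) :=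
  inr (inl (nth 0%N t rj.1, val rj.2)).
pose J : seq (unit + (nat * nat + nat)) := inl tt ::
  [seq h rj | rj <- enum {: 'I_(size t) * 'I_m}].
pose E (s : unit + (nat * nat + nat)) : set T :=
  match s with
  | inr (inl ij) => step ij.1 ij.2 @^-1`
      (if (insub (index ij.1 t) : option 'I_(size t)) is Some r then
         (if (insub ij.2 : option 'I_m) is Some j then B (r, j) else setT) else setT)
  | inr (inr i) => setT
  | inl _ => A
  end.
have EJ (rj : 'I_(size t) * 'I_m) : E (h rj) =
    step (nth 0%N t rj.1) rj.2 @^-1` B rj.
  rewrite /E /= index_uniq // !valK; by case: rj.
have inj : injective h.
  move=> [r j] [r' j'] /= [e1 e2]; congr (_, _); last exact: val_inj.
  by apply: val_inj; move: e1 => /eqP; rewrite nth_uniq // => /eqP.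
have uJ : uniq J.
  rewrite /= map_inj_uniq // enum_uniq andbT; by apply/negP => /mapP[].
have := ind uJ (E := E); have -> : \bigcap_(i in [set` J]) E i =
    A `&` \bigcap_(rj in [set: 'I_(size t) * 'I_m]) (step (nth 0%N t rj.1) rj.2 @^-1` B rj).
  apply/seteqP; split => w.
    move=> H; split; first by have := H (inl tt); apply; rewrite /= inE.
    move=> rj _; rewrite -EJ; apply: H; rewrite /= inE; apply/orP; right.
    by apply/mapP; exists rj; rewrite ?mem_enum.
  move=> [H1 H2] i /=; rewrite inE => /orP[/eqP -> //|/mapP[rj _ ->]].
  by rewrite EJ; exact: H2.
move=> ->; last first.
  move=> i; rewrite inE => /orP[/eqP -> //|/mapP[rj _ ->]].
  by rewrite EJ; exists (B rj) => //; rewrite setTI.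
rewrite big_cons big_map big_enum; congr (_ * _).
apply: eq_bigr => rj _; rewrite EJ; congr fine; exact: step_law.
Qed.

End marks.

(** * Paths off the exceptional events *)

Lemma sorted_neq_mem (t t' : seq nat) : sorted ltn t -> sorted ltn t' ->
  size t = size t' -> t != t' -> exists2 i, i \in t & i \notin t'.
Proof.
move=> st st' sz tt'.
have ut : uniq t by apply: sorted_uniq st; [exact: ltn_trans|exact: ltnn].
have [/hasP[i it it']|/hasPn h] := boolP (has (fun i => i \notin t') t).
  by exists i.
have sub : {subset t <= t'} by move=> i /h; rewrite negbK.
have [_ e] := uniq_min_size ut sub (eq_leq (esym sz)).
case/eqP: tt'; apply: (irr_sorted_eq ltn_trans ltnn st st') => i.
by rewrite e.
Qed.

Section path.
Context (R : realType) d (T : measurableType d).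
Context (y : nat -> T -> R) (delay : nat -> T -> nat)
  (step : nat -> nat -> T -> nat) (sg : nat -> T -> R).
Hypothesis y0 : forall i w, 0 < y i w.
Hypothesis sg1 : forall i w, sg i w = 1 \/ sg i w = -1.

Definition hit (k : nat) (t : seq nat) (w : T) : bool :=
  `[< (\bigcap_(i in [set` t]) renewal_set (delay i w) (fun j => step i j w)) k >].

Lemma hit_early k m t w : (k <= m)%N -> hit k t w -> early delay m t w.
Proof.
move=> km /asboolP H; apply/allP => i it; have [n _ e] := H i it.
by apply: leq_trans km; rewrite -e leq_addr.
Qed.

Lemma hit0 t w : early delay 0 t w -> hit 0 t w.
Proof.
move=> /allP H; apply/asboolP => i it; exists 0%N => //.
by rewrite big_ord0 addn0; apply/eqP; rewrite -leqn0; exact: H.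
Qed.

Lemma hit_bits m t w (k : 'I_m.+1) : early delay 0 t w ->
  hit k t w = tuple_bits step m (size t) t w k.
Proof.
move=> /allP H; rewrite ffunE; apply/asboolP/forallP => [h r|h i /= it].
  have rt := mem_nth 0%N (ltn_ord r); have := h _ rt.
  have := H _ rt; rewrite leqn0 => /eqP -> hr; exact/asboolP.
have ir : (index i t < size t)%N by rewrite index_mem.
have /asboolP := h (Ordinal ir); rewrite /= nth_index //.
by have := H i it; rewrite leqn0 => /eqP ->.
Qed.

(** The tuples with [maxY <= theta] contribute to [X k] through these terms. *)
Definition hit_low_term m theta k t w : R :=
  low_term y delay m theta t w * (hit k t w)%:R.

Context (q m : nat) (X : nat -> T -> R) (e : nat -> q.+1.-tuple nat).
Hypothesis e_bij : set_bij [set: nat] [set t : q.+1.-tuple nat | sorted ltn t] e.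

Let e_sorted l : sorted ltn (e l).
Proof. by have [f _ _] := e_bij; exact: f. Qed.

Let e_inj : injective e.
Proof. by have [_ i _] := e_bij => l l' h; apply: i; rewrite ?inE. Qed.

Let e_surj t : sorted ltn t -> size t = q.+1 -> exists l, e l = t :> seq nat.
Proof.
move=> st sz; have [_ _ s] := e_bij.
have h : size t == q.+1 by apply/eqP.
by have [l _ el] := s (Tuple h) st; exists l; rewrite el.
Qed.

Definition low_sum theta k n w : R :=
  \sum_(0 <= l < n) sign_of sg (e l) w * hit_low_term m theta k (e l) w.

Lemma series_termE k l w : series_term y delay step sg k (e l) w =
  sign_of sg (e l) w * (prodY y (e l) w * (hit k (e l) w)%:R).
Proof.
rewrite /series_term /sign_of /prodY -mulrA; congr (_ * (_ * _)).
Qed.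

(** If some entry were small, then the large entries alone, fewer than [p] of
   them, would have a product above [theta]. *)
Lemma big_tuple_large theta t w : uniq t -> size t = q.+1 ->
  (forall q', (q' < q.+1)%N -> ~ large_event y delay m q' theta w) ->
  early delay m t w -> theta < maxY y t w ->
  large y delay m t w /\ theta < prodY y t w.
Proof.
move=> ut sz nolow et tht.
pose t1 := [seq i <- t | 1 <= y i w].
have e1 : maxY y t w = prodY y t1 w.
  rewrite /maxY /prodY big_filter [RHS]big_mkcond; apply: eq_bigr => i _.
  by case: leP.
have lt1 : large y delay m t1 w.
  apply/andP; split; last exact: filter_all.
  apply/allP => i; rewrite mem_filter => /andP[_ it]; exact: (allP et).
have ut1 : uniq t1 by exact: filter_uniq.
have st1 : (size t1 <= q.+1)%N by rewrite -sz size_filter count_size.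
have st1' : size t1 = q.+1.
  apply/eqP; rewrite eqn_leq st1 /= leqNgt; apply/negP => /nolow; apply.
  by exists t1; rewrite /= ?ut1 ?eqxx // lt1 -e1.
have tt1 : t1 = t.
  apply/all_filterP; rewrite all_count; apply/eqP.
  by rewrite -size_filter -/t1 st1' sz.
by rewrite -tt1 in e1 *; rewrite -e1 tt1; split => //; rewrite -tt1.
Qed.

(** Otherwise exchange an entry of one tuple for an entry of the other; the
   smaller of the two entries gives the configuration of [pair_event]. *)
Lemma large_tuple_unique theta t t' w : ~ pair_event y delay m q theta w ->
  sorted ltn t -> sorted ltn t' -> size t = q.+1 -> size t' = q.+1 ->
  large y delay m t w -> large y delay m t' w ->
  theta < prodY y t w -> theta < prodY y t' w -> t = t'.
Proof.
move=> nopair.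
have swap (u u' : seq nat) i j : uniq u -> size u = q.+1 -> large y delay m u w ->
    large y delay m u' w -> theta < prodY y u w ->
    i \in u -> j \notin u -> j \in u' -> y i w <= y j w -> False.
  move=> uu su lu lu' thu iu ju ju' yij; apply: nopair.
  exists [:: i, j & rem i u] => /=.
    rewrite inE negb_or mem_rem_uniqF // rem_uniq // size_rem // su /= eqxx !andbT.
    apply/andP; split; first by apply: contraNneq ju => <-.
    by apply: contra ju => /mem_rem.
  have pu := perm_to_rem iu.
  apply/and3P; split => //.
    rewrite !large_cons.
    have /andP[/allP lj1 /allP lj2] := lu'.
    have /andP[/allP li1 /allP li2] := lu.
    apply/and3P; split; [exact: li1|exact: li2|].
    apply/and3P; split; [exact: lj1|exact: lj2|].
    by apply/andP; split; apply/allP => l /mem_rem; [exact: li1|exact: li2].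
  by rewrite /prodY -(perm_big _ pu).
move=> st st' sz sz' lt lt' tht tht'; apply/eqP/negPn/negP => tt'.
have ut u : sorted ltn u -> uniq u by apply: sorted_uniq; [exact: ltn_trans|exact: ltnn].
have [j jt jt'] := sorted_neq_mem st st' (etrans sz (esym sz')) tt'.
have [i it' it] : exists2 i, i \in t' & i \notin t.
  by apply: sorted_neq_mem => //; [rewrite sz|rewrite eq_sym].
case: (leP (y i w) (y j w)) => [yij|/ltW yji].
  exact: (swap t' t i j (ut _ st')).
exact: (swap t t' j i (ut _ st)).
Qed.

Lemma limit_le (u : nat -> R) (l eps : R) : u n @[n --> \oo] --> l ->
  (forall N, exists2 n, (N <= n)%N & `|u n| <= eps) -> `|l| <= eps.
Proof.
move=> ul H; rewrite leNgt; apply/negP => le.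
have : \forall n \near \oo, eps < `|u n|.
  exact: (cvgr_gt _ (cvg_norm ul) _ le).
by move=> [N _ HN]; have [n Nn] := H N; rewrite leNgt HN.
Qed.

(** At most one tuple exceeds the truncation level, so each [X k] is the term of
   this tuple, if there is one, up to the limit of the truncated sums. That
   limit is bounded by [eps] as soon as the sums are so infinitely often. *)
Lemma path_dichotomy theta eps w :
  ~ pair_event y delay m q theta w ->
  (forall q', (q' < q.+1)%N -> ~ large_event y delay m q' theta w) ->
  (forall k, (k <= m)%N -> forall N, exists2 n, (N <= n)%N & `|low_sum theta k n w| <= eps) ->
  (forall k, (k <= m)%N ->
     \sum_(0 <= l < n) series_term y delay step sg k (e l) w @[n --> \oo] --> X k w) ->
  (exists t, [/\ sorted ltn t, size t = q.+1, large y delay m t w,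
     theta < prodY y t w & forall k, (k <= m)%N ->
       `|X k w - sign_of sg t w * (prodY y t w * (hit k t w)%:R)| <= eps]) \/
  ((forall k, (k <= m)%N -> `|X k w| <= eps) /\
   forall t, sorted ltn t -> size t = q.+1 -> large y delay m t w ->
     prodY y t w <= theta).
Proof.
move=> nopair nolow far cv.
pose big l := early delay m (e l) w && (theta < maxY y (e l) w).
have ue l : uniq (e l) by apply: sorted_uniq (e_sorted l); [exact: ltn_trans|exact: ltnn].
have bigP l : big l -> large y delay m (e l) w /\ theta < prodY y (e l) w.
  by move=> /andP[? ?]; apply: big_tuple_large; rewrite ?size_tuple.
have lowE k l : (k <= m)%N -> ~~ big l ->
    series_term y delay step sg k (e l) w =
    sign_of sg (e l) w * hit_low_term m theta k (e l) w.
  move=> km nb; rewrite series_termE /hit_low_term /low_term; congr (_ * _).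
  case hk: (hit k (e l) w); last by rewrite !mulr0.
  have ee := hit_early km hk; move: nb; rewrite /big ee /= -leNgt => ->.
  by rewrite !mulr1.
have lowbig k l : big l -> hit_low_term m theta k (e l) w = 0.
  by move=> /andP[_]; rewrite /hit_low_term /low_term ltNge => /negbTE ->; rewrite andbF mulr0 mul0r.
have [[l0 bl0]|nbig] := pselect (exists l, big l).
  left; exists (e l0); have [ll0 tl0] := bigP l0 bl0.
  split; rewrite ?size_tuple // => k km.
  have one l : big l -> l = l0.
    move=> bl; have [ll tl] := bigP l bl; apply: e_inj; apply: val_inj.
    exact: (large_tuple_unique nopair) (e_sorted l) (e_sorted l0) (size_tuple _)
      (size_tuple _) ll ll0 tl tl0.
  set c := sign_of sg _ _ * _.
  apply: (@limit_le (fun n => \sum_(0 <= l < n) series_term y delay step sg k (e l) w - c)).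
    by apply: cvgB; [exact: cv|exact: cvg_cst].
  move=> N; have [n Nn le] := far k km (maxn N l0.+1).
  exists n; first by apply: leq_trans Nn; exact: leq_maxl.
  have l0n : (l0 < n)%N by apply: leq_trans Nn; exact: leq_maxr.
  suff -> : \sum_(0 <= l < n) series_term y delay step sg k (e l) w - c =
      low_sum theta k n w by [].
  rewrite /low_sum (bigD1_seq l0) ?iota_uniq ?mem_index_iota //=.
  rewrite [RHS](bigD1_seq l0) ?iota_uniq ?mem_index_iota //=.
  rewrite lowbig // mulr0 add0r series_termE -/c [c + _]addrC addrK.
  apply: eq_bigr => l ll0'; apply: lowE => //.
  by apply/negP => /one h; rewrite h eqxx in ll0'.
right; split => [k km|t st sz lt].
  apply: (limit_le (cv k km)) => N; have [n Nn le] := far k km N.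
  exists n => //; suff -> : \sum_(0 <= l < n) series_term y delay step sg k (e l) w =
      low_sum theta k n w by [].
  by apply: eq_bigr => l _; apply: lowE => //; apply/negP => bl; apply: nbig; exists l.
rewrite leNgt; apply/negP => tht; apply: nbig; have [l el] := e_surj st sz.
exists l; rewrite /big el; have /andP[-> /allP a1] := lt.
rewrite /= (lt_le_trans tht) // /prodY /maxY; apply: ler_prod => i _.
by rewrite ltW //= le_max lexx.
Qed.

(** Uniqueness is part of the definition so that the events of different tuples
   are disjoint. The delays are [0], so that the tuple hits [0]. *)
Definition main_tuple (x : R) (t : seq nat) (w : T) : Prop :=
  [/\ sorted ltn t, size t = q.+1, large y delay 0 t w, x < prodY y t w &
      forall t', sorted ltn t' -> size t' = q.+1 -> large y delay 0 t' w ->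
        x < prodY y t' w -> t' = t].

Lemma large0 t w : large y delay 0 t w -> large y delay m t w.
Proof.
move=> /andP[/allP h h2]; apply/andP; split => //; apply/allP => i it.
exact: leq_trans (h i it) _.
Qed.

(** A product outside the window of relative width [delta] around [x] is on the
   same side of [x] as [|X 0|], since the other terms add up to at most
   [delta * x]. The ratio then follows as [X k] and [|X 0|] are both within
   [delta * x] of their main terms. *)
Lemma path_structure (x theta delta : R) w :
  0 < x -> 0 < delta <= 2^-1 -> theta <= x / 2 ->
  ~ pair_event y delay m q theta w ->
  (forall q', (q' < q.+1)%N -> ~ large_event y delay m q' theta w) ->
  (forall k, (k <= m)%N -> forall N, exists2 n, (N <= n)%N &
     `|low_sum theta k n w| <= delta * x) ->
  (forall k, (k <= m)%N ->
     \sum_(0 <= l < n) series_term y delay step sg k (e l) w @[n --> \oo] --> X k w) ->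
  ~ (exists2 t, uniq t && (size t == q.+1) & large y delay m t w &&
      ((1 - delta) * x <= prodY y t w <= (1 + delta) * x)) ->
  (x < `|X 0%N w| <-> exists t, main_tuple x t w) /\
  (large_event y delay 0 q.+1 x w -> x < `|X 0%N w|) /\
  (forall t, main_tuple x t w -> forall k, (k <= m)%N ->
     `|X k w / `|X 0%N w| - sign_of sg t w * (hit k t w)%:R| <= 2 * delta).
Proof.
move=> x0 /andP[d0 d1] thx nopair nolow far cv nostrip.
have su t : sorted ltn t -> uniq t by apply: sorted_uniq; [exact: ltn_trans|exact: ltnn].
have dx0 : 0 < delta * x by exact: mulr_gt0.
have dx : delta * x <= x / 2 by rewrite [x / 2]mulrC ler_wpM2r // ltW.
have uniq_main t t' : sorted ltn t -> sorted ltn t' -> size t = q.+1 -> size t' = q.+1 ->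
    large y delay m t w -> large y delay m t' w ->
    x < prodY y t w -> theta < prodY y t' w -> t = t'.
  move=> st st' sz sz' lt lt' h h'; apply: (large_tuple_unique nopair) => //.
  by apply: le_lt_trans h; lra.
case: (path_dichotomy nopair nolow far cv) => [[t [st sz lt tht Xt]]|[Xs nobig]]; last first.
  have nX : ~ (x < `|X 0%N w|).
    by apply/negP; rewrite -leNgt; have := Xs 0%N (leq0n _); lra.
  have nmain t : sorted ltn t -> size t = q.+1 -> large y delay 0 t w -> x < prodY y t w -> False.
    by move=> st sz /large0 lt h; have := nobig t st sz lt; lra.
  split; [split => // -[t [st sz lt h _]]; case: (nmain t st sz lt h)|split].
    move=> [t /= /andP[ut /eqP sz] /andP[lt h]].
    case: (nmain (sort leq t)).
    - by rewrite ltn_sorted_uniq_leq sort_uniq ut sort_sorted //; exact: leq_total.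
    - by rewrite size_sort.
    - by rewrite /large /early !all_sort.
    - by rewrite /prodY (perm_big _ (permEl (perm_sort _ _))).
  by move=> t [st sz lt h _]; case: (nmain t st sz lt h).
have strip (h1 : (1 - delta) * x <= prodY y t w) : (1 + delta) * x < prodY y t w.
  rewrite ltNge; apply/negP => h2; apply: nostrip; exists t; first by rewrite su //= sz.
  by rewrite lt h1 h2.
have Y0 : 0 < prodY y t w by apply: prodY_gt0.
have s1 : `|sign_of sg t w| = 1 by exact: sign_of_norm.
have hitE : hit 0 t w -> `| `|X 0%N w| - prodY y t w| <= delta * x.
  move=> h0; apply: le_trans (Xt 0%N (leq0n _)).
  rewrite h0 mulr1; apply: le_trans (ler_dist_dist _ _).
  by rewrite normrM s1 mul1r (gtr0_norm Y0).
have X0hit : x < `|X 0%N w| -> hit 0 t w.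
  move=> xX; apply/negPn/negP => nh; have := Xt 0%N (leq0n _).
  rewrite (negbTE nh) mulr0 mulr0 subr0; lra.
have fwd : x < `|X 0%N w| -> main_tuple x t w.
  move=> xX; have h0 := X0hit xX; have := hitE h0; rewrite ler_distl => /andP[a1 a2].
  have e0 := hit_early (leqnn 0) h0.
  have l0 : large y delay 0 t w by move: lt => /andP[_ l2]; exact/andP.
  have h2 : (1 + delta) * x < prodY y t w by apply: strip; rewrite mulrBl mul1r; lra.
  have h3 : x < prodY y t w by move: h2; rewrite mulrDl mul1r; lra.
  split => // t' st' sz' /large0 l' h'.
  exact: (uniq_main t' t).
have bwd t' : sorted ltn t' -> size t' = q.+1 -> large y delay 0 t' w ->
    x < prodY y t' w -> t' = t /\ x < `|X 0%N w|.
  move=> st' sz' l' h'; have tt' : t' = t by apply: uniq_main => //; exact: large0.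
  split => //; rewrite tt' in l' h'.
  have h0 : hit 0 t w by apply: hit0; case/andP: l'.
  have h2 : (1 + delta) * x < prodY y t w by apply: strip; rewrite mulrBl mul1r; lra.
  have := hitE h0; rewrite ler_distl => /andP[a1 a2].
  by move: h2; rewrite mulrDl mul1r; lra.
split; [split=> [/fwd ?|[t' [st' sz' l' h' _]]]|split].
- by exists t.
- by case: (bwd t' st' sz' l' h').
- move=> [t' /= /andP[ut /eqP sz'] /andP[lt' h]].
  case: (bwd (sort leq t')) => //.
  - by rewrite ltn_sorted_uniq_leq sort_uniq ut sort_sorted //; exact: leq_total.
  - by rewrite size_sort.
  - by rewrite /large /early !all_sort.
  - by rewrite /prodY (perm_big _ (permEl (perm_sort _ _))).
move=> t' [st' sz' l' h' _] k km; have [-> xX] := bwd t' st' sz' l' h'.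
have X0 : 0 < `|X 0%N w| by exact: lt_trans xX.
have h0 := X0hit xX.
set s := sign_of sg t w; set Y := prodY y t w; set J : R := (hit k t w)%:R.
have J1 : `|J| <= 1 by rewrite /J; case: (hit k t w); rewrite ?normr1 ?normr0.
rewrite (_ : X k w / _ - _ = (X k w - s * (Y * J)) / `|X 0%N w| +
   s * J * ((Y - `|X 0%N w|) / `|X 0%N w|)); last by field; rewrite gt_eqF.
apply: le_trans (ler_normD _ _) _; rewrite mulr_natl mulr2n; apply: lerD.
  rewrite normrM normfV normr_id ler_pdivrMr //.
  apply: le_trans (Xt k km) _; rewrite ler_wpM2l ?(ltW d0) // ltW //.
rewrite normrM -[leRHS]mul1r; apply: ler_pM => //.
  by rewrite normrM s1 mul1r.
rewrite normrM normfV normr_id ler_pdivrMr // distrC.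
by apply: le_trans (hitE h0) _; rewrite ler_wpM2l ?(ltW d0) // ltW.
Qed.

End path.

(** * The exceptional events are negligible *)

Lemma powRXn (R : realType) (b a : R) n : 0 <= b -> (b ^+ n) `^ a = (b `^ a) ^+ n.
Proof.
by move=> b0; rewrite -powR_mulrn // -powRrM mulrC powRrM powR_mulrn ?powR_ge0.
Qed.

Section strip_bound.
Context d (T : measurableType d) (R : realType) (P : probability T R).
Context (alpha : R) (nu : probability nat R).
Context (y : nat -> T -> R) (delay : nat -> T -> nat).
Hypothesis alpha0 : 0 < alpha.
Hypothesis my : forall i, measurable_fun setT (y i).
Hypothesis mdelay : forall i, measurable_fun setT (delay i).
Hypothesis y0 : forall i w, 0 < y i w.
Hypothesis ppp : poisson_point_process P (stable_delay_intensity alpha nu)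
  (fun i w => (y i w, delay i w)).
Context (q m : nat).

Definition strip_event (lo hi : R) : set T :=
  \bigcup_(t in [set t : seq nat | uniq t && (size t == q.+1)])
     [set w | large y delay m t w && (lo <= prodY y t w <= hi)].

Lemma measurable_strip_event lo hi : measurable (strip_event lo hi).
Proof.
apply: measurable_union_tuples => t _.
rewrite (_ : [set w | _] = [set w | large y delay m t w] `&`
     (setT `&` prodY y t @^-1` `[lo, hi]%classic)).
  by apply: measurableI; [exact: measurable_large|exact: measurable_prodY].
by apply/seteqP; split => w; rewrite setTI /= in_itv /=; [move/andP|move=> [-> ->]].
Qed.

(** With base [b = 1 + kk^-1] the window meets a bounded number of levels; each
   of them has about [(kk * N) ^ q] splittings into the levels of the
   entries, with a factor [dl ^+ q.+1] from the intensities of the cells.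
   One factor [dl] is left. *)
Lemma strip_event_le : exists2 C : R, 0 <= C & forall kk N (x : R), (2 <= kk)%N ->
  (q.+1 + 2 <= N)%N -> 2 ^+ N <= x < 2 ^+ N.+1 ->
  (P (strip_event ((1 - kk%:R^-1) * x) ((1 + kk%:R^-1) * x)) <=
   (C / kk%:R * ((2 `^ (- alpha)) ^+ N * N.+1%:R ^+ q))%:E)%E.
Proof.
pose r : R := 2 `^ (- alpha); have r0 : 0 < r by rewrite powR_gt0.
pose p := q.+1.
pose C := (p + 4)%:R * (m.+1%:R * alpha) ^+ p * 2 ^+ q / r ^+ (p + 3).
exists C.
  rewrite /C divr_ge0 ?exprn_ge0 ?(ltW r0) // !mulr_ge0 // exprn_ge0 //.
  by rewrite mulr_ge0 // ltW.
move=> kk N x kk2 pN /andP[xN xN1].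
set dl : R := kk%:R^-1.
have kk0 : 0 < kk%:R :> R by rewrite ltr0n (leq_trans _ kk2).
have dl0 : 0 < dl by rewrite invr_gt0.
have dl1 : dl <= 2^-1 by rewrite lef_pV2 ?posrE // ler_nat.
pose b := 1 + dl.
have b1 : 1 < b by rewrite ltrDl.
have b0 : 0 < b by exact: lt_trans b1.
have b2 : b <= 2 by rewrite /b; lra.
(* Bernoulli's inequality; it bounds the level of [x] in base [b] by
   [kk * N.+1] *)
have bk : 2 <= b ^+ kk.
  have bern n : 1 + n%:R * dl <= b ^+ n.
    elim: n => [|n IH]; first by rewrite mul0r addr0.
    rewrite exprS -natr1; have : 1 + n%:R * dl + dl <= b * (1 + n%:R * dl).
      rewrite /b mulrDl mul1r lerD2l mulrDr mulr1 lerDl.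
      by rewrite !mulr_ge0 // ltW.
    move=> h; apply: le_trans (ler_wpM2l (ltW b0) IH); apply: le_trans h.
    by rewrite mulrDl mul1r addrA.
  by have := bern kk; rewrite mulfV ?gt_eqF.
have x1 : 1 <= x by apply: le_trans xN; rewrite exprn_ege1 // ler1n.
have x0 : 0 < x by exact: lt_le_trans x1.
have [j /andP[j1 j2]] := level_ex b1 x1.
have lt12 : 1 < 2 :> R by rewrite ltr1n.
have Nj : (N <= j)%N.
  have : 2 ^+ N < 2 ^+ j.+1 :> R.
    apply: le_lt_trans xN _; apply: lt_le_trans j2 _.
    by rewrite lerXn2r ?nnegrE //; exact: ltW.
  by rewrite ltr_eXn2l // ltnS.
have jk : (j < kk * N.+1)%N.
  have : b ^+ j < b ^+ (kk * N.+1).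
    apply: le_lt_trans j1 _; apply: lt_le_trans xN1 _.
    by rewrite exprM lerXn2r ?nnegrE // ?exprn_ge0 // ltW.
  by rewrite ltr_eXn2l.
pose s1 := (j - (p + 2))%N.
have s1j : (s1 + (p + 2))%N = j by rewrite subnK // (leq_trans pN).
have hlo : b ^+ (s1 + q.+1) <= (1 - dl) * x.
  have e : b ^+ (s1 + q.+1) * b ^+ 2 = b ^+ j by rewrite -exprD -addnA s1j.
  have c1 : 1 <= (1 - dl) * b ^+ 2.
    rewrite /b expr2; have -> : (1 - dl) * ((1 + dl) * (1 + dl)) = 1 + dl * (1 - dl - dl ^+ 2) by ring.
    rewrite lerDl mulr_ge0 ?(ltW dl0) //.
    have : dl ^+ 2 <= 2^-1 * 2^-1 by rewrite expr2 ler_pM // ltW.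
    lra.
  rewrite -(ler_pM2r (exprn_gt0 2 b0)) e; apply: le_trans j1 _.
  by rewrite mulrAC ler_peMl // ltW.
have hhi : (1 + dl) * x < b ^+ (s1 + (p + 4)).
  have -> : (s1 + (p + 4))%N = j.+2 by rewrite -s1j; clear; lia.
  by rewrite exprS ltr_pM2l.
apply: le_trans (large_between_le alpha0 my mdelay y0 ppp m b1 hlo hhi) _.
rewrite lee_fin.
have hr : (b `^ (- alpha)) ^+ s1 <= r ^+ N / r ^+ (p + 3).
  rewrite ler_pdivlMr ?exprn_gt0 // -!powRXn ?(ltW b0) // -powRM ?exprn_ge0 ?(ltW b0) //.
  have h : 2 ^+ N <= b ^+ s1 * 2 ^+ (p + 3).
    apply: le_trans xN _; apply: le_trans (ltW j2) _.
    have -> : j.+1 = (s1 + (p + 3))%N by rewrite -s1j; clear; lia.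
    rewrite exprD ler_wpM2l ?exprn_ge0 ?(ltW b0) //.
    by rewrite lerXn2r ?nnegrE // ltW.
  rewrite !powRN lef_pV2 ?posrE ?powR_gt0 ?mulr_gt0 ?exprn_gt0 //.
  by apply: ge0_ler_powR => //; rewrite ?nnegrE ?mulr_ge0 ?exprn_ge0 // ?(ltW b0) // ltW.
have -> : (s1 + (p + 4))%:R = (j + 2)%:R :> R by congr _%:R; rewrite -s1j; clear; lia.
have hj : (j + 2)%:R <= 2 * kk%:R * N.+1%:R :> R.
  by rewrite -!natrM ler_nat; move: jk kk2; clear; nia.
have -> : b - 1 = dl by rewrite /b addrC addKr.
rewrite -!mulrA; apply: (@le_trans _ _ ((p + 4)%:R * ((m.+1%:R * (dl * alpha)) ^+ p *
   (r ^+ N / r ^+ (p + 3) * (2 * kk%:R * N.+1%:R) ^+ q)))).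
  rewrite ler_wpM2l // ler_wpM2l ?exprn_ge0 ?mulr_ge0 ?(ltW dl0) ?(ltW alpha0) //.
  apply: ler_pM; rewrite ?exprn_ge0 ?powR_ge0 // lerXn2r ?nnegrE // !mulr_ge0 //.
rewrite le_eqVlt; apply/orP; left; apply/eqP.
rewrite /C -/dl -/r !exprMn /p [dl ^+ q.+1]exprS.
have -> : kk%:R ^+ q = (dl ^+ q)^-1 by rewrite /dl exprVn invrK.
have n1 : dl ^+ q != 0 by rewrite expf_neq0 // gt_eqF.
have n2 : r ^+ (q.+1 + 3) != 0 by rewrite expf_neq0 // gt_eqF.
by field; rewrite n2.
Qed.

End strip_bound.

Section measurable_hit.
Context d (T : measurableType d) (R : realType).
Context (y : nat -> T -> R) (delay : nat -> T -> nat) (step : nat -> nat -> T -> nat).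
Hypothesis my : forall i, measurable_fun setT (y i).
Hypothesis mdelay : forall i, measurable_fun setT (delay i).
Hypothesis mstep : forall i j, measurable_fun setT (step i j).

Lemma measurable_hit k t : measurable [set w | hit delay step k t w].
Proof.
rewrite (_ : [set w | _] = \bigcap_(i in [set` t])
    \bigcup_n [set w | (delay i w + \sum_(j < n) step i j w)%N = k]); last first.
  apply/seteqP; split => w /=; first by move=> /asboolP H i /H[n _ <-]; exists n.
  by move=> H; apply/asboolP => i /H[n _ <-]; exists n.
apply: bigcap_measurableType => i _; apply: bigcupT_measurable => n.
have ms : measurable_fun setT (fun w => (delay i w + \sum_(j < n) step i j w)%N).
  apply: measurable_fun_addn => //; elim: n => [|n IH].
    by under eq_fun do rewrite big_ord0; exact: measurable_cst.
  by under eq_fun do rewrite big_ord_recr /=; exact: measurable_fun_addn.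
by rewrite -[X in measurable X]setTI; exact: (ms measurableT [set k]).
Qed.

Lemma measurable_hit_low_term m theta k t :
  measurable_fun setT (hit_low_term y delay step m theta k t).
Proof.
apply: measurable_funM; first exact: measurable_low_term.
rewrite (_ : (fun w => _) = \1_[set w | hit delay step k t w]).
  exact: measurable_indic (measurable_hit _ _).
apply/funext => w; rewrite indicE; congr ((nat_of_bool _)%:R).
by apply/idP/idP; rewrite inE.
Qed.

End measurable_hit.

Section far_event.
Context d (T : measurableType d) (R : realType) (P : probability T R).
Context (alpha : R) (nu : probability nat R).
Context (y : nat -> T -> R) (delay : nat -> T -> nat)
  (step : nat -> nat -> T -> nat) (sg : nat -> T -> R).
Hypothesis alpha0 : 0 < alpha.
Hypothesis alpha2 : alpha < 2.
Hypothesis my : forall i, measurable_fun setT (y i).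
Hypothesis mdelay : forall i, measurable_fun setT (delay i).
Hypothesis mstep : forall i j, measurable_fun setT (step i j).
Hypothesis msg : forall i, measurable_fun setT (sg i).
Hypothesis y0 : forall i w, 0 < y i w.
Hypothesis sg1 : forall i w, sg i w = 1 \/ sg i w = -1.
Hypothesis sg_half : forall i, P (sg i @^-1` [set 1]) = (2^-1)%:E.
Hypothesis ind : mutually_independent P (sources y delay step sg).
Hypothesis ppp : poisson_point_process P (stable_delay_intensity alpha nu)
  (fun i w => (y i w, delay i w)).
Context (q m : nat) (e : nat -> q.+1.-tuple nat).
Hypothesis e_bij : set_bij [set: nat] [set t : q.+1.-tuple nat | sorted ltn t] e.

Let e_sorted l : sorted ltn (e l).
Proof. by have [f _ _] := e_bij; exact: f. Qed.

Let e_inj : injective e.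
Proof. by have [_ i _] := e_bij => l l' h; apply: i; rewrite ?inE. Qed.

Let e_uniq l : uniq (e l).
Proof. by apply: sorted_uniq (e_sorted l); [exact: ltn_trans|exact: ltnn]. Qed.

Lemma measurable_low_sum theta k n :
  measurable_fun setT (low_sum y delay step sg m e theta k n).
Proof.
apply: measurable_sum => l; apply: measurable_funM; first exact: measurable_sign_of.
exact: measurable_hit_low_term.
Qed.

Let far_at theta c k n : set T := [set w | c < `|low_sum y delay step sg m e theta k n w|].

Let mfar_at theta c k n : measurable (far_at theta c k n).
Proof.
rewrite (_ : far_at _ _ _ _ = setT `&`
   ((fun v : R => `|v|) \o low_sum y delay step sg m e theta k n) @^-1` `]c, +oo[%classic).
  apply: (measurableT_comp _ (measurable_low_sum theta k n)) => //.
by apply/seteqP; split => w; rewrite setTI /= in_itv /= andbT.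
Qed.

(** Negated, it says that the truncated sums are at most [c] infinitely often,
   which is all that is needed of a convergent sequence; a bound for all the
   partial sums would require a maximal inequality. *)
Definition far_event (theta c : R) (k : nat) : set T :=
  \bigcup_N \bigcap_(n in [set n | (N <= n)%N]) far_at theta c k n.

Let mtail theta c k N : measurable (\bigcap_(n in [set n | (N <= n)%N]) far_at theta c k n).
Proof. by apply: bigcap_measurableType => n _; exact: mfar_at. Qed.

Lemma measurable_far_event theta c k : measurable (far_event theta c k).
Proof. by apply: bigcupT_measurable => N; exact: mtail. Qed.

Lemma not_far_event theta c k w : ~ far_event theta c k w ->
  forall N, exists2 n, (N <= n)%N & `|low_sum y delay step sg m e theta k n w| <= c.
Proof.
move=> nf N; apply: contrapT => H; apply: nf; exists N => // n /= Nn.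
by rewrite /far_at /= ltNge; apply/negP => le; apply: H; exists n.
Qed.

(** Chebyshev's inequality at each fixed [n], with orthogonal terms; continuity
   from below passes to the union over [N]. *)
Lemma far_event_le : exists2 C : R, 0 <= C &
  forall M theta c k, theta < 2 ^+ M.+1 -> 0 < c ->
  (P (far_event theta c k) <=
   (C * low_ratio alpha ^+ M * M.+1%:R ^+ q / c ^+ 2)%:E)%E.
Proof.
have [C C0 HC] := low_second_moment_le alpha0 alpha2 my mdelay y0 ppp m q.
exists C => // M theta c k hM c0.
have at_le n : (P (far_at theta c k n) <=
   (C * low_ratio alpha ^+ M * M.+1%:R ^+ q / c ^+ 2)%:E)%E.
  pose L := [seq (e l : seq nat) | l <- iota 0 n].
  have uL : uniq L.
    by rewrite map_inj_uniq ?iota_uniq // => l l' h; apply: e_inj; exact: val_inj.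
  have Lu : {in L, forall t : seq nat, uniq t /\ size t = q.+1}.
    by move=> _ /mapP[l _ ->]; rewrite size_tuple.
  have lowE w : low_sum y delay step sg m e theta k n w =
      \sum_(t <- L) sign_of sg t w * hit_low_term y delay step m theta k t w.
    by rewrite /low_sum big_map /index_iota subn0.
  have sm : (\int[P]_w ((low_sum y delay step sg m e theta k n w) ^+ 2)%:E <=
      (C * low_ratio alpha ^+ M * M.+1%:R ^+ q)%:E)%E.
    apply: le_trans (HC M theta L hM uL Lu).
    under eq_integral do rewrite lowE.
    rewrite (@second_moment _ _ _ P y delay step sg my mdelay mstep msg sg1 sg_half ind
      L _ `|theta| uL).
    - apply: lee_sum => t _; apply: ge0_le_integral => //.
      + by move=> w _; rewrite lee_fin sqr_ge0.
      + by apply/measurable_EFinP; apply: measurable_funX; exact: measurable_hit_low_term.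
      + by apply/measurable_EFinP; apply: measurable_funX; exact: measurable_low_term.
      move=> w _; rewrite lee_fin /hit_low_term exprMn.
      by case: hit; rewrite ?expr1n ?mulr1 // expr0n mulr0 sqr_ge0.
    - by move=> t /Lu[].
    - move=> _ _ /mapP[l _ ->] /mapP[l' _ ->]; apply: sorted_neq_mem => //.
      by rewrite !size_tuple.
    - move=> t i; apply: measurable_hit_low_term => j.
      + move=> _ B mB.
        have := @measurable_point_but _ _ _ y delay step sg i j measurableT (B `*` setT)
          (measurableX mB measurableT).
        by rewrite (_ : _ @^-1` _ = y j @^-1` B) //; apply/seteqP; split => w //= -[].
      + move=> _ B mB.
        have := @measurable_point_but _ _ _ y delay step sg i j measurableT (setT `*` B)
          (measurableX measurableT mB).
        by rewrite (_ : _ @^-1` _ = delay j @^-1` B) //; apply/seteqP; split => w //= -[].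
      + by move=> l; exact: measurable_step_but.
    move=> t w; have /andP[t0 t1] := low_term_le delay y0 m theta t w.
    rewrite /hit_low_term normrM (ger0_norm t0).
    by case: hit; rewrite ?normr1 ?mulr1 // normr0 mulr0.
  have c2 : 0 < c ^+ 2 by exact: exprn_gt0.
  rewrite EFinM lee_pdivlMr // muleC; apply: le_trans sm.
  have <- : (\int[P]_w ((c ^+ 2)%:E * (\1_(far_at theta c k n) w)%:E) = (c ^+ 2)%:E * P (far_at theta c k n))%E.
    rewrite ge0_integralZl //.
    - by rewrite integral_indic // setIT.
    - by apply/measurable_EFinP; exact: measurable_indic.
    - by rewrite lee_fin ltW.
  apply: ge0_le_integral => //.
  - by move=> w _; rewrite mule_ge0 // lee_fin ltW.
  - by apply: emeasurable_funM => //; apply/measurable_EFinP; exact: measurable_indic.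
  - by apply/measurable_EFinP; apply: measurable_funX; exact: measurable_low_sum.
  move=> w _; rewrite -EFinM lee_fin indicE.
  have [aw|aw] := pselect (far_at theta c k n w).
    rewrite mem_set // mulr1 -[leRHS]real_normK ?num_real //.
    by rewrite lerXn2r ?nnegrE // ltW.
  by rewrite memNset // mulr0 sqr_ge0.
have nd : nondecreasing_seq (fun N => \bigcap_(n in [set n | (N <= n)%N]) far_at theta c k n).
  move=> N N' NN'; apply/subsetPset => w H n /= N'n; apply: H => /=.
  exact: leq_trans N'n.
have cv := nondecreasing_cvg_mu (mu := P) (mtail theta c k)
  (bigcupT_measurable _ (mtail theta c k)) nd.
rewrite /far_event -(cvg_lim _ cv) //; apply: lime_le.
  by apply/cvg_ex; eexists; exact: cv.
near=> N; apply: le_trans (at_le N).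
apply: le_measure; rewrite ?inE //.
by move=> w; apply; rewrite /=.
Unshelve. all: by end_near. Qed.

End far_event.

Section low_event.
Context d (T : measurableType d) (R : realType) (P : probability T R).
Context (alpha : R) (nu : probability nat R).
Context (y : nat -> T -> R) (delay : nat -> T -> nat).
Hypothesis alpha0 : 0 < alpha.
Hypothesis my : forall i, measurable_fun setT (y i).
Hypothesis mdelay : forall i, measurable_fun setT (delay i).
Hypothesis y0 : forall i w, 0 < y i w.
Hypothesis ppp : poisson_point_process P (stable_delay_intensity alpha nu)
  (fun i w => (y i w, delay i w)).
Context (q m : nat).

Definition low_event (theta : R) : set T :=
  \bigcup_(q' in [set q' | (q' < q.+1)%N]) large_event y delay m q' theta.

Lemma measurable_large_event k n theta : measurable (large_event y delay k n theta).
Proof. by apply: measurable_union_tuples => t _; exact: measurable_large_gt. Qed.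

Lemma measurable_pair_event theta : measurable (pair_event y delay m q theta).
Proof.
by apply: measurable_union_tuples => t _; exact: measurable_pair_tuple.
Qed.

Lemma measurable_low_event theta : measurable (low_event theta).
Proof. by apply: bigcup_measurable => q' _; exact: measurable_large_event. Qed.

Lemma finite_union_le (n : nat) (F : nat -> set T) (b : nat -> R) :
  (forall i, (i < n)%N -> measurable (F i)) ->
  (forall i, (i < n)%N -> (P (F i) <= (b i)%:E)%E) ->
  (P (\bigcup_(i in [set i | (i < n)%N]) F i) <= (\sum_(i < n) b i)%:E)%E.
Proof.
move=> mF Fb; rewrite bigcup_mkord.
apply: le_trans (Boole_inequality _ _) _ => //.
by rewrite -sumEFin; apply: lee_sum => i _; exact: Fb.
Qed.

Lemma low_event_le : exists2 C : R, 0 <= C &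
  forall S theta, 2 ^+ (S + q.+1) <= theta ->
  (P (low_event theta) <=
   (C * (2 `^ (- alpha)) ^+ S * (S.+1%:R ^+ q / S.+1%:R))%:E)%E.
Proof.
have /choice[C HC] q' : exists C : R, 0 <= C /\
    forall S theta, 2 ^+ (S + q') <= theta ->
    (P (large_event y delay m q' theta) <=
     (C * (2 `^ (- alpha)) ^+ S * (S.+1%:R ^+ q' / S.+1%:R))%:E)%E.
  by have [C ? ?] := large_event_le alpha0 my mdelay y0 ppp m q'; exists C.
exists (\sum_(q' < q.+1) C q'); first by apply: sumr_ge0 => i _; case: (HC i).
move=> S theta hS; rewrite !mulr_suml.
apply: (@finite_union_le q.+1 (fun q' => large_event y delay m q' theta)
  (fun q' => C q' * (2 `^ (- alpha)) ^+ S * (S.+1%:R ^+ q / S.+1%:R))) => q' qq.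
  exact: measurable_large_event.
have [C0 H] := HC q'; apply: le_trans (H S theta _) _.
  by apply: le_trans hS; rewrite ler_weXn2l ?ler1n // leq_add2l ltnW.
rewrite lee_fin ler_wpM2l ?mulr_ge0 ?exprn_ge0 ?powR_ge0 //.
by rewrite ler_wpM2r ?invr_ge0 // ler_weXn2l ?ler1n.
Qed.

End low_event.

Section bad_event.
Context d (T : measurableType d) (R : realType) (P : probability T R).
Context (alpha : R) (nu : probability nat R).
Context (y : nat -> T -> R) (delay : nat -> T -> nat)
  (step : nat -> nat -> T -> nat) (sg : nat -> T -> R).
Hypothesis alpha0 : 0 < alpha.
Hypothesis alpha2 : alpha < 2.
Hypothesis nu0 : nu [set 0%N] = 0%E.
Hypothesis my : forall i, measurable_fun setT (y i).
Hypothesis mdelay : forall i, measurable_fun setT (delay i).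
Hypothesis mstep : forall i j, measurable_fun setT (step i j).
Hypothesis msg : forall i, measurable_fun setT (sg i).
Hypothesis y0 : forall i w, 0 < y i w.
Hypothesis sg1 : forall i w, sg i w = 1 \/ sg i w = -1.
Hypothesis sg_half : forall i, P (sg i @^-1` [set 1]) = (2^-1)%:E.
Hypothesis ind : mutually_independent P (sources y delay step sg).
Hypothesis ppp : poisson_point_process P (stable_delay_intensity alpha nu)
  (fun i w => (y i w, delay i w)).
Context (q m : nat) (e : nat -> q.+1.-tuple nat).
Hypothesis e_bij : set_bij [set: nat] [set t : q.+1.-tuple nat | sorted ltn t] e.
Context (X : nat -> T -> R).
Hypothesis mX : forall k, measurable_fun setT (X k).
Hypothesis cvX : forall k, {ae P, forall w,
  \sum_(0 <= l < n) series_term y delay step sg k (e l) w @[n --> \oo] --> X k w}.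

Definition exceed (x : R) : set T := [set w | x < `|X 0%N w|].

Lemma measurable_exceed x : measurable (exceed x).
Proof.
rewrite (_ : exceed x = setT `&` ((fun v : R => `|v|) \o X 0%N) @^-1` `]x, +oo[%classic).
  exact: (measurableT_comp _ (mX 0%N)).
by apply/seteqP; split => w; rewrite setTI /= in_itv /= andbT.
Qed.

Let r : R := 2 `^ (- alpha).
Let r0 : 0 < r. Proof. by rewrite powR_gt0. Qed.
Let sigma : R := low_ratio alpha.

(** The order of the choices matters: [delta] is fixed first, for the window;
   then the truncation ratio [2 ^- a], for the Chebyshev bound; then [N] is
   large, for the bounds that gain a factor [N]. *)
Lemma bad_event_bound (kap dl0 : R) : 0 < kap -> 0 < dl0 ->
  exists2 delta : R, 0 < delta <= 2^-1 /\ delta <= dl0 &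
  exists N0 : nat, forall N x, (N0 <= N)%N -> 2 ^+ N <= x < 2 ^+ N.+1 ->
  exists2 theta : R, theta <= x / 2 &
  [/\ (P (pair_event y delay m q theta) <= (kap * (r ^+ N * N.+1%:R ^+ q))%:E)%E,
      (P (low_event y delay q m theta) <= (kap * (r ^+ N * N.+1%:R ^+ q))%:E)%E,
      (P (\bigcup_(k in [set k | (k < m.+1)%N])
          far_event y delay step sg m e theta (delta * x) k) <=
        (kap * (r ^+ N * N.+1%:R ^+ q))%:E)%E &
      (P (strip_event y delay q m ((1 - delta) * x) ((1 + delta) * x)) <=
        (kap * (r ^+ N * N.+1%:R ^+ q))%:E)%E].
Proof.
move=> kap0 dl00.
have [C1 C10 H1] := pair_event_le alpha0 my mdelay y0 ppp m q.
have [C2 C20 H2] := low_event_le alpha0 my mdelay y0 ppp q m.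
have [C3 C30 H3] := far_event_le alpha0 alpha2 my mdelay mstep msg y0 sg1 sg_half ind ppp m e_bij.
have [C4 C40 H4] := strip_event_le alpha0 my mdelay y0 ppp q m.
have s1 : 1 < sigma by exact: low_ratio_gt1.
have s0 : 0 < sigma by exact: lt_trans s1.
(* large enough for [C4 / kk <= kap] and [delta = 1 / kk <= min dl0 (1/2)] *)
pose kk := (Num.truncn (C4 / kap + dl0^-1 + 2)).+1.
have kkB : C4 / kap + dl0^-1 + 2 < kk%:R by exact: truncnS_gt.
have C4k : 0 <= C4 / kap by rewrite divr_ge0 // ltW.
have dlV : 0 < dl0^-1 by rewrite invr_gt0.
have kk0 : 0 < kk%:R :> R by [].
have kk2 : (2 <= kk)%N by rewrite -(ler_nat R); lra.
pose delta : R := kk%:R^-1.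
have delta0 : 0 < delta by rewrite invr_gt0.
exists delta.
  split; first by rewrite delta0 /= lef_pV2 ?posrE // ler_nat.
  by rewrite -[dl0]invrK lef_pV2 ?posrE //; lra.
(* the Chebyshev bound is [C3 * sigma ^+ (N - a)] over [(delta * x) ^+ 2], and
   [sigma ^+ N = 4 ^+ N * r ^+ N] *)
have [a' Ha'] := archi_pow (m.+1%:R * C3 * kk%:R ^+ 2 / kap) s1.
pose a := a'.+1; pose p := q.+1.
have ra0 : 0 < r ^+ (a + p) * kap by rewrite mulr_gt0 // exprn_gt0.
(* the shift of the level by [a + p] costs [r ^+ (a + p)], made up for by the
   gain [N1] *)
pose N1 := (Num.truncn ((C1 + C2) / (r ^+ (a + p) * kap))).+1.
have HN1 : (C1 + C2) / (r ^+ (a + p) * kap) < N1%:R by exact: truncnS_gt.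
exists (N1 + a + p + 2)%N => N x hN hx; have /andP[xN xN1] := hx.
pose S := (N - (a + p))%N; pose M := (N - a)%N.
have SN : (S + (a + p))%N = N by rewrite subnK //; move: hN; clear; lia.
have MN : (M + a)%N = N by rewrite subnK //; move: hN; clear; lia.
have x0 : 0 < x by apply: lt_le_trans xN; rewrite exprn_gt0.
pose theta : R := 2 ^+ M.
have thS : 2 ^+ (S + q.+1) <= theta.
  rewrite /theta ler_weXn2l ?ler1n //; move: SN MN; rewrite /p; clear; lia.
have lt12 : 1 < 2 :> R by rewrite ltr1n.
have thM : theta < 2 ^+ M.+1 by rewrite ltr_eXn2l.
pose Psi : R := r ^+ N * N.+1%:R ^+ q.
have Psi0 : 0 <= Psi by rewrite mulr_ge0 // exprn_ge0 // ltW.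
have low C : 0 <= C -> C <= C1 + C2 ->
    C * r ^+ S * (S.+1%:R ^+ q / S.+1%:R) <= kap * Psi.
  move=> C0 CC.
  have rN : r ^+ N = r ^+ S * r ^+ (a + p) by rewrite -exprD SN.
  rewrite /Psi rN.
  have rS : 0 <= r ^+ S by rewrite exprn_ge0 // ltW.
  have S10 : 0 < S.+1%:R :> R by [].
  apply: (@le_trans _ _ (C / S.+1%:R * r ^+ S * N.+1%:R ^+ q)).
    rewrite (_ : C * _ * _ = C / S.+1%:R * r ^+ S * S.+1%:R ^+ q); last by ring.
    rewrite ler_wpM2l ?mulr_ge0 ?invr_ge0 // lerXn2r ?nnegrE // ler_nat ltnS.
    by rewrite -SN leq_addr.
  have CS : C / S.+1%:R <= r ^+ (a + p) * kap.
    rewrite ler_pdivrMr //; apply: le_trans CC _.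
    move: HN1; rewrite ltr_pdivrMr // => /ltW h; apply: le_trans h _.
    rewrite mulrC ler_wpM2l ?(ltW ra0) // ler_nat; move: hN SN; clear; lia.
  have mulE (u v n : R) : kap * (u * v * n) = v * kap * u * n by ring.
  rewrite mulE ler_wpM2r ?exprn_ge0 // ler_wpM2r //.
exists theta.
  rewrite ler_pdivlMr //; apply: le_trans xN.
  by rewrite /theta -exprSr ler_weXn2l ?ler1n // -MN /a addnS ltnS leq_addr.
split.
- by apply: le_trans (H1 S theta thS) _; rewrite lee_fin low // lerDl.
- by apply: le_trans (H2 S theta thS) _; rewrite lee_fin low // lerDr.
- apply: le_trans (@finite_union_le _ _ _ P m.+1 _
    (fun=> C3 * sigma ^+ M * M.+1%:R ^+ q / (delta * x) ^+ 2) _ _) _.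
  + by move=> k _; exact: measurable_far_event.
  + by move=> k _; apply: H3 => //; exact: mulr_gt0.
  rewrite lee_fin sumr_const card_ord -[leLHS]mulr_natl -/Psi.
  have x2 : 4 ^+ N <= x ^+ 2.
    have -> : 4 ^+ N = (2 ^+ N) ^+ 2 :> R.
      by rewrite -exprM mulnC exprM; congr (_ ^+ _); rewrite -natrX.
    by rewrite lerXn2r ?nnegrE ?exprn_ge0 // ltW.
  have sN : sigma ^+ M * sigma ^+ a = 4 ^+ N * r ^+ N.
    by rewrite -exprD MN /sigma /low_ratio exprMn.
  have sa : m.+1%:R * C3 * kk%:R ^+ 2 <= kap * sigma ^+ a.
    rewrite -ler_pdivrMl // mulrC; apply: le_trans (ltW Ha') _.
    by rewrite ler_weXn2l // ltW.
  have sM0 : 0 <= sigma ^+ M by rewrite exprn_ge0 // ltW.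
  have x20 : 0 < x ^+ 2 by rewrite exprn_gt0.
  have -> : m.+1%:R * (C3 * sigma ^+ M * M.+1%:R ^+ q / (delta * x) ^+ 2) =
     (m.+1%:R * C3 * kk%:R ^+ 2) * (sigma ^+ M * M.+1%:R ^+ q) / x ^+ 2.
    rewrite /delta; field.
    by rewrite (gt_eqF x0) (gt_eqF kk0).
  rewrite ler_pdivrMr //.
  apply: (@le_trans _ _ (kap * sigma ^+ a * (sigma ^+ M * N.+1%:R ^+ q))).
    apply: ler_pM; [|by rewrite mulr_ge0 ?sM0 ?exprn_ge0|exact: sa|].
      by rewrite mulr_ge0 ?exprn_ge0 // mulr_ge0.
    by rewrite ler_wpM2l // lerXn2r ?nnegrE // ler_nat ltnS; exact: leq_subr.
  rewrite [leLHS](_ : _ = kap * (sigma ^+ M * sigma ^+ a) * N.+1%:R ^+ q); last by ring.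
  rewrite sN [leLHS](_ : _ = kap * Psi * 4 ^+ N); last by rewrite /Psi; ring.
  by rewrite ler_wpM2l // mulr_ge0 // ltW.
apply: le_trans (H4 kk N x kk2 _ hx) _; first by move: hN; rewrite /p; clear; lia.
rewrite lee_fin ler_wpM2r // ler_pdivrMr // mulrC -ler_pdivrMr //; lra.
Qed.

(** All the exceptional events, and the null set where the series diverges, are
   gathered in one event that is negligible relative to the conditioning
   event. *)
Lemma bad_event_exists (kap dl0 : R) : 0 < kap -> kap <= 1 -> 0 < dl0 ->
  exists2 delta : R, 0 < delta <= dl0 &
  \forall x \near +oo, exists Bad : set T,
  [/\ measurable Bad, (P Bad <= kap%:E * P (exceed x))%E, (0 < P (exceed x))%E,
      forall w, ~ Bad w -> exceed x w <-> exists t, main_tuple y delay q x t w &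
      forall w, ~ Bad w -> forall t, main_tuple y delay q x t w ->
        forall k, (k <= m)%N ->
        `|X k w / `|X 0%N w| - sign_of sg t w * (hit delay step k t w)%:R| <= 2 * delta].
Proof.
move=> kap0 kap1 dl00.
have [c c0 [Nc _ Hc]] := large_event_ge alpha0 my mdelay nu0 ppp q.
(* four exceptional events, and [P (exceed x)] is at least half of the lower
   bound [c * r * Psi] *)
pose kap' := kap * (c * r) / 8.
have cr : 0 < c * r by exact: mulr_gt0.
have kap'0 : 0 < kap' by rewrite divr_gt0 // mulr_gt0.
have [delta [d12 dd] [N0 HN]] := bad_event_bound kap'0 dl00.
exists delta; first by case/andP: d12 => -> _.
have lt12 : 1 < 2 :> R by rewrite ltr1n.
near=> x.
have xbig : 2 ^+ (N0 + Nc) <= x by near: x; exact: nbhs_pinfty_ge.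
have x1 : 1 <= x by apply: le_trans xbig; rewrite exprn_ege1 // ler1n.
have x0 : 0 < x by exact: lt_le_trans x1.
have [N hx] := level_ex lt12 x1; have /andP[xN xN1] := hx.
have NN : (N0 + Nc <= N)%N.
  by have := le_lt_trans xbig xN1; rewrite ltr_eXn2l // ltnS.
have [|theta thx [B1 B2 B3 B4]] := HN N x _ hx.
  by apply: leq_trans NN; exact: leq_addr.
pose Psi : R := r ^+ N * N.+1%:R ^+ q.
have Psi0 : 0 < Psi by rewrite mulr_gt0 // exprn_gt0.
have low : ((c * r * Psi)%:E <= P (large_event y delay 0 q.+1 x))%E.
  apply: le_trans (Hc N.+1 _ x xN1); last first.
    by apply: leq_trans (leqW NN); exact: leq_addl.
  rewrite lee_fin /Psi -/r exprS le_eqVlt; apply/orP; left; apply/eqP; ring.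
have [Nul [mNul PNul subNul]] : P.-negligible
    [set w | ~ forall k, (k <= m)%N -> \sum_(0 <= l < n)
       series_term y delay step sg k (e l) w @[n --> \oo] --> X k w].
  have h k : P.-negligible [set w | ~ (\sum_(0 <= l < n)
       series_term y delay step sg k (e l) w @[n --> \oo] --> X k w)].
    exact: cvX.
  apply: negligibleS (negligible_bigcup h) => w /= /existsNP[k /not_implyP[_ nk]].
  by exists k.
pose F := \bigcup_(k in [set k | (k < m.+1)%N])
          far_event y delay step sg m e theta (delta * x) k.
pose B12 := pair_event y delay m q theta `|` low_event y delay q m theta.
pose B34 := F `|` strip_event y delay q m ((1 - delta) * x) ((1 + delta) * x).
have mF : measurable F by apply: bigcup_measurable => k _; exact: measurable_far_event.
have mB12 : measurable B12.
  by apply: measurableU; [exact: measurable_pair_event|exact: measurable_low_event].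
have mB34 : measurable B34.
  by apply: measurableU => //; exact: measurable_strip_event.
pose Bad := (B12 `|` B34) `|` Nul.
have mB : measurable (B12 `|` B34) by exact: measurableU.
have mBad : measurable Bad by exact: measurableU.
have PBad : (P Bad <= (c * r * kap / 2 * Psi)%:E)%E.
  rewrite /Bad measureU0 //.
  apply: le_trans (measureU2 _ mB12 mB34) _.
  have P12 : (P B12 <= (kap' * Psi + kap' * Psi)%:E)%E.
    rewrite EFinD; apply: le_trans (measureU2 _ _ _) (leeD B1 B2).
      exact: measurable_pair_event.
    exact: measurable_low_event.
  have P34 : (P B34 <= (kap' * Psi + kap' * Psi)%:E)%E.
    rewrite EFinD; apply: le_trans (measureU2 _ mF _) (leeD B3 B4).
    exact: measurable_strip_event.
  apply: le_trans (leeD P12 P34) _; rewrite -EFinD lee_fin.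
  by rewrite le_eqVlt; apply/orP; left; apply/eqP; rewrite /kap'; field.
have struct w : ~ Bad w ->
  (x < `|X 0%N w| <-> exists t, main_tuple y delay q x t w) /\
  (large_event y delay 0 q.+1 x w -> x < `|X 0%N w|) /\
  (forall t, main_tuple y delay q x t w -> forall k, (k <= m)%N ->
     `|X k w / `|X 0%N w| - sign_of sg t w * (hit delay step k t w)%:R| <= 2 * delta).
  move=> nB; apply: (path_structure y0 sg1 e_bij x0 d12 thx).
  - by move=> h; apply: nB; left; left; left.
  - by move=> q' qq h; apply: nB; left; left; right; exists q'.
  - move=> k km; apply: not_far_event => h; apply: nB; left; right; left.
    by exists k.
  - by apply: contrapT => h; apply: nB; right; exact: subNul.
  - by move=> [t ut ht]; apply: nB; left; right; right; exists t.
have PE : ((c * r / 2 * Psi)%:E <= P (exceed x))%E.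
  have mE := measurable_exceed x.
  have sub : large_event y delay 0 q.+1 x `<=` exceed x `|` Bad.
    move=> w lw; have [Bw|Bw] := pselect (Bad w); first by right.
    by left; have [_ [h _]] := struct w Bw; exact: h.
  have : (P (large_event y delay 0 q.+1 x) <= P (exceed x) + P Bad)%E.
    apply: le_trans (measureU2 _ mE mBad); apply: le_measure; rewrite ?inE //.
      exact: measurable_large_event.
    exact: measurableU.
  move=> /(le_trans low); rewrite -[P (exceed x)]fineK ?fin_num_measure //.
  move=> /le_trans/(_ (leeD (lexx _) PBad)).
  rewrite -EFinD !lee_fin => h.
  have : c * r * kap / 2 * Psi <= c * r / 2 * Psi.
    rewrite ler_wpM2r ?(ltW Psi0) // ler_wpM2r // ler_piMr // ltW //.
  have -> : c * r / 2 * Psi = c * r * Psi / 2 by ring.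
  lra.
exists Bad; split => //.
- apply: le_trans PBad _.
  apply: (@le_trans _ _ (kap%:E * (c * r / 2 * Psi)%:E)%E).
    by rewrite -EFinM lee_fin le_eqVlt; apply/orP; left; apply/eqP; ring.
  by apply: lee_wpmul2l => //; rewrite lee_fin ltW.
- by apply: lt_le_trans PE; rewrite lte_fin mulr_gt0 // divr_gt0.
- by move=> w /struct[].
- by move=> w /struct[_ [_]].
Unshelve. all: by end_near. Qed.

End bad_event.

(** * Borel sets of row vectors *)

Section borel_row_vectors.
Context (R : realType) (n : nat).

(** Boxes with rational centres and radii of the form [1 / k.+1]: a countable
   base of the topology. *)
Definition box (c : {ffun 'I_n -> rat}) (k : nat) : set 'rV[R]_n :=
  [set v | forall j, `|ratr (c j) - v 0 j| < k.+1%:R^-1].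

Lemma open_boxes (U : set 'rV[R]_n) : open U ->
  U = \bigcup_(ck in [set ck : {ffun 'I_n -> rat} * nat | box ck.1 ck.2 `<=` U])
        box ck.1 ck.2.
Proof.
move=> oU; apply/seteqP; split => [v Uv|v [ck ckU]]; last exact: ckU.
have /nbhs_ballP[e /= e0 eU] : nbhs v U by exact: open_nbhs_nbhs.
have [k hk] : exists k : nat, k.+1%:R^-1 < e / 2.
  exists (Num.truncn (2 / e)); rewrite invf_plt ?posrE // ?divr_gt0 // invf_div.
  exact: truncnS_gt.
pose s : R := k.+1%:R^-1.
have s0 : 0 < s by rewrite invr_gt0.
have /choice[c hc] (j : 'I_n) : exists c : rat, ratr c \in `](v 0 j - s), (v 0 j + s)[.
  by apply: rat_in_itvoo; lra.
pose c' : {ffun 'I_n -> rat} := [ffun j => c j].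
have near j : `|ratr (c' j) - v 0 j| < s.
  by rewrite ffunE ltr_distl; have := hc j; rewrite in_itv.
exists (c', k) => //= u bu; apply: eU; split => // i j; rewrite ord1.
rewrite /ball /= (_ : v 0 j - u 0 j = (ratr (c' j) - u 0 j) - (ratr (c' j) - v 0 j)); last by ring.
apply: le_lt_trans (ler_normB _ _) _; have := bu j; have := near j; rewrite -/s.
move: hk; rewrite -/s; lra.
Qed.

Lemma measurable_row d (T : measurableType d) (V : T -> 'rV[R]_n) :
  (forall j, measurable_fun setT (fun w => V w 0 j)) ->
  measurable_fun setT (V : T -> borel_rV R n).
Proof.
move=> mV; apply: (@measurability _ _ T (borel_rV R n) setT V (@open 'rV[R]_n)) => //.
move=> _ [U oU <-]; rewrite setTI (open_boxes oU) preimage_bigcup bigcup_mkcond.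
apply: countable_bigcupT_measurable => [|[c k]]; first exact: countableP.
case: ifP => _ //; rewrite (_ : _ @^-1` _ = \bigcap_(j in [set: 'I_n])
    ((fun w => V w 0 j) @^-1` ball (ratr (c j) : R) (k.+1%:R^-1 : R))).
  apply: fin_bigcap_measurable; first exact: finite_finset.
  by move=> j _; rewrite -[X in measurable X]setTI; apply: mV => //; exact: measurable_ball.
by apply/seteqP; split => w /= H j; [move=> _|]; exact: H.
Qed.

Lemma continuous_measurable_rV (g : 'rV[R]_n -> R) : continuous g ->
  measurable_fun setT (g : borel_rV R n -> R).
Proof.
move=> /continuousP cg; apply: (measurability _ (RGenOpens.measurableE R)).
move=> _ [_ [a [b ->]] <-]; rewrite setTI.
apply: sub_sigma_algebra; apply: cg; exact: interval_open.
Qed.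

End borel_row_vectors.

(** Used with [A t] the event that [t] is the main tuple and [B t] the part of
   it with prescribed marks. *)
Lemma measure_proportional d (T : measurableType d) (R : realType)
    (P : probability T R) (I : countType) (A B : I -> set T) (c : R) :
  (forall t, measurable (A t)) -> (forall t, measurable (B t)) ->
  (forall t, B t `<=` A t) -> trivIset setT A -> 0 <= c ->
  (forall t, P (B t) = (c * fine (P (A t)))%:E) ->
  P (\bigcup_t B t) = (c * fine (P (\bigcup_t A t)))%:E.
Proof.
move=> mA mB BA tA c0 BcA.
pose enum (C : I -> set T) n := if pickle_inv n is Some t then C t else set0.
have enumE C : \bigcup_t C t = \bigcup_n enum C n.
  apply/seteqP; split => w []; first by move=> t _ Ct; exists (pickle t) => //; rewrite /enum pickleK_inv.
  by move=> n _; rewrite /enum; case: (pickle_inv n) => // t Ct; exists t.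
have m C : (forall t, measurable (C t)) -> forall n, measurable (enum C n).
  by move=> mC n; rewrite /enum; case: (pickle_inv n).
have tr C : trivIset setT C -> trivIset setT (enum C).
  move=> tC n n' _ _ [w []]; rewrite /enum.
  case e: (pickle_inv n) => [t|//]; case e': (pickle_inv n') => [t'|//] Ct Ct'.
  have tt' : t = t' by apply: tC => //; exists w.
  have := @pickle_invK I n; have := @pickle_invK I n'.
  by rewrite /ocancel /oapp e e' tt' => <- <-.
have tB : trivIset setT B.
  by move=> t t' _ _ [w [/BA a /BA b]]; apply: tA => //; exists w.
have PE C : (forall t, measurable (C t)) -> trivIset setT C ->
    P (\bigcup_t C t) = (\sum_(n <oo) P (enum C n))%E.
  by move=> mC tC; rewrite enumE measure_bigcup //; [by apply: eq_eseriesl => ?; rewrite in_setT|by move=> *; exact: m|exact: tr].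
rewrite PE // (eq_eseriesr (g := fun n => c%:E * P (enum A n))%E); last first.
  move=> n _; rewrite /enum; case: (pickle_inv n) => [t|]; last by rewrite !measure0 mule0.
  by rewrite BcA EFinM fineK ?fin_num_measure.
rewrite nneseriesZl // -PE // EFinM fineK // fin_num_measure //.
by rewrite enumE; apply: bigcupT_measurable; exact: m.
Qed.

(** * The law of the marks of the main tuple *)

Section main_event.
Context d (T : measurableType d) (R : realType).
Context (y : nat -> T -> R) (delay : nat -> T -> nat) (q : nat).
Local Notation main := (main_tuple y delay q).

Lemma trivIset_main x : trivIset setT (fun t => [set w | main x t w]).
Proof.
by move=> t t' _ _ [w [[st sz l xt _] [_ _ _ _ h]]]; exact: h.
Qed.

Lemma measurable_main x t : (forall i, measurable_fun setT (y i)) ->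
  (forall i, measurable_fun setT (delay i)) -> measurable [set w | main x t w].
Proof.
move=> my mdelay.
case st: (sorted ltn t); last by rewrite (_ : [set w | _] = set0) //; apply/seteqP; split => // w []; rewrite st.
have [sz|sz] := eqVneq (size t) q.+1; last first.
  by rewrite (_ : [set w | _] = set0) //; apply/seteqP; split => // w [_ e]; rewrite e eqxx in sz.
pose L t' := [set w | large y delay 0 t' w && (x < prodY y t' w)].
have mL t' : measurable (L t') by exact: measurable_large_gt.
rewrite (_ : [set w | _] = L t `\`
    \bigcup_(t' in [set t' | [&& sorted ltn t', size t' == q.+1 & t' != t]]) L t').
  by apply: measurableD => //; apply: measurable_union_tuples.
apply/seteqP; split => w.
  move=> [_ _ l xt h]; split; first by apply/andP.
  move=> [t' /= /and3P[st' /eqP sz' /eqP tt'] /andP[l' xt']].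
  by apply: tt'; exact: h.
move=> [/andP[l xt] h]; split => // t' st' sz' l' xt'.
apply/eqP/negPn/negP => tt'; apply: h; exists t' => /=; first by rewrite st' sz' eqxx.
exact/andP.
Qed.

Definition main_event x := \bigcup_t [set w | main x t w].

End main_event.

Section main_marks.
Context d (T : measurableType d) (R : realType) (P : probability T R).
Context (nu : probability nat R) (y : nat -> T -> R) (delay : nat -> T -> nat)
  (step : nat -> nat -> T -> nat) (sg : nat -> T -> R).
Hypothesis my : forall i, measurable_fun setT (y i).
Hypothesis mdelay : forall i, measurable_fun setT (delay i).
Hypothesis mstep : forall i j, measurable_fun setT (step i j).
Hypothesis msg : forall i, measurable_fun setT (sg i).
Hypothesis sg1 : forall i w, sg i w = 1 \/ sg i w = -1.
Hypothesis sg_half : forall i, P (sg i @^-1` [set 1]) = (2^-1)%:E.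
Hypothesis ind : mutually_independent P (sources y delay step sg).
Hypothesis step_law : forall i j, has_law P (step i j) nu.
Hypothesis nu0 : nu [set 0%N] = 0%E.
Context (q m : nat).
Local Notation main := (main_tuple y delay q).

(** That [t] is the main tuple depends on the sizes and the delays only, which
   is what makes the marks independent of it. *)
Lemma main_points x t : sources y delay step sg (inl tt) [set w | main x t w].
Proof.
pose T' : Type := g_sigma_algebraType
  (\bigcup_(i in [set: nat]) sigma_rv (fun w => (y i w, delay i w))).
have mz i : measurable_fun [set: T'] ((fun w => (y i w, delay i w)) : T' -> _).
  by move=> _ B mB; apply: sub_sigma_algebra; exists i => //; exists B.
apply: (@measurable_main _ T' R y delay q x t) => i.
  exact: (measurableT_comp measurable_fst (mz i)).
exact: (measurableT_comp measurable_snd (mz i)).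
Qed.

Definition marked (x s : R) (v : {ffun 'I_m.+1 -> bool}) (t : seq nat) : set T :=
  [set w | main x t w] `&` [set w | tuple_bits step m q.+1 t w = v] `&`
  [set w | sign_of sg t w = s].

Lemma bits_mass_ge0 p' (v : {ffun 'I_m.+1 -> bool}) : 0 <= bits_mass nu p' v.
Proof.
by apply: sumr_ge0 => c _; apply: prodr_ge0 => rj _; exact: fine_ge0.
Qed.

Lemma measurable_marked x s v t : measurable (marked x s v t).
Proof.
apply: measurableI.
  by apply: measurableI; [exact: measurable_main|exact: measurable_renewal_bits].
rewrite -[X in measurable X]setTI; exact: (measurable_sign_of msg t measurableT (Y := [set s])).
Qed.

(** Sum of [marks_law] over the disjoint events of the possible main tuples. *)
Lemma marked_event_law x s v : s = 1 \/ s = -1 ->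
  P (\bigcup_t marked x s v t) =
  (2^-1 * bits_mass nu q.+1 v * fine (P (main_event y delay q x)))%:E.
Proof.
move=> s1; apply: measure_proportional.
- by move=> t; exact: measurable_main.
- by move=> t; exact: measurable_marked.
- by move=> t w [[]].
- exact: trivIset_main.
- by rewrite mulr_ge0 ?bits_mass_ge0.
move=> t.
case h: (sorted ltn t && (size t == q.+1)); last first.
  have e : [set w | main x t w] = set0.
    by apply/seteqP; split => // w [st sz _ _ _]; move: h; rewrite st sz eqxx.
  by rewrite /marked e !set0I measure0 mulr0.
have /andP[st /eqP sz] := h.
rewrite /marked -sz (@marks_law _ _ _ _ nu _ _ _ _ my mdelay mstep msg sg1 sg_half ind step_law nu0) //.
- by rewrite sz; congr (_%:E); ring.
- by apply: sorted_uniq st; [exact: ltn_trans|exact: ltnn].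
- by rewrite -size_eq0 sz.
- exact: main_points.
Qed.

End main_marks.

(** * Limit of the conditional mean *)

Lemma Rintegral_indic_sum d (T : measurableType d) (R : realType)
    (P : probability T R) (I : finType) (c : I -> R) (H : I -> set T) :
  (forall i, measurable (H i)) ->
  \int[P]_w (\sum_i c i * \1_(H i) w) = \sum_i c i * fine (P (H i)).
Proof.
move=> mH; rewrite /Rintegral.
have int1 i : P.-integrable setT (EFin \o (\1_(H i) : T -> R)).
  apply: (@bounded_integrable _ _ _ _ _ 1) => // w.
  by rewrite indicE; case: (w \in _); rewrite ?normr1 ?normr0.
under eq_integral do rewrite -sumEFin.
rewrite integral_sum //; last first.
  move=> i; rewrite (_ : (fun w => _) = (fun w => (c i)%:E * (EFin \o (\1_(H i) : T -> R)) w)%E).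
    exact: integrableZl.
  by apply/funext => w; rewrite /= EFinM.
rewrite (eq_bigr (fun i => (c i * fine (P (H i)))%:E)); first by rewrite sumEFin.
move=> i _; under eq_integral do rewrite EFinM.
rewrite integralZl //; last exact: int1.
by rewrite integral_indic // setIT EFinM fineK // fin_num_measure.
Qed.

Section limit_values.
Context (R : realType) (m : nat).

Definition sign_bool (b : bool) : R := (-1) ^+ b.

Definition signed_row (bv : bool * {ffun 'I_m.+1 -> bool}) : 'rV[R]_m.+1 :=
  \row_k (sign_bool bv.1 * (bv.2 k)%:R).

Lemma sign_bool_cases b : sign_bool b = 1 \/ sign_bool b = -1.
Proof. by case: b; [right|left]. Qed.

Lemma sign_bool_inj : injective sign_bool.
Proof.
have n : (1 : R) != -1 by rewrite -addr_eq0 -mulr2n pnatr_eq0.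
by move=> [] [] // /eqP; rewrite /sign_bool expr0 expr1 ?(negbTE n) // eq_sym (negbTE n).
Qed.

Lemma sign_bool_ex (s : R) : s = 1 \/ s = -1 -> exists b, s = sign_bool b.
Proof. by move=> [->|->]; [exists false|exists true]. Qed.

(** The mean of [g] under the law of the limit. *)
Definition limit_value (nu : probability nat R) (p : nat) (g : 'rV[R]_m.+1 -> R) : R :=
  \sum_bv g (signed_row bv) * (2^-1 * bits_mass nu p bv.2).

(** The limit has finitely many values, so that continuity at each of them gives
   a common [dl]. *)
Lemma continuous_at_signed_rows (g : 'rV[R]_m.+1 -> R) (eps : R) : continuous g ->
  0 < eps -> exists2 dl : R, 0 < dl & forall bv (u : 'rV[R]_m.+1),
    (forall k, `|u 0 k - signed_row bv 0 k| <= dl) -> `|g u - g (signed_row bv)| <= eps.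
Proof.
move=> cg eps0.
have H : \forall dl \near 0^'+, forall bv (u : 'rV[R]_m.+1),
    (forall k, `|u 0 k - signed_row bv 0 k| <= dl) -> `|g u - g (signed_row bv)| <= eps.
  apply: filter_forall => bv.
  have /cvgrPdist_le/(_ _ eps0)/nbhs_ballP[e /= e0 He] := cg (signed_row bv).
  near=> dl => u hu; rewrite distrC; apply: He; split => // i j; rewrite ord1.
  rewrite /ball /= distrC; apply: le_lt_trans (hu j) _.
  near: dl; exact: nbhs_right_lt.
have : \forall dl \near (0 : R)^'+, 0 < dl /\ forall bv (u : 'rV[R]_m.+1),
    (forall k, `|u 0 k - signed_row bv 0 k| <= dl) -> `|g u - g (signed_row bv)| <= eps.
  near=> dl; split; [near: dl; exact: nbhs_right_gt|near: dl; exact: H].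
by move=> /filter_ex[dl [? ?]]; exists dl.
Unshelve. all: by end_near. Qed.

End limit_values.

Section conditional_mean.
Context d (T : measurableType d) (R : realType) (P : probability T R).
Context (alpha : R) (nu : probability nat R).
Context (y : nat -> T -> R) (delay : nat -> T -> nat)
  (step : nat -> nat -> T -> nat) (sg : nat -> T -> R).
Hypothesis alpha0 : 0 < alpha.
Hypothesis alpha2 : alpha < 2.
Hypothesis nu0 : nu [set 0%N] = 0%E.
Hypothesis my : forall i, measurable_fun setT (y i).
Hypothesis mdelay : forall i, measurable_fun setT (delay i).
Hypothesis mstep : forall i j, measurable_fun setT (step i j).
Hypothesis msg : forall i, measurable_fun setT (sg i).
Hypothesis y0 : forall i w, 0 < y i w.
Hypothesis sg1 : forall i w, sg i w = 1 \/ sg i w = -1.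
Hypothesis sg_half : forall i, P (sg i @^-1` [set 1]) = (2^-1)%:E.
Hypothesis ind : mutually_independent P (sources y delay step sg).
Hypothesis step_law : forall i j, has_law P (step i j) nu.
Hypothesis ppp : poisson_point_process P (stable_delay_intensity alpha nu)
  (fun i w => (y i w, delay i w)).
Context (q m : nat) (e : nat -> q.+1.-tuple nat).
Hypothesis e_bij : set_bij [set: nat] [set t : q.+1.-tuple nat | sorted ltn t] e.
Context (X : nat -> T -> R).
Hypothesis mX : forall k, measurable_fun setT (X k).
Hypothesis cvX : forall k, {ae P, forall w,
  \sum_(0 <= l < n) series_term y delay step sg k (e l) w @[n --> \oo] --> X k w}.

Definition ratio_row (w : T) : 'rV[R]_m.+1 := \row_k (X k w / `|X 0%N w|).

Lemma measurable_ratio_row : measurable_fun setT (ratio_row : T -> borel_rV R m.+1).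
Proof.
apply: measurable_row => j.
under eq_fun do rewrite mxE -powR_inv1 //.
apply: measurable_funM => //; apply: (measurableT_comp (measurable_powR _)).
exact: measurableT_comp.
Qed.

Context (g : 'rV[R]_m.+1 -> R) (M : R).
Hypothesis cg : continuous g.
Hypothesis gM : forall v, `|g v| <= M.

Let exceedX := exceed X.
Let H x (bv : bool * {ffun 'I_m.+1 -> bool}) : set T :=
  \bigcup_t marked y delay step sg q x (sign_bool R bv.1) bv.2 t.
Let W x (w : T) : R := \sum_bv g (signed_row R bv) * \1_(H x bv) w.
Let U x (w : T) : R := \1_(exceedX x) w * g (ratio_row w).
Let Ev := limit_value nu q.+1 g.

Let mH x bv : measurable (H x bv).
Proof.
apply: countable_bigcupT_measurable => // t; exact: measurable_marked.
Qed.

Let mmain x : measurable (main_event y delay q x).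
Proof. by apply: countable_bigcupT_measurable => // t; exact: measurable_main. Qed.

Let mean_W x : \int[P]_w W x w = Ev * fine (P (main_event y delay q x)).
Proof.
rewrite /W Rintegral_indic_sum // /Ev /limit_value mulr_suml.
apply: eq_bigr => bv _; rewrite -mulrA; congr (_ * _).
by rewrite (@marked_event_law _ _ _ _ nu) //; exact: sign_bool_cases.
Qed.

Let W_main x t w b : main_tuple y delay q x t w -> sign_of sg t w = sign_bool R b ->
  W x w = g (signed_row R (b, tuple_bits step m q.+1 t w)).
Proof.
move=> mt st; rewrite /W (bigD1 (b, tuple_bits step m q.+1 t w)) //= big1.
  rewrite addr0 indicE mem_set ?mulr1 //; exists t => //.
move=> bv bvn; rewrite indicE memNset ?mulr0 //.
move=> [t' _ [[mt' bt'] st']]; have [_ _ _ _ uni] := mt.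
have tt' : t' = t by case: mt' => a1 a2 a3 a4 _; exact: uni.
move/eqP: bvn; apply; move: bt' st'; rewrite /= tt' => ->.
by rewrite st => /sign_bool_inj ->; case: bv.
Qed.

Let W_nomain x w : ~ (exists t, main_tuple y delay q x t w) -> W x w = 0.
Proof.
move=> n; rewrite /W big1 // => bv _; rewrite indicE memNset ?mulr0 //.
by move=> [t _ [[mt _] _]]; apply: n; exists t.
Qed.

Let M0 : 0 <= M. Proof. exact: le_trans (normr_ge0 _) (gM 0). Qed.

Let W_le x w : `|W x w| <= M.
Proof.
have [[t mt]|/W_nomain ->] := pselect (exists t, main_tuple y delay q x t w); last first.
  by rewrite normr0.
have [b sb] := sign_bool_ex (sign_of1 sg1 t w).
by rewrite (W_main mt sb).
Qed.

Let U_le x w : `|U x w| <= M.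
Proof.
rewrite /U indicE; case: (w \in _); first by rewrite mul1r.
by rewrite mul0r normr0.
Qed.

Let mW x : measurable_fun setT (W x).
Proof.
apply: measurable_sum => bv; apply: measurable_funM => //.
Qed.

Lemma measurable_g_ratio : measurable_fun setT (fun w => g (ratio_row w)).
Proof. exact: measurableT_comp (continuous_measurable_rV cg) measurable_ratio_row. Qed.

Let mU x : measurable_fun setT (U x).
Proof.
apply: measurable_funM; last exact: measurable_g_ratio.
by apply: measurable_indic; exact: measurable_exceed.
Qed.

(** Off the bad event [U x] is within [eps / 2] of [W x], a combination of
   indicators of marked events, whose mean is known exactly. *)
Lemma conditional_mean_near (eps : R) : 0 < eps ->
  \forall x \near +oo, (0 < P (exceedX x))%E /\
    `|\int[P]_w U x w - Ev * fine (P (exceedX x))| <= eps * fine (P (exceedX x)).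
Proof.
move=> eps0.
pose K := 2 * M + `|Ev| + 1.
have K0 : 0 < K by have := normr_ge0 Ev; have := M0; rewrite /K; lra.
pose kap := Num.min 1 (eps / 2 / K).
have eps2 : 0 < eps / 2 by lra.
have kap0 : 0 < kap by rewrite /kap lt_min ltr01 divr_gt0.
have kap1 : kap <= 1 by rewrite ge_min lexx.
have kapK : kap * K <= eps / 2 by rewrite -ler_pdivlMr // ge_min lexx orbT.
have [dl dl0 Hdl] := continuous_at_signed_rows cg eps2.
have [|delta /andP[delta0 hdelta] near_bad] := bad_event_exists alpha0 alpha2 nu0 my mdelay mstep
  msg y0 sg1 sg_half ind ppp m e_bij mX cvX kap0 kap1 (dl0 := dl / 2); first by lra.
near=> x.
have [Bad [mBad PBad PE HE HX]] : exists Bad : set T,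
  [/\ measurable Bad, (P Bad <= kap%:E * P (exceed X x))%E, (0 < P (exceed X x))%E,
      forall w, ~ Bad w -> exceed X x w <-> exists t, main_tuple y delay q x t w &
      forall w, ~ Bad w -> forall t, main_tuple y delay q x t w ->
        forall k, (k <= m)%N ->
        `|X k w / `|X 0%N w| - sign_of sg t w * (hit delay step k t w)%:R| <= 2 * delta].
  by near: x.
have mE : measurable (exceedX x) by exact: measurable_exceed.
split => //.
have mA := mmain x.
set pE := fine (P (exceedX x)); set pA := fine (P (main_event y delay q x)).
set pB := fine (P Bad).
have pBE : pB <= kap * pE.
  by rewrite /pB /pE -lee_fin EFinM !fineK ?fin_num_measure.
have pE0 : 0 <= pE by exact: fine_ge0.
have pt w : `|U x w - W x w| <= eps / 2 * \1_(exceedX x) w + 2 * M * \1_Bad w.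
  have [Bw|nB] := pselect (Bad w).
    rewrite [\1_Bad w]indicE mem_set // mulr1.
    apply: le_trans (ler_normB _ _) _; have := U_le x w; have := W_le x w.
    have : 0 <= eps / 2 * \1_(exceedX x) w :> R by rewrite mulr_ge0 // ltW.
    lra.
  rewrite [\1_Bad w]indicE memNset // mulr0 addr0.
  have [Ew|nE] := pselect (exceedX x w); last first.
    rewrite W_nomain; last by move=> /(HE w nB).
    by rewrite /U indicE memNset // !mul0r subr0 normr0 mulr0.
  have [t mt] := (HE w nB).1 Ew; have [b sb] := sign_bool_ex (sign_of1 sg1 t w).
  rewrite (W_main mt sb) /U indicE mem_set // mul1r mulr1.
  apply: Hdl => k; rewrite !mxE /=; have := HX w nB t mt k; rewrite -ltnS ltn_ord => /(_ isT).
  have [_ sz /andP[ed _] _ _] := mt.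
  rewrite (hit_bits step k ed) sz sb; lra.
have iU := bounded_integrable P (mU x) (U_le x).
have iW := bounded_integrable P (mW x) (W_le x).
have UW : `|\int[P]_w U x w - \int[P]_w W x w| <= eps / 2 * pE + 2 * M * pB.
  rewrite -RintegralB //.
  apply: le_trans (le_normr_Rintegral _ _) _ => //.
    by have := integrableB measurableT iU iW.
  have bUW w : `|(`|U x w - W x w|)| <= M + M.
    by rewrite normr_id; apply: le_trans (ler_normB _ _) (lerD (U_le x w) (W_le x w)).
  have mUW : measurable_fun setT (fun w => `|U x w - W x w|).
    by apply: measurableT_comp => //; exact: measurable_funB.
  pose c (b : bool) := if b then eps / 2 else 2 * M.
  pose D (b : bool) := if b then exceedX x else Bad.
  have mD b : measurable (D b) by case: b.
  have -> : eps / 2 * pE + 2 * M * pB = \int[P]_w (\sum_b c b * \1_(D b) w).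
    by rewrite Rintegral_indic_sum // big_bool.
  apply: le_Rintegral => //.
  - exact: bounded_integrable mUW bUW.
  - apply: (@bounded_integrable _ _ _ _ _ (\sum_b `|c b|)).
      by apply: measurable_sum => b; apply: measurable_funM.
    move=> w; apply: le_trans (ler_norm_sum _ _ _) _; apply: ler_sum => b _.
    by rewrite normrM indicE; case: (w \in _); rewrite ?normr1 ?normr0 ?mulr1 ?mulr0.
  - by move=> w _; rewrite big_bool; exact: pt.
have AE : `|pA - pE| <= pB.
  have sub (A B : set T) : measurable A -> measurable B ->
      (forall w, ~ Bad w -> A w -> B w) -> fine (P A) <= fine (P B) + pB.
    move=> mA' mB' AB; rewrite -lee_fin EFinD !fineK ?fin_num_measure //.
    apply: le_trans (measureU2 _ mB' mBad); apply: le_measure; rewrite ?inE //.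
      exact: measurableU.
    by move=> w Aw; have [|nB] := pselect (Bad w); [right|left; exact: AB].
  rewrite ler_distl; apply/andP; split.
    rewrite lerBlDr; apply: sub => // w nB /(HE w nB)[t mt].
    by exists t.
  apply: sub => // w nB [t _ mt]; apply/(HE w nB); by exists t.
rewrite mean_W in UW.
have -> : \int[P]_w U x w - Ev * pE = (\int[P]_w U x w - Ev * pA) + Ev * (pA - pE) by ring.
apply: le_trans (ler_normD _ _) _; rewrite normrM.
have h1 : `|Ev| * `|pA - pE| <= `|Ev| * pB by rewrite ler_wpM2l.
have h2 : K * pB <= eps / 2 * pE.
  apply: le_trans (ler_wpM2l (ltW K0) pBE) _.
  by rewrite mulrA [K * kap]mulrC ler_wpM2r.
have pB0 : 0 <= pB by exact: fine_ge0.
apply: le_trans (lerD UW h1) _; move: h2; rewrite /K.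
have -> : (2 * M + `|Ev| + 1) * pB = 2 * M * pB + `|Ev| * pB + pB by ring.
have -> : eps * pE = eps / 2 * pE + eps / 2 * pE by field.
lra.
Unshelve. all: by end_near. Qed.

End conditional_mean.

(** * Integrals with respect to conditional laws *)

Section cond_law_integral.
Context d (T : measurableType d) (R : realType).

(** The complement of [A] is a null set, and on [A] the two measures agree. *)
Lemma ge0_integral_mrestr (m : {measure set T -> \bar R}) (A : set T)
    (mA : measurable A) (f : T -> \bar R) : measurable_fun setT f ->
  (forall w, 0 <= f w)%E -> (\int[mrestr m mA]_w f w = \int[m]_(w in A) f w)%E.
Proof.
move=> mf f0; have mCA : measurable (~` A) by exact: measurableC.
rewrite -(setUv A) ge0_integral_setU //; last 2 first.
- by rewrite setUv.
- exact/disj_setPCl.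
rewrite [X in (_ + X)%E]null_set_integral //; last 2 first.
- exact: measurable_funTS.
- by rewrite /= /mrestr setICl measure0.
rewrite adde0; apply: eq_measure_integral => B mB BA.
by rewrite /= /mrestr setIidl.
Qed.

Lemma integral_cond_law (P : probability T R) (A : set T) (n : nat)
    (V : T -> 'rV[R]_n) (g : 'rV[R]_n -> R) (M : R) : measurable A ->
  measurable_fun setT (V : T -> borel_rV R n) ->
  measurable_fun setT (g : borel_rV R n -> R) -> (forall v, `|g v| <= M) ->
  (\int[cond_law P A V]_v (g v)%:E =
   ((fine (P A))^-1 * \int[P]_w (\1_A w * g (V w))%R)%:E)%E.
Proof.
move=> mA mV mg gM.
have c0 : 0 <= (fine (P A))^-1 by rewrite invr_ge0 fine_ge0.
pose Q : {measure set (borel_rV R n) -> \bar R} :=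
  mscale (NngNum c0) (pushforward (mrestr P mA) (V : T -> borel_rV R n)).
have -> : cond_law P A V = Q mV.
  by apply/funext => B; rewrite /cond_law /Q /= /mscale /= /pushforward /mrestr muleC.
have mgV : measurable_fun setT (fun w => g (V w)) by exact: measurableT_comp mg mV.
have ig : P.-integrable A (EFin \o (fun w => g (V w))).
  apply: (@integrableS _ _ _ _ setT) => //.
  by apply: (bounded_integrable P mgV) => w; exact: gM.
pose gE : borel_rV R n -> \bar R := EFin \o g.
have mgE : measurable_fun setT gE by exact/measurable_EFinP.
have part (f : borel_rV R n -> \bar R) : measurable_fun setT f -> (forall v, 0 <= f v)%E ->
    (\int[Q mV]_v f v = ((fine (P A))^-1)%:E * \int[P]_(w in A) f (V w))%E.
  move=> mf f0; rewrite ge0_integral_mscale //; congr (_ * _)%E.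
  rewrite ge0_integral_pushforward // preimage_setT ge0_integral_mrestr //.
  - exact: measurableT_comp mf mV.
  - by move=> w; exact: f0.
have fin2 : (\int[P]_(w in A) gE^\- (V w))%E \is a fin_num.
  rewrite (eq_integral (EFin \o (fun w => g (V w)))^\-%E); last first.
    by move=> w _; rewrite !funenegE.
  exact: integrable_neg_fin_num.
have split_A : (\int[P]_(w in A) (g (V w))%:E =
    \int[P]_(w in A) gE^\+ (V w) - \int[P]_(w in A) gE^\- (V w))%E.
  rewrite (integralE P A (fun w => (g (V w))%:E)).
  by congr (_ - _)%E; apply: eq_integral => w _; rewrite ?funeposE ?funenegE.
transitivity (\int[Q mV]_v gE v)%E; first by [].
rewrite integralE !part //; last 2 first.
- exact: measurable_funeneg.
- exact: measurable_funepos.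
rewrite -muleBr //; last by apply: fin_num_adde_defl; rewrite fin_numN.
rewrite -split_A EFinM; congr (_ * _)%E.
rewrite /Rintegral fineK; last first.
  apply: integrable_fin_num => //.
  apply: (@bounded_integrable _ _ _ _ _ M).
    by apply: measurable_funM => //; exact: measurable_indic.
  move=> w; rewrite normrM indicE; apply: le_trans (gM (V w)).
  by rewrite ler_piMl //; case: (w \in A); rewrite ?normr1 ?normr0.
rewrite [LHS]integral_mkcond; congr integral; apply/funext => w.
by rewrite patchE indicE; case: ifP => _; rewrite ?mul1r ?mul0r.
Qed.

End cond_law_integral.

(** * The sign variables *)

(** Any enumeration will do: the limit of the series does not depend on it. *)
Lemma sorted_tuples_enum (q : nat) : exists e : nat -> q.+1.-tuple nat,
  set_bij [set: nat] [set t : q.+1.-tuple nat | sorted ltn t] e.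
Proof.
have inf : infinite_set [set t : q.+1.-tuple nat | sorted ltn t].
  apply: (@sub_infinite_set _ (range (fun k => iota_tuple q.+1 k))).
    by move=> _ [k _ <-]; exact: iota_ltn_sorted.
  apply/infiniteP; rewrite (card_le_eqr (@inj_card_eq _ _ setT _ _)) ?card_lexx //.
  by move=> k k' _ _ /(congr1 (fun t : q.+1.-tuple nat => head 0%N t)).
have /card_esym/card_set_bijP[e eb] : ([set t : q.+1.-tuple nat | sorted ltn t] #= [set: nat])%card.
  by apply: eq_card_nat => //; exact: countableP.
by exists e.
Qed.

Section sign_values.
Context d (T : measurableType d) (R : realType) (P : probability T R).
Context (eps : T -> R).
Hypothesis meps : measurable_fun setT eps.

(** A Rademacher variable may take other values on a null set; this version is a
   sign everywhere and almost surely unchanged. *)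
Definition sign_value (r : R) : R := 2 * \1_[set 1] r - 1.

Lemma sign_value1 r : sign_value r = 1 \/ sign_value r = -1.
Proof.
rewrite /sign_value indicE; case: (r \in _).
  by left; rewrite mulr1; lra.
by right; rewrite mulr0; lra.
Qed.

Lemma measurable_sign_value : measurable_fun setT sign_value.
Proof.
by apply: measurable_funB => //; apply: measurable_funM => //; exact: measurable_indic.
Qed.

Lemma sign_value_eq1 r : sign_value r = 1 <-> r = 1.
Proof.
rewrite /sign_value indicE; split => [|->]; last by rewrite mem_set // mulr1; lra.
have [->//|/= r1] := eqVneq r 1; rewrite memNset ?mulr0 /=; last by move=> e; rewrite e eqxx in r1.
lra.
Qed.

Lemma rademacher_ae : rademacher P eps -> {ae P, forall w, eps w = sign_value (eps w)}.
Proof.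
move=> [h1 h2].
pose A := eps @^-1` [set 1] `|` eps @^-1` [set -1].
have m1 : measurable (eps @^-1` [set 1]) by rewrite -[X in measurable X]setTI; exact: meps.
have m2 : measurable (eps @^-1` [set -1]) by rewrite -[X in measurable X]setTI; exact: meps.
have n1 : (1 : R) != -1 by rewrite -addr_eq0 -mulr2n pnatr_eq0.
have PA : P A = 1%E.
  rewrite measureU //; last by apply/seteqP; split => // w [/= -> /eqP]; rewrite (negbTE n1).
  by rewrite [X in (X + _)%E]h1 [X in (_ + X)%E]h2 -EFinD; congr (_%:E); lra.
exists (~` A); split; first by apply: measurableC; exact: measurableU.
  by rewrite probability_setC ?PA ?subee //; exact: measurableU.
move=> w /= h [e|e]; apply: h; rewrite e /sign_value indicE.
  by rewrite mem_set // mulr1; lra.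
rewrite memNset ?mulr0 /=; last by move=> /esym/eqP; rewrite (negbTE n1).
lra.
Qed.

End sign_values.

(** * The limit law *)

Section limit_law.
Context d (T : measurableType d) (R : realType) (P : probability T R).
Context (nu : probability nat R) (p m : nat).
Context (step : 'I_p -> nat -> T -> nat) (eps : T -> R).
Hypothesis nu0 : nu [set 0%N] = 0%E.
Hypothesis mstep : forall r j, measurable_fun setT (step r j).
Hypothesis meps : measurable_fun setT eps.
Hypothesis step_law : forall r j, has_law P (step r j) nu.
Hypothesis step_indep : mutually_independent P
  (fun rj : 'I_p * nat => sigma_rv (step rj.1 rj.2)).
Hypothesis eps_law : rademacher P eps.
Hypothesis eps_indep : mutually_independent P
  (fun b : bool => if b then sigma_rv eps else sigma_rvs (theta_star R step)).

Let bits w := renewal_bits m (fun r j => step r j w).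

Lemma theta_star_bits (k : 'I_m.+1) w : theta_star R step k w = (bits w k)%:R.
Proof.
rewrite /theta_star indicE ffunE; congr (_%:R); congr nat_of_bool.
apply/idP/forallP => [/set_mem h r|h].
  by apply/asboolP; exact: h.
by apply/mem_set => r _; have /asboolP := h r.
Qed.

Lemma renewal_bits_mass v :
  P [set w | bits w = v] = (bits_mass nu p v)%:E.
Proof.
rewrite -[X in P X]setTI.
rewrite (@renewal_bits_law _ nu p m _ _ P step mstep).
- by rewrite probability_setT mul1r.
- by move=> r j; rewrite -nu0 -(step_law r j).
- exact: measurableT.
move=> B; rewrite setTI probability_setT mul1r.
pose h (rj : 'I_p * 'I_m) : 'I_p * nat := (rj.1, val rj.2).
pose E (rj : 'I_p * nat) : set T := step rj.1 rj.2 @^-1`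
  (if (insub rj.2 : option 'I_m) is Some j then B (rj.1, j) else setT).
have EJ rj : E (h rj) = step rj.1 rj.2 @^-1` B rj.
  by rewrite /E /= valK; case: rj.
have inj : injective h by move=> [r j] [r' j'] [-> /val_inj ->].
have uJ : uniq [seq h rj | rj <- enum {: 'I_p * 'I_m}].
  by rewrite map_inj_uniq // enum_uniq.
have := step_indep uJ (E := E); rewrite big_map big_enum /=.
rewrite (_ : \bigcap_(i in [set` _]) E i =
    \bigcap_(rj in [set: 'I_p * 'I_m]) (step rj.1 rj.2 @^-1` B rj)).
  move=> ->; last first.
    by move=> _ /mapP[rj _ ->]; rewrite EJ; exists (B rj) => //; rewrite setTI.
  by apply: eq_bigr => rj _; rewrite EJ; congr fine; exact: step_law.
apply/seteqP; split => w H.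
  by move=> rj _; rewrite -EJ; apply: H; apply/mapP; exists rj; rewrite ?mem_enum.
by move=> _ /= /mapP[rj _ ->]; rewrite EJ; exact: H.
Qed.

Lemma bits_theta v : sigma_rvs (theta_star R step) [set w | bits w = v].
Proof.
pose T' : Type := g_sigma_algebraType
  (\bigcup_(k in [set: nat]) sigma_rv (theta_star R step k)).
suff : measurable ([set w | bits w = v] : set T') by [].
rewrite (_ : [set w | _] = \bigcap_(k in [set: 'I_m.+1])
    theta_star R step k @^-1` [set (v k)%:R]).
  apply: fin_bigcap_measurable; first exact: finite_finset.
  move=> k _; apply: sub_sigma_algebra; exists (k : nat) => //.
  by exists [set (v k)%:R] => //; rewrite setTI.
apply/seteqP; split => w.
  by move=> /= <- k _ /=; rewrite theta_star_bits.
move=> H; apply/ffunP => k; have := H k I; rewrite /= theta_star_bits => /eqP.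
by rewrite eqr_nat; case: (bits w k); case: (v k).
Qed.

Let H (bv : bool * {ffun 'I_m.+1 -> bool}) : set T :=
  eps @^-1` [set sign_bool R bv.1] `&` [set w | bits w = bv.2].

Let mH bv : measurable (H bv).
Proof.
apply: measurableI; last exact: measurable_renewal_bits.
by rewrite -[X in measurable X]setTI; exact: meps.
Qed.

Let PH bv : fine (P (H bv)) = 2^-1 * bits_mass nu p bv.2.
Proof.
pose E (b : bool) : set T := if b then eps @^-1` [set sign_bool R bv.1] else [set w | bits w = bv.2].
have := eps_indep (J := [:: true; false]) (E := E) isT.
rewrite (_ : \bigcap_(i in _) _ = H bv); last first.
  by apply/seteqP; split => w; [move=> h; split; [exact: (h true)|exact: (h false)]|
    move=> [? ?] [] _].
move=> ->; last first.
  move=> [] _; last exact: bits_theta.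
  by exists [set sign_bool R bv.1] => //; rewrite setTI.
rewrite !big_cons big_nil mulr1 /E renewal_bits_mass; congr (_ * _).
by case: (bv.1); rewrite /sign_bool /= ?expr0 ?expr1; [rewrite eps_law.2|rewrite eps_law.1].
Qed.

(** Almost surely the row is one of the finitely many signed rows, whose
   probabilities are products by independence. *)
Lemma limit_mean (g : 'rV[R]_m.+1 -> R) (M : R) : continuous g ->
  (forall v, `|g v| <= M) ->
  (\int[law P (fun w => \row_(k < m.+1) (eps w * theta_star R step k w)%R)]_v (g v)%:E =
   (limit_value nu p g)%:E)%E.
Proof.
move=> cg gM.
pose V w : 'rV[R]_m.+1 := \row_k (eps w * theta_star R step k w).
have mtheta (k : 'I_m.+1) : measurable_fun setT (theta_star R step k).
  rewrite (_ : theta_star R step k = fun w =>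
      \sum_(v : {ffun 'I_m.+1 -> bool}) (v k)%:R * \1_[set w | bits w = v] w).
    apply: measurable_sum => v; apply: measurable_funM => //.
    by apply: measurable_indic; exact: measurable_renewal_bits.
  apply/funext => w; rewrite theta_star_bits (bigD1 (bits w)) //= indicE mem_set // mulr1.
  rewrite big1 ?addr0 // => v vb; rewrite indicE memNset ?mulr0 // => /= e.
  by rewrite e eqxx in vb.
have mV : measurable_fun setT (V : T -> borel_rV R m.+1).
  apply: measurable_row => j; rewrite /V; under eq_fun do rewrite mxE.
  exact: measurable_funM.
have mg := continuous_measurable_rV cg.
have mgV : measurable_fun setT (fun w => g (V w)) by exact: measurableT_comp mg mV.
have igV : P.-integrable setT (EFin \o (fun w => g (V w))).
  by apply: (bounded_integrable P mgV) => w; exact: gM.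
have mgE : measurable_fun setT (EFin \o g : borel_rV R m.+1 -> \bar R).
  exact/measurable_EFinP.
have e1 := integral_pushforward mV mgE igV measurableT.
rewrite [LHS]e1 preimage_setT.
pose W w := \sum_bv g (signed_row R bv) * \1_(H bv) w.
have mW : measurable_fun setT W.
  by apply: measurable_sum => bv; apply: measurable_funM => //; exact: measurable_indic.
have -> : limit_value nu p g = \int[P]_w W w.
  by rewrite Rintegral_indic_sum //; apply: eq_bigr => bv _; rewrite PH.
have bW w : `|W w| <= \sum_bv `|g (signed_row R bv)|.
  apply: le_trans (ler_norm_sum _ _ _) _; apply: ler_sum => bv _.
  by rewrite normrM indicE; case: (w \in _); rewrite ?normr1 ?normr0 ?mulr1 ?mulr0.
rewrite /Rintegral fineK; last exact: integrable_fin_num (bounded_integrable P mW bW).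
apply: ae_eq_integral => //.
- exact/measurable_EFinP.
- exact/measurable_EFinP.
have := rademacher_ae meps eps_law; apply: filterS => w ew _ /=; congr (_%:E).
have [b sb] := sign_bool_ex (sign_value1 (eps w)); rewrite sb in ew.
rewrite /W (bigD1 (b, bits w)) //= indicE mem_set // mulr1 big1 ?addr0.
  by congr g; apply/rowP => k; rewrite !mxE theta_star_bits ew.
move=> bv bvn; rewrite indicE memNset ?mulr0 // => -[/= e2 e3].
by case/eqP: bvn; rewrite e3; move: e2; rewrite ew => /sign_bool_inj ->; case: (bv).
Qed.

End limit_law.

(** * Convergence of the conditional laws *)

Section sign_value_sources.
Context d (T : measurableType d) (R : realType) (P : probability T R).
Context (y : nat -> T -> R) (delay : nat -> T -> nat)
  (step : nat -> nat -> T -> nat) (eps : nat -> T -> R).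

Let sg i w := sign_value (eps i w).

Lemma sign_value_indep : mutually_independent P (sources y delay step eps) ->
  mutually_independent P (sources y delay step sg).
Proof.
move=> ind J E uJ JE; apply: ind => // s /JE; case: s => [[]|[[i j]|i]] //=.
move=> [B mB <-]; exists (@sign_value R @^-1` B) => //.
by rewrite -[X in measurable X]setTI; exact: measurable_sign_value.
Qed.

Lemma sign_value_series (p k : nat) (X : T -> R) (e : nat -> p.-tuple nat) :
  (forall i, measurable_fun setT (eps i)) -> (forall i, rademacher P (eps i)) ->
  {ae P, forall w,
    \sum_(0 <= l < n) series_term y delay step eps k (e l) w @[n --> \oo] --> X w} ->
  {ae P, forall w,
    \sum_(0 <= l < n) series_term y delay step sg k (e l) w @[n --> \oo] --> X w}.
Proof.
move=> meps heps.
have all_sg : {ae P, forall w, forall i, eps i w = sg i w}.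
  apply/ae_foralln => i; exact: rademacher_ae.
apply: filterS2 all_sg => w ew cv.
rewrite (_ : (fun n => _) = fun n =>
  \sum_(0 <= l < n) series_term y delay step eps k (e l) w) //.
apply/funext => n; apply: eq_bigr => l _; rewrite /series_term; congr (_ * _ * _).
by apply: eq_bigr => i _; rewrite ew.
Qed.

End sign_value_sources.

Section same_rows.
Context d d' (T : measurableType d) (T' : measurableType d') (R : realType).
Context (P : probability T R) (P' : probability T' R) (m : nat).
Context (X : nat -> T -> R) (X' : nat -> T' -> R).
Hypothesis mX : forall k, measurable_fun setT (X k).
Hypothesis mX' : forall k, measurable_fun setT (X' k).
Hypothesis same : has_law P ((fun w => \row_(k < m.+1) X k w) : T -> borel_rV R m.+1)
  (law P' (fun w => \row_(k < m.+1) X' k w)).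

Let coord (k : nat) (v : borel_rV R m.+1) : R := (v : 'rV[R]_m.+1) 0 (inord k).

Let mcoord k : measurable_fun setT (coord k).
Proof. by apply: continuous_measurable_rV => v; exact: coord_continuous. Qed.

Let row e (S : measurableType e) (Z : nat -> S -> R) (w : S) : borel_rV R m.+1 :=
  \row_(k < m.+1) Z k w.

(** Conditioning event and ratios are read off the row itself, by applying the
   same definitions to the coordinates as random variables on the space of
   rows. *)
Let exceed_row e (S : measurableType e) (Z : nat -> S -> R) x w :
  exceed coord x (row Z w) = exceed Z x w.
Proof. by rewrite /exceed /= /coord /row mxE inordK. Qed.

Let ratio_row_row e (S : measurableType e) (Z : nat -> S -> R) w :
  ratio_row m coord (row Z w) = ratio_row m Z w.
Proof. by apply/rowP => k; rewrite !mxE /coord /row !mxE inord_val inordK. Qed.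

Lemma same_rows_exceed x : P (exceed X x) = P' (exceed X' x).
Proof.
have := same (measurable_exceed mcoord x); rewrite /law /pushforward.
rewrite (_ : _ @^-1` _ = exceed X x).
  by move=> ->; congr (P' _); apply/funext => w; exact: exceed_row.
by apply/funext => w; exact: exceed_row.
Qed.

Lemma same_rows_mean x (g : 'rV[R]_m.+1 -> R) (M : R) : continuous g ->
  (forall v, `|g v| <= M) ->
  \int[P]_w (\1_(exceed X x) w * g (ratio_row m X w)) =
  \int[P']_w (\1_(exceed X' x) w * g (ratio_row m X' w)).
Proof.
move=> cg gM; rewrite /Rintegral; congr fine.
pose psi (v : borel_rV R m.+1) : R := \1_(exceed coord x) v * g (ratio_row m coord v).
have psiE e (S : measurableType e) (Z : nat -> S -> R) w :
    \1_(exceed Z x) w * g (ratio_row m Z w) = psi (row Z w).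
  rewrite /psi ratio_row_row !indicE; congr (_%:R * _); congr nat_of_bool.
  by apply/idP/idP => /set_mem h; apply/mem_set; rewrite ?exceed_row // -exceed_row.
have mpsi : measurable_fun setT psi.
  apply: measurable_funM; last exact: measurable_g_ratio mcoord _ cg.
  by apply: measurable_indic; exact: measurable_exceed.
have mrow e (S : measurableType e) (Z : nat -> S -> R) :
    (forall k, measurable_fun setT (Z k)) -> measurable_fun setT (row Z).
  by move=> mZ; apply: measurable_row => j; under eq_fun do rewrite mxE; exact: mZ.
have psiM v : `|psi v| <= M.
  rewrite normrM indicE; apply: le_trans (gM (ratio_row m coord v)).
  by rewrite ler_piMl //; case: (v \in _); rewrite ?normr1 ?normr0.
under eq_integral do rewrite psiE.
under [RHS]eq_integral do rewrite psiE.
apply: (@same_law_integral _ _ _ _ _ _ _ _ _ M).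
- exact: measurableT_comp mpsi (mrow _ _ _ mX).
- exact: measurableT_comp mpsi (mrow _ _ _ mX').
- by move=> w; exact: psiM.
- by move=> w; exact: psiM.
move=> B mB; apply: (same (B := psi @^-1` B)).
by rewrite -[X in measurable X]setTI; exact: mpsi.
Qed.

End same_rows.

Theorem theorem1p1 (R : realType) (alpha beta : R) (p : nat)
  (nu : probability nat R)
  (halpha : 0 < alpha < 2) (hbeta : 0 < beta < 1) (hp : (0 < p)%N)
  (hnu : interrenewal_law beta nu)
  (d : measure_display) (T : measurableType d) (P : probability T R)
  (X : nat -> {RV P >-> R})
  (hX : multiple_stable_process alpha p nu X)
  (d' : measure_display) (T' : measurableType d') (P' : probability T' R)
  (step : 'I_p -> nat -> {RV P' >-> nat}) (eps : {RV P' >-> R})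
  (hstep_law : forall r j, has_law P' (step r j) nu)
  (hstep_indep : mutually_independent P'
     (fun rj : 'I_p * nat => sigma_rv (step rj.1 rj.2 : T' -> nat)))
  (heps : rademacher P' eps)
  (heps_indep : mutually_independent P'
     (fun b : bool => if b then sigma_rv (eps : T' -> R) else
        sigma_rvs (theta_star R (fun r j => step r j : T' -> nat))))
  (m : nat) (hm : (0 < m)%N) :
  weak_cvg
    (fun x : R => cond_law P [set w | x < `|X 0%N w|]
       (fun w => \row_(k < m.+1) (X k w / `|X 0%N w|)))
    (+oo)
    (law P' (fun w => \row_(k < m.+1)
       (eps w * theta_star R (fun r j => step r j : T' -> nat) k w))).
Proof.
case: p hp hX step hstep_law hstep_indep heps_indep => // q _ hX step hstep_law hstep_indep heps_indep.
have nu0 : nu [set 0%N] = 0%E by case: hnu.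
have /andP[alpha0 alpha2] := halpha.
move=> g cg [M gM].
rewrite (@limit_mean _ _ _ P' nu q.+1 m (fun r j => step r j : T' -> nat) eps nu0 _ _
  hstep_law hstep_indep heps heps_indep g M cg gM) //.
have [d0 [T0 [P0 [y [delay [st [ep [X0 [ser same]]]]]]]]] := hX.
have [y0 ppp st_law ep_law ind cv] := ser.
have [e e_bij] := sorted_tuples_enum q.
pose sg i w := sign_value (ep i w).
have msg i : measurable_fun setT (sg i).
  by apply: measurableT_comp => //; exact: measurable_sign_value.
have sg_half i : P0 (sg i @^-1` [set 1]) = (2^-1)%:E.
  rewrite -(ep_law i).1; congr (P0 _); apply/seteqP.
  by split => w /= /sign_value_eq1.
have near0 := @conditional_mean_near _ T0 R P0 alpha nu (fun i => y i : T0 -> R)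
  (fun i => delay i : T0 -> nat) (fun i j => st i j : T0 -> nat) sg alpha0 alpha2 nu0
  (fun i => measurable_funPT (y i)) (fun i => measurable_funPT (delay i))
  (fun i j => measurable_funPT (st i j)) msg y0 (fun i w => sign_value1 (ep i w)) sg_half
  (sign_value_indep ind) st_law ppp q m e e_bij (fun k => X0 k : T0 -> R)
  (fun k => measurable_funPT (X0 k))
  (fun k => sign_value_series (fun i => measurable_funPT (ep i)) ep_law (cv k e e_bij)) g M cg gM.
have mX k : measurable_fun setT (X k : T -> R) by exact: measurable_funPT.
pose I x := \int[P]_w (\1_(exceed (fun k => X k : T -> R) x) w *
  g (ratio_row m (fun k => X k : T -> R) w)).
have condE x : (\int[cond_law P [set w | (x < `|X 0%N w|)%R]
      (fun w => \row_(k < m.+1) (X k w / `|X 0%N w|)%R)]_v (g v)%:E =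
    ((fine (P (exceed (fun k => X k : T -> R) x)))^-1 * I x)%:E)%E.
  exact: (integral_cond_law P (measurable_exceed mX x) (@measurable_ratio_row _ T R m _ mX)
    (continuous_measurable_rV cg) gM).
rewrite (_ : (fun x => _) = fun x => ((fine (P (exceed (fun k => X k : T -> R) x)))^-1 * I x)%:E).
  apply: cvg_EFin; first by near=> x.
  apply/cvgrPdist_le => eta eta0; have := near0 eta eta0; apply: filterS => x [PE0 h].
  have eqP := @same_rows_exceed _ _ T T0 R P P0 m (fun k => X k : T -> R)
    (fun k => X0 k : T0 -> R) (same m.+1) x.
  have eqI := @same_rows_mean _ _ T T0 R P P0 m (fun k => X k : T -> R)
    (fun k => X0 k : T0 -> R) (fun k => measurable_funPT (X k))
    (fun k => measurable_funPT (X0 k)) (same m.+1) x g M cg gM.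
  rewrite /= /I eqI eqP; set I0 := Rintegral _ _ _ in h *.
  set b := fine _ in h *.
  have b0 : 0 < b by rewrite fine_gt0 // PE0 /= (le_lt_trans (probability_le1 _ _)) ?ltry //; exact: measurable_exceed.
  rewrite distrC (_ : _ - _ = (I0 - limit_value nu q.+1 g * b) / b); last by field; rewrite gt_eqF.
  by rewrite normrM normfV (gtr0_norm b0) ler_pdivrMr.
by apply/funext => x; exact: condE.
Unshelve. all: by end_near. Qed.
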